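(* Let $n\ge 1$ and $m \ge 1$ be integers, let $\Omega\subset\mathbb{R}^n$ be a bounded domain with Lipschitz boundary, and let $f\in L^2(\mathcal{S}^m;\mathbb{R}^n)$ have support contained in $\Omega$. Let $f = du + {}^s f$ be the Helmholtz decomposition of $f$ on $\mathbb{R}^n$, and let $f|_\Omega = du_\Omega + {}^s f_\Omega + dh_\Omega$ be the Helmholtz decomposition of $f$ on $\Omega$ (both as defined in the context). (i) If the harmonic part vanishes, i.e. $dh_\Omega = 0$, then ${}^s f$ and $u$ are equal to the extensions by zero to $\mathbb{R}^n$ of ${}^s f_\Omega$ and $u_\Omega$ respectively. (ii) Conversely, if ${}^s f$ and $u$ are supported in $\Omega$, then the harmonic part vanishes, i.e. $dh_\Omega = 0$.
   Context: Notation. For an open set $U\subset\mathbb{R}^n$ with Lipschitz boundary (possibly $U=\mathbb{R}^n$), $L^2(\mathcal{S}^m;U)$ is the space of square-integrable symmetric tensor fields of rank $m$ on $U$; $H^1(\mathcal{S}^m;U)$ is the Sobolev space of such fields with square-integrable first weak derivatives; $\mathcal{C}_c^\infty(\mathcal{S}^m;U)$ is the space of smooth compactly supported symmetric $m$-tensor fields on $U$ (for $m=0$ these are scalar functions). Repeated indices are summed. The symmetric gradient $d$ maps symmetric $m$-tensor fields to symmetric $(m+1)$-tensor fields: $du$ is the full symmetrisation of $\partial u_{i_1\dots i_m}/\partial x_{i_{m+1}}$ over all indices (the gradient when $m=0$; $(du)_{ij}=\tfrac12(\partial_j u_i+\partial_i u_j)$ when $m=1$). The divergence $\mathrm{Div}$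 maps symmetric $(m+1)$-tensor fields to symmetric $m$-tensor fields, $(\mathrm{Div} f)_{i_1\dots i_m}=\partial f_{i_1\dots i_m j}/\partial x_j$; it is the formal adjoint of $-d$. Both are understood in the distributional sense. A field is solenoidal (divergence-free) if its divergence is zero. $\dot H^1_0(\mathcal{S}^{m};U)$ is the closure of $\mathcal{C}_c^\infty(\mathcal{S}^{m};U)$ in the norm $\|u\|=\|du\|_{L^2(\mathcal{S}^{m+1};U)}$. Helmholtz decomposition on $\mathbb{R}^n$: every $f\in L^2(\mathcal{S}^m;\mathbb{R}^n)$, $m\ge1$, can be written uniquely as $f = du+{}^s f$ with $u\in\dot H^1_0(\mathcal{S}^{m-1};\mathbb{R}^n)$ and ${}^sf\in L^2(\mathcal{S}^m;\mathbb{R}^n)$ with $\mathrm{Div}({}^sf)=0$ in the sense of distributions on $\mathbb{R}^n$. Helmholtz decomposition on a bounded Lipschitz domain $\Omega$: every $f\in L^2(\mathcal{S}^m;\mathbb{R}^n)$, $m\ge1$, restricted to $\Omega$ can be written uniquely as $f = du_\Omega+{}^sf_\Omega+dh_\Omega$ on $\Omega$, where $u_\Omega\in\dot H^1_0(\mathcal{S}^{m-1};\Omega)$; $h_\Omega\in H^1(\mathcal{S}^{m-1};\Omega)$ satisfies $\mathrm{Div}(dh_\Omega)=0$ on $\Omega$; and ${}^sf_\Omega\in L^2(\mathcal{S}^m;\Omega)$ satisfies $$\int_\Omega ({}^sf_\Omega)_{i_1\dots i_m}\frac{\partial\varphi_{i_1\dots i_{m-1}}}{\partial x_{i_m}}\,\mathrm{d}x=0\qquad\text{for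 all }\varphi\in H^1(\mathcal{S}^{m-1};\Omega).$$ Uniqueness refers to the three components $du_\Omega$, ${}^sf_\Omega$, $dh_\Omega$ (and $u_\Omega$); $h_\Omega$ itself is determined only modulo the kernel of $d$. *)

(* Defs.v *)
From HB Require Import structures.
From mathcomp Require Import all_boot all_order all_algebra all_fingroup.
From mathcomp Require Import all_classical all_reals all_analysis.

Set Implicit Arguments.
Unset Strict Implicit.
Unset Printing Implicit Defensive.
Import Order.TTheory GRing.Theory Num.Theory.
Import numFieldNormedType.Exports.
Local Open Scope classical_set_scope.
Local Open Scope ring_scope.

Definition rV_display : measure_display.
Proof. exact: default_measure_display. Qed.

(* 'rV[R]_n carries the sigma-algebra generated by the coordinates (as the
   library does for n.-tuple); it is the Borel sigma-algebra of R^n. *)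
Section rV_measurable.
Context {R : realType} (n : nat).

Let coor (i : 'I_n) (x : 'rV[R]_n) : measurableTypeR R := x ord0 i.

Let rV_set0 : g_sigma_preimage coor set0.
Proof. exact: sigma_algebra0. Qed.

Let rV_setC A : g_sigma_preimage coor A -> g_sigma_preimage coor (~` A).
Proof. exact: sigma_algebraC. Qed.

Let rV_bigcup (F : (set 'rV[R]_n)^nat) :
  (forall i, g_sigma_preimage coor (F i)) ->
  g_sigma_preimage coor (\bigcup_i (F i)).
Proof. exact: sigma_algebra_bigcup. Qed.

HB.instance Definition _ := @isMeasurable.Build rV_display
  'rV[R]_n (g_sigma_preimage coor) rV_set0 rV_setC rV_bigcup.

Lemma measurable_coor (i : 'I_n) :
  measurable_fun [set: 'rV[R]_n]
    (fun x : 'rV[R]_n => x ord0 i : measurableTypeR R).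
Proof.
move=> _ Y mY; rewrite setTI; apply: sub_sigma_algebra => /=.
rewrite -bigcup_seq/=; exists i => /=; first by rewrite mem_index_enum.
by exists Y => //; rewrite setTI.
Qed.

Lemma measurable_fun_rV d (T : measurableType d) (f : T -> 'rV[R]_n) :
  (forall i, measurable_fun [set: T]
     (fun t => f t ord0 i : measurableTypeR R)) ->
  measurable_fun [set: T] f.
Proof.
move=> mf; suff: g_sigma_preimage (fun i => coor i \o f) `<=` measurable.
  rewrite g_sigma_preimage_comp => H _ A mA.
  by apply: H; exists A.
apply: smallest_sub; first exact: sigma_algebra_measurable.
rewrite -bigcup_seq; apply: bigcup_sub => i _ A [B mB <-].
exact: mf.
Qed.

End rV_measurable.

Definition rV_cons {R : realType} (n : nat)
    (p : measurableTypeR R * 'rV[R]_n) : 'rV[R]_n.+1 :=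
  \row_i (if unlift ord0 i is Some j then p.2 ord0 j else p.1).

Definition rV_uncons {R : realType} (n : nat) (x : 'rV[R]_n.+1) :
    measurableTypeR R * 'rV[R]_n :=
  (x ord0 ord0, \row_j x ord0 (lift ord0 j)).

Lemma rV_consK {R : realType} n : cancel (@rV_cons R n) (@rV_uncons R n).
Proof.
case=> a v; rewrite /rV_uncons /rV_cons; congr pair.
  by rewrite mxE unlift_none.
by apply/rowP => j; rewrite !mxE liftK.
Qed.

Lemma measurable_rV_cons {R : realType} n :
  measurable_fun setT (@rV_cons R n).
Proof.
apply: measurable_fun_rV => i; rewrite /rV_cons.
under eq_fun do rewrite mxE.
case: (unlift ord0 i) => [j|]; last exact: measurable_fst.
exact: (measurableT_comp (measurable_coor j) measurable_snd).
Qed.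

Lemma measurable_rV_uncons {R : realType} n :
  measurable_fun setT (@rV_uncons R n).
Proof.
apply: measurable_fun_pair => /=; first exact: measurable_coor.
apply: measurable_fun_rV => i; under eq_fun do rewrite mxE.
exact: measurable_coor.
Qed.

Section lebesgue_step.
Context {R : realType} (n : nat).
Variable mu : {sigma_finite_measure set 'rV[R]_n -> \bar R}.

Definition leb_step : set 'rV[R]_n.+1 -> \bar R :=
  pushforward (@lebesgue_measure R \x mu)%E (@rV_cons R n).

Let leb_step0 : leb_step set0 = 0%E.
Proof. by rewrite /leb_step /pushforward preimage_set0 measure0. Qed.

Let leb_step_ge0 A : (0 <= leb_step A)%E.
Proof. by rewrite /leb_step /pushforward; exact: measure_ge0. Qed.

Let leb_step_sigma_additive : semi_sigma_additive leb_step.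
Proof.
have mc := @measurable_rV_cons R n.
move=> F mF tF mUF; rewrite /leb_step /pushforward preimage_bigcup.
apply: measure_semi_sigma_additive.
- by move=> k; rewrite -[X in measurable X]setTI; exact: mc.
- apply/trivIsetP => /= i j _ _ ij; rewrite -preimage_setI.
  by move/trivIsetP : tF => /(_ _ _ _ _ ij) ->//; rewrite preimage_set0.
- by rewrite -preimage_bigcup -[X in measurable X]setTI; exact: mc.
Qed.

HB.instance Definition _ := isMeasure.Build _ _ _ leb_step
  leb_step0 leb_step_ge0 leb_step_sigma_additive.

Let leb_step_sigma_finite : sigma_finite setT leb_step.
Proof.
have /sigma_finiteP[F [TF ndF Foo]] := sigma_finiteT (@lebesgue_measure R).
have /sigma_finiteP[G [TG ndG Goo]] := sigma_finiteT mu.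
exists (fun k => @rV_uncons R n @^-1` (F k `*` G k)).
  rewrite predeqE => x; split=> // _.
  have [i _ Fi] : (\bigcup_i F i) (rV_uncons x).1 by rewrite -TF.
  have [j _ Gj] : (\bigcup_i G i) (rV_uncons x).2 by rewrite -TG.
  exists (maxn i j) => //; split.
    by move: Fi; exact/subsetPset/ndF/leq_maxl.
  by move: Gj; exact/subsetPset/ndG/leq_maxr.
move=> k; have [mF Fk] := Foo k; have [mG Gk] := Goo k; split.
  rewrite -[X in measurable X]setTI; apply: measurable_rV_uncons => //.
  exact: measurableX.
rewrite /leb_step /pushforward -comp_preimage.
have -> : @rV_uncons R n \o @rV_cons R n = id.
  by apply/funext => p; exact: rV_consK.
by rewrite preimage_id product_measure1E// lte_mul_pinfty// ge0_fin_numE.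
Qed.

HB.instance Definition _ := Measure_isSigmaFinite.Build _ _ _ leb_step
  leb_step_sigma_finite.

End lebesgue_step.

Fixpoint lebesgue_rV {R : realType} (n : nat) :
    {sigma_finite_measure set 'rV[R]_n -> \bar R} :=
  match n with
  | 0 => @dirac _ 'rV[R]_0 0 R
  | n'.+1 => leb_step (lebesgue_rV n')
  end.

Section test_functions.
Context {R : realType} (n : nat).
Implicit Types (f phi : 'rV[R]_n -> R) (U K : set 'rV[R]_n).

Definition pderive (i : 'I_n) f : 'rV[R]_n -> R :=
  fun x => 'D_(delta_mx ord0 i) f x.

Fixpoint Ck (k : nat) f : Prop :=
  match k with
  | 0 => continuous f
  | k'.+1 => continuous f /\
      forall i, (forall x, derivable f x (delta_mx ord0 i)) /\
                Ck k' (pderive i f)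
  end.

Definition Cinfty f := forall k, Ck k f.

Definition test_fun U phi := Cinfty phi /\
  exists K, [/\ compact K, K `<=` U & forall x, ~ K x -> phi x = 0].

End test_functions.

(* A rank m tensor field is given by its components u x (i_1, ..., i_m).  Fields
   on U are total functions of which only the values on U are ever used. *)

Definition tfield (R : realType) (n m : nat) :=
  'rV[R]_n -> m.-tuple 'I_n -> R.

Section tensor_fields.
Context {R : realType} (n : nat).
Local Notation mu := (@lebesgue_rV R n).
Implicit Types (U K : set 'rV[R]_n) (m : nat).

Definition perm_idx m (s : 'S_m) (I : m.-tuple 'I_n) : m.-tuple 'I_n :=
  [tuple tnth I (s k) | k < m].

Definition idx_front m (I : m.+1.-tuple 'I_n) : m.-tuple 'I_n :=
  [tuple tnth I (widen_ord (leqnSn m) k) | k < m].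

Definition idx_last m (I : m.+1.-tuple 'I_n) : 'I_n := tnth I ord_max.

Definition symmetrisation m (T : m.-tuple 'I_n -> R) (I : m.-tuple 'I_n) : R :=
  (m`!%:R)^-1 * \sum_(s : 'S_m) T (perm_idx s I).

Definition symmetric_on U m (u : tfield R n m) :=
  forall x, U x -> forall (s : 'S_m) I, u x (perm_idx s I) = u x I.

Definition zero_field m : tfield R n m := fun _ _ => 0.

Definition sub_field m (u v : tfield R n m) : tfield R n m :=
  fun x I => u x I - v x I.

Definition ext0 U m (u : tfield R n m) : tfield R n m :=
  fun x I => if x \in U then u x I else 0.

Definition ae_eq_field m (u v : tfield R n m) :=
  {ae mu, forall x, forall I, u x I = v x I}.

Definition supported_in U m (u : tfield R n m) :=
  {ae mu, forall x, ~ U x -> forall I, u x I = 0}.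

Definition test_field U m (phi : tfield R n m) :=
  symmetric_on setT phi /\ forall I, test_fun U (fun x => phi x I).

Definition L2 U m (u : tfield R n m) :=
  symmetric_on U u /\
  forall I, (fun x => u x I) \_ U \in Lfun mu 2%:E.

Definition L2loc U m (u : tfield R n m) :=
  symmetric_on U u /\
  forall K, compact K -> K `<=` U ->
  forall I, (fun x => u x I) \_ K \in Lfun mu 2%:E.

Definition L2dist2 U m (u v : tfield R n m) : \bar R :=
  (\int[mu]_(x in U) (\sum_I (u x I - v x I) ^+ 2)%:E)%E.

Definition sgrad m (phi : tfield R n m) : tfield R n m.+1 := fun x =>
  symmetrisation
    (fun J => pderive (idx_last J) (fun y => phi y (idx_front J)) x).

(* du = g in the sense of distributions on U, componentwise against scalar test
   functions. *)
Definition is_sgrad U m (u : tfield R n m) (g : tfield R n m.+1) :=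
  forall phi, test_fun U phi -> forall I : m.+1.-tuple 'I_n,
    \int[mu]_(x in U) (g x I * phi x) =
    - symmetrisation (fun J =>
        \int[mu]_(x in U) (u x (idx_front J) * pderive (idx_last J) phi x)) I.

Definition is_div U m (f : tfield R n m.+1) (g : tfield R n m) :=
  forall phi, test_fun U phi -> forall I : m.-tuple 'I_n,
    \int[mu]_(x in U) (g x I * phi x) =
    - \sum_(j < n)
        \int[mu]_(x in U) (f x (rcons_tuple I j) * pderive j phi x).

Definition solenoidal U m (f : tfield R n m.+1) := is_div U f (@zero_field m).

Definition weak_grad U m (u : tfield R n m) (D : 'I_n -> tfield R n m) :=
  forall j phi, test_fun U phi -> forall I,
    \int[mu]_(x in U) (D j x I * phi x) =
    - \int[mu]_(x in U) (u x I * pderive j phi x).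

Definition H1_grad U m (u : tfield R n m) (D : 'I_n -> tfield R n m) :=
  [/\ L2 U u, forall j, L2 U (D j) & weak_grad U u D].

Definition H1 U m (u : tfield R n m) := exists D, H1_grad U u D.

(* \dot H^1_0(S^m; U) is the completion of the test fields for the norm
   ||d phi||_{L^2(U)}, realised by functions: u represents the class of a Cauchy
   sequence phi_k of test fields when phi_k --> u in L^2_loc(U); then du is the L^2 limit of d phi_k.
   The representative is unique when U is bounded or n >= 3; when n <= 2 and
   U = R^n, constants have norm zero, and it is unique only up to them. *)
Definition dotH10 U m (u : tfield R n m) :=
  L2loc U u /\
  exists (phi : nat -> tfield R n m) (g : tfield R n m.+1),
    [/\ forall k, test_field U (phi k),
        forall K, compact K -> K `<=` U ->
          L2dist2 K (phi k) u @[k --> \oo] --> 0%E,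
        L2 U g &
        L2dist2 U (sgrad (phi k)) g @[k --> \oo] --> 0%E].

(* u and v represent the same element: ||d(u - v)|| = 0 *)
Definition dotH10_eq U m (u v : tfield R n m) :=
  [/\ dotH10 U u, dotH10 U v & is_sgrad U (sub_field u v) (@zero_field m.+1)].

Definition helmholtz_space m (f : tfield R n m.+1)
    (u : tfield R n m) (sf : tfield R n m.+1) :=
  [/\ dotH10 setT u, L2 setT sf, solenoidal setT sf &
      exists du, [/\ L2 setT du, is_sgrad setT u du &
        {ae mu, forall x, forall I, f x I = du x I + sf x I}]].

Definition helmholtz_domain U m (f : tfield R n m.+1)
    (u : tfield R n m) (sf : tfield R n m.+1) (h : tfield R n m) :=
  [/\ dotH10 U u,
      L2 U sf /\ (forall phi D, H1_grad U phi D ->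
        \int[mu]_(x in U)
          (\sum_(I : m.+1.-tuple 'I_n)
             sf x I * D (idx_last I) x (idx_front I)) = 0),
      H1 U h &
      exists du dh, [/\ L2 U du /\ is_sgrad U u du,
        L2 U dh /\ is_sgrad U h dh,
        solenoidal U dh &
        {ae mu, forall x, U x ->
           forall I, f x I = du x I + sf x I + dh x I}]].

Definition dotp (x y : 'rV[R]_n) : R := \sum_i x ord0 i * y ord0 i.

(* Near each boundary point U is the strict epigraph, in some unit direction e,
   of a Lipschitz function on the hyperplane orthogonal to e; a function on that
   hyperplane is written as a function on R^n composed with the projection
   x |-> x - (x . e) e. *)
Definition lipschitz_boundary U :=
  forall x0, (closure U `\` interior U) x0 ->
  exists (r : R) (e : 'rV[R]_n) (gamma : 'rV[R]_n -> R),
    [/\ 0 < r, dotp e e = 1, lipschitz gamma &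
        forall x, ball x0 r x ->
          (U x <-> gamma (x - dotp x e *: e) < dotp x e)].

Definition bounded_lipschitz_domain U :=
  [/\ open U, connected U, U !=set0, bounded_set U & lipschitz_boundary U].

End tensor_fields.

(* Main.v *)
(* Extend all fields on Omega by zero.

   (i) If dh_Omega = 0, then ext0 (sf_Omega) is solenoidal on R^n, since its
   defining orthogonality on Omega allows test fields that do not vanish on the
   boundary, and ext0 (u_Omega) lies in \dot H^1_0(R^n) by the inequalities of
   Korn and Poincare.  Hence sigma = ext0 (sf_Omega) - sf = du - ext0 (du_Omega)
   is both solenoidal and a limit of gradients d phi_k of test fields, so that
   sigma is orthogonal to itself.  If moreover n >= 3, then du = d(ext0 u_Omega)
   gives u = ext0 u_Omega by the inequalities of Korn and Hardy.

   (ii) On Omega, dh_Omega = (du - du_Omega) + (sf - sf_Omega), and each of the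
   four terms is orthogonal to dh_Omega.  For du_Omega and sf_Omega this follows
   from the definitions.  For du and sf it is an integration by parts between p
   (= u or sf), for which the equation Lp = L p holds on all of R^n and which
   vanishes outside Omega, and q (= dh_Omega or h_Omega), for which Lq = -L^* q
   holds on Omega only.  It is proved by doubling the variables: the first
   equation is tested in z and the second in x with chi(z) eta_k(x - z), where
   chi has small support and eta_k is a mollifier supported near a small
   multiple of the direction in which Omega is locally an epigraph, so that
   x |-> eta_k(x - z) has compact support in Omega for every z in Omega. *)

Require Import Defs.
From mathcomp Require Import all_boot all_order all_algebra all_fingroup.
From mathcomp Require Import all_classical all_reals all_analysis.
From mathcomp Require Import measurable_realfun ring lra.
Set Implicit Arguments.
Unset Strict Implicit.
Unset Printing Implicit Defensive.
Import Order.TTheory GRing.Theory Num.Theory.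
Import numFieldNormedType.Exports.
Local Open Scope classical_set_scope.
Local Open Scope ring_scope.

(** * Boxes and Lebesgue measure on R^n *)

Section boxes.
Context {R : realType} {n : nat}.
Implicit Types (a b c x y : 'rV[R]_n) (U : set 'rV[R]_n).

(** In (ii) neither factor can test the equation of the other: u and sf carry only weak equations,
    and those of h_Omega and dh_Omega stop at a boundary on which no trace is available. A mollifier
    shifted inwards replaces the trace, but the direction of the shift varies along the boundary.
    This forces a localising factor chi, whose gradient enters the identity. The resulting
    [pairing chi] is linear in chi; adding up the local identities gives [pairing 1 = 0], where the
    gradient terms are gone.

    For sf the operator L is the divergence, whose adjoint produces all first derivatives of h_Omega
    rather than dh_Omega; a symmetric field pairs equally with both.

    Korn is applied to test fields on R^n, where it reduces to exchanging two derivatives under the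
    integral.

    Estimates are kept for squared norms, with a free weight s in the role of Cauchy-Schwarz; s is
    tuned to the tolerance when a limit is taken. *)

Definition box a b : set 'rV[R]_n := [set x : 'rV[R]_n | forall i, a ord0 i <= x ord0 i <= b ord0 i].
Definition obox a b : set 'rV[R]_n := [set x : 'rV[R]_n | forall i, a ord0 i < x ord0 i < b ord0 i].

Lemma ball_rVP x r y : 0 < r ->
  ball x r y <-> forall i, `|x ord0 i - y ord0 i| < r.
Proof.
move=> r0; split=> [[_ h] i|h]; first exact: h.
by split=> // i j; rewrite ord1; exact: h.
Qed.

Lemma obox_sub_box a b : obox a b `<=` box a b.
Proof. by move=> x h i; have /andP[/ltW-> /ltW->] := h i. Qed.

Lemma measurable_preim_coor i (A : set R) : measurable A ->
  measurable [set x : 'rV[R]_n | A (x ord0 i)].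
Proof.
by move=> mA; rewrite -[X in measurable X]setTI; exact: (@measurable_coor R n i).
Qed.

Lemma measurable_forall_coor (A : 'I_n -> set R) :
  (forall i, measurable (A i)) ->
  measurable [set x : 'rV[R]_n | forall i, A i (x ord0 i)].
Proof.
move=> mA.
have -> : [set x : 'rV[R]_n | forall i, A i (x ord0 i)] =
    \big[setI/setT]_(i < n) [set x : 'rV[R]_n | A i (x ord0 i)].
  rewrite -bigcap_seq; apply/seteqP; split => [x h i _|x h i]; first exact: h.
  by apply: (h i) => /=; rewrite mem_index_enum.
by apply: bigsetI_measurable => i _; exact: measurable_preim_coor.
Qed.

Lemma measurable_box a b : measurable (box a b).
Proof.
have -> : box a b = [set x : 'rV[R]_n | forall i, `[a ord0 i, b ord0 i]%classic (x ord0 i)].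
  by apply/seteqP; split=> x h i; have := h i; rewrite /= in_itv.
by apply: (@measurable_forall_coor (fun i => _)) => i; exact: measurable_itv.
Qed.

Lemma measurable_obox a b : measurable (obox a b).
Proof.
have -> : obox a b = [set x : 'rV[R]_n | forall i, `]a ord0 i, b ord0 i[%classic (x ord0 i)].
  by apply/seteqP; split=> x h i; have := h i; rewrite /= in_itv.
by apply: (@measurable_forall_coor (fun i => _)) => i; exact: measurable_itv.
Qed.

Lemma compact_box a b : compact (box a b).
Proof.
have -> : box a b = [set x : 'rV[R]_n | forall i, `[a ord0 i, b ord0 i]%classic (x ord0 i)].
  by apply/seteqP; split=> x h i; have := h i; rewrite /= in_itv.
by apply: (@rV_compact _ _ (fun i => `[a ord0 i, b ord0 i]%classic)) => i;
  exact: segment_compact.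
Qed.

Lemma compact_sub_box (K : set 'rV[R]_n) : compact K ->
  exists M : R, 0 < M /\ K `<=` box (const_mx (- M)) (const_mx M).
Proof.
move=> /compact_bounded[M [Mr hM]]; exists (`|M| + 1); split=> [|x Kx i].
  by rewrite ltr_wpDl.
rewrite !mxE -ler_norml; apply: le_trans (hM (`|M| + 1) _ x Kx).
  rewrite {2}/Num.norm /= mx_normrE.
  by apply/bigmax_geP; right; exists (ord0, i).
by rewrite (le_lt_trans (ler_norm M))// ltrDl.
Qed.

(** Rational centres and half-sides 1/(k+1) leave countably many candidates. The closed boxes stay
    in [U] while the open ones cover it, so one family serves for measurability, for exhaustion by
    compact sets and for supports of test functions. *)
Lemma open_box_cover U : open U -> U !=set0 ->
  exists a b : nat -> 'rV[R]_n, (forall k, box (a k) (b k) `<=` U) /\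
    U `<=` \bigcup_k obox (a k) (b k).
Proof.
move=> oU [x0 Ux0].
pose lo (p : 'rV[rat]_n * nat) : 'rV[R]_n := \row_i (ratr (p.1 ord0 i) - p.2.+1%:R^-1).
pose hi (p : 'rV[rat]_n * nat) : 'rV[R]_n := \row_i (ratr (p.1 ord0 i) + p.2.+1%:R^-1).
have main x : U x -> exists p, obox (lo p) (hi p) x /\ box (lo p) (hi p) `<=` U.
  move=> Ux; have /nbhs_ballP[e /= e0 eU] : nbhs x U by exact: open_nbhs_nbhs.
  (* The rational centre is within t of x in each coordinate and the box extends t further, so 2t
     has to stay below e. *)
  have [k ke] : exists k, 2 * k.+1%:R^-1 < e :> R.
    have /ltr_add_invr[k] : (0 : R) < e / 2 by rewrite divr_gt0.
    by rewrite add0r => h; exists k; rewrite mulrC -ltr_pdivlMr.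
  have : (0 : R) < k.+1%:R^-1 by rewrite invr_gt0.
  set t := k.+1%:R^-1 in ke * => t0.
  have /choice[q qP] : forall i, exists q : rat,
      x ord0 i - t < ratr q < x ord0 i + t.
    move=> i; have /rat_in_itvoo[q] :
      x ord0 i - t < x ord0 i + t by lra.
    by rewrite in_itv; exists q.
  exists (\row_i q i, k); split=> [i|y hy].
    by rewrite !mxE /= -/t; have := qP i; lra.
  apply: eU; apply/ball_rVP => // i; have := hy i; rewrite !mxE /= -/t.
  by have := qP i; rewrite ltr_norml; lra.
have [p0 [_ hp0]] := main _ Ux0.
(* Numbers that code no pair, and pairs whose box leaves [U], are sent to [p0], so that every index
   yields a box in [U]. *)
pose p k := if unpickle k is Some p then
  if `[< box (lo p) (hi p) `<=` U >] then p else p0 else p0.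
exists (lo \o p), (hi \o p); split=> [k|x Ux] /=.
  rewrite /p; case: unpickle => [q|//].
  by case: asboolP.
have [q [xq qU]] := main _ Ux; exists (pickle q) => //=.
by rewrite /p pickleK; case: asboolP.
Qed.

Lemma open_measurable_rV U : open U -> measurable U.
Proof.
move=> oU; have [->|/set0P U0] := eqVneq U set0; first exact: measurable0.
have [a [b [abU Uab]]] := open_box_cover oU U0.
have -> : U = \bigcup_k obox (a k) (b k).
  by apply/seteqP; split=> // x [k _ /obox_sub_box/abU].
by apply: bigcupT_measurable => k; exact: measurable_obox.
Qed.

Lemma closed_measurable_rV U : closed U -> measurable U.
Proof.
by move=> cU; rewrite -(setCK U); apply: measurableC; apply: open_measurable_rV;
  rewrite openC.
Qed.

Lemma compact_measurable_rV U : compact U -> measurable U.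
Proof.
by move=> cU; apply: closed_measurable_rV; apply: compact_closed => //;
  exact: norm_hausdorff.
Qed.

Lemma continuous_measurable_rV (f : 'rV[R]_n -> R) :
  continuous f -> measurable_fun setT f.
Proof.
move=> cf; apply: (measurability _ (RGenOpens.measurableE R)).
move=> _ [_ [a [b ->] <-]]; rewrite setTI; apply: open_measurable_rV.
by apply: open_comp => // x _; exact: cf.
Qed.

End boxes.

(** * Invariance of Lebesgue measure under reflections and translations *)

Section reflection.
Context {R : realType}.

(** Uniqueness of the measure on half-open intervals: the reflection turns []a, b]] into [[c - b, c
    - a[], of the same length. Reflections come before translations because [z |-> x - z] is the
    change of variables of a convolution, and two reflections compose to a translation. *)
Lemma lebesgue_measure_refl (c : R) (A : set R) : measurable A ->
  lebesgue_measure [set x : R | A (c - x)] = lebesgue_measure A.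
Proof.
move=> mA.
have mc : measurable_fun [set: measurableTypeR R]
   ((fun x : R => c - x) : measurableTypeR R -> measurableTypeR R).
  by apply: measurable_funB => //; exact: measurable_cst.
pose nu : {measure set (measurableTypeR R) -> \bar R} :=
  pushforward (@lebesgue_measure R)
    ((fun x : R => c - x) : measurableTypeR R -> measurableTypeR R).
apply/esym; apply: (@lebesgue_measure_unique R (nu mc)) => //= _ [[a b] _ <-].
rewrite /nu /pushforward /=.
have -> : (fun x : R => c - x) @^-1` `]a, b]%classic = `[c - b, c - a[%classic.
  by apply/seteqP; split=> x /=; rewrite !in_itv /=; lra.
rewrite !lebesgue_measure_itv /= !lte_fin ltrD2l ltrN2.
by case: ifP => // _; congr (_%:E); ring.
Qed.

Lemma measurable_refl n (c : 'rV[R]_n) :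
  measurable_fun setT (fun x : 'rV[R]_n => c - x).
Proof.
apply: measurable_fun_rV => i.
under eq_fun do rewrite !mxE.
by apply: measurable_funB; [exact: measurable_cst|exact: measurable_coor].
Qed.

(** Induction on the dimension: through [rV_cons] the reflection splits into one of the first
    coordinate and one of the others, and the product measure is determined by rectangles. In
    dimension 0 the measure is the Dirac mass at the only point. *)
Lemma lebesgue_rV_refl n (c : 'rV[R]_n) (A : set 'rV[R]_n) : measurable A ->
  lebesgue_rV n [set x | A (c - x)] = lebesgue_rV n A.
Proof.
elim: n c A => [|n IH] c A mA.
  rewrite /= !diracE; congr (_%:R%:E); congr nat_of_bool.
  by apply/idP/idP; rewrite !inE /= (thinmx0 (c - 0)).
rewrite /= /leb_step /pushforward.
pose c' : 'rV[R]_n := \row_j c ord0 (lift ord0 j).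
pose S (p : measurableTypeR R * 'rV[R]_n) : measurableTypeR R * 'rV[R]_n :=
  (c ord0 ord0 - p.1, c' - p.2).
have mS : measurable_fun setT S.
  apply: measurable_fun_pair => /=.
    by apply: measurable_funB; [exact: measurable_cst|exact: measurable_fst].
  exact: measurableT_comp (measurable_refl c') measurable_snd.
pose nu : {measure set (measurableTypeR R * 'rV[R]_n) -> \bar R} :=
  pushforward (@lebesgue_measure R \x lebesgue_rV n)%E S.
have mc : measurable (@rV_cons R n @^-1` A).
  by rewrite -[X in measurable X]setTI; exact: measurable_rV_cons.
have -> : @rV_cons R n @^-1` [set x | A (c - x)] = S @^-1` (@rV_cons R n @^-1` A).
  apply/seteqP; split=> -[t v] /=; congr (A _); apply/rowP => i;
  rewrite !mxE /=; case: unliftP => [j ->|->] //=; by rewrite !mxE.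
apply/esym; apply: (@product_measure_unique _ _ _ _ _ _ _ (nu mS)) => //.
move=> B C mB mC; rewrite /nu /= /pushforward.
have -> : S @^-1` (B `*` C) = [set t : measurableTypeR R | B (c ord0 ord0 - t)] `*`
  [set v | C (c' - v)] by [].
rewrite product_measure1E; last 2 first.
- rewrite -[X in measurable X]setTI.
  have : measurable_fun [set: measurableTypeR R]
   ((fun x : R => c ord0 ord0 - x) : measurableTypeR R -> measurableTypeR R).
    by apply: measurable_funB => //; exact: measurable_cst.
  by apply.
- by rewrite -[X in measurable X]setTI; exact: (measurable_refl c').
by congr (_ * _)%E; [exact: lebesgue_measure_refl|exact: IH].
Qed.

Lemma rV_cons_box n (a b : 'rV[R]_n.+1) :
  @rV_cons R n @^-1` (box a b) = `[a ord0 ord0, b ord0 ord0]%classic `*`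
   box (\row_j a ord0 (lift ord0 j)) (\row_j b ord0 (lift ord0 j)).
Proof.
apply/seteqP; split=> -[t v] /= => [h|[h0 h] i].
  split=> [|i]; first by rewrite in_itv; have := h ord0; rewrite !mxE unlift_none.
  by have := h (lift ord0 i); rewrite !mxE liftK.
rewrite /rV_cons mxE; case: unliftP => [j ->|->] /=; last by move: h0; rewrite in_itv /=.
by have := h j; rewrite !mxE.
Qed.

Lemma lebesgue_box_lty n (a b : 'rV[R]_n) : (lebesgue_rV n (box a b) < +oo)%E.
Proof.
elim: n a b => [|n IH] a b; first by rewrite /= diracE ltry.
rewrite /= /leb_step /pushforward rV_cons_box.
rewrite product_measure1E//; last exact: measurable_box.
have h : (lebesgue_measure (`[a ord0 ord0, b ord0 ord0]%classic : set R) < +oo)%E.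
  by rewrite lebesgue_measure_itv /=; case: ifP => _; rewrite ?ltry.
by apply: lte_mul_pinfty; rewrite ?ge0_fin_numE ?IH.
Qed.

Lemma lebesgue_box_gt0 n (a b : 'rV[R]_n) : (forall i, a ord0 i < b ord0 i) ->
  (0 < lebesgue_rV n (box a b))%E.
Proof.
elim: n a b => [|n IH] a b ab.
  by rewrite /= diracE mem_set ?lte_fin ?ltr01// => -[].
rewrite /= /leb_step /pushforward rV_cons_box.
rewrite product_measure1E//; last exact: measurable_box.
have h : (0 < lebesgue_measure (`[a ord0 ord0, b ord0 ord0]%classic : set R))%E.
  by rewrite lebesgue_measure_itv /= lte_fin ab -EFinB lte_fin subr_gt0 ab.
apply: mule_gt0; first exact: h.
by apply: IH => i; rewrite !mxE.
Qed.

Section refl_integral.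
Variable n : nat.
Local Notation mu := (@lebesgue_rV R n).
Local Notation V := 'rV[R]_n.

Lemma ge0_integral_refl (c : V) (f : V -> \bar R) : measurable_fun setT f ->
  (forall x, 0 <= f x)%E -> (\int[mu]_x f (c - x)%R = \int[mu]_x f x)%E.
Proof.
move=> mf f0; have mc := measurable_refl c.
rewrite -[LHS](@ge0_integral_pushforward _ _ _ _ _ _ mc mu setT f)//.
by apply: eq_measure_integral => A mA _; exact: lebesgue_rV_refl.
Qed.

Lemma integrable_refl (c : V) (f : V -> R) : mu.-integrable setT (EFin \o f) ->
  mu.-integrable setT (EFin \o (fun x => f (c - x))).
Proof.
move=> /integrableP[mf fi]; apply/integrableP; split.
  exact: measurableT_comp mf (measurable_refl c).
rewrite (ge0_integral_refl c (f := fun x => `|(f x)%:E|%E))//.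
exact: measurableT_comp.
Qed.

Lemma Rintegral_refl (c : V) (f : V -> R) : mu.-integrable setT (EFin \o f) ->
  \int[mu]_x f (c - x) = \int[mu]_x f x.
Proof.
move=> fi; congr fine; have mc := measurable_refl c.
rewrite -[LHS](@integral_pushforward _ _ _ _ _ _ mc mu setT (EFin \o f))//.
- by apply: eq_measure_integral => A mA _; exact: lebesgue_rV_refl.
- exact: measurable_int fi.
- exact: integrable_refl.
Qed.

Lemma integrable_shift (c : V) (f : V -> R) : mu.-integrable setT (EFin \o f) ->
  mu.-integrable setT (EFin \o (fun x => f (x + c))).
Proof.
move=> fi; have := integrable_refl 0 (integrable_refl c fi).
by apply: eq_integrable => // x _ /=; rewrite sub0r opprK addrC.
Qed.

Lemma Rintegral_shift (c : V) (f : V -> R) : mu.-integrable setT (EFin \o f) ->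
  \int[mu]_x f (x + c) = \int[mu]_x f x.
Proof.
move=> fi; rewrite -(Rintegral_refl c fi) -(Rintegral_refl 0 (integrable_refl c fi)).
by apply: eq_Rintegral => x _; rewrite sub0r opprK addrC.
Qed.

End refl_integral.
End reflection.

(** * Functions of class C^k *)

Section Ck_theory.
Context {R : realType} {n : nat}.
Local Notation V := 'rV[R]_n.
Local Notation "''e_' i" := (delta_mx ord0 i : V) (at level 8, i at level 2).
Implicit Types (f g : V -> R) (x c : V) (i : 'I_n) (k : nat).

(** Turns a directional derivative into the derivative at 0 of a function of one variable, to which
    the chain rule [is_derive1_comp] applies. *)
Lemma is_derive_lineP f x (v : V) (d : R) :
  is_derive x v f d <-> is_derive (0 : R) (1 : R) (fun h : R => f (h *: v + x)) d.
Proof.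
have DE : 'D_v f x = 'D_1 (fun h : R => f (h *: v + x)) 0.
  rewrite /derive; set g1 := fun h => h^-1 *: _; set g2 := fun h => h^-1 *: _.
  suff -> : g1 = g2 by [].
  by rewrite funeqE /g1 /g2 => h /=; rewrite addr0 scale0r add0r [_%:A]mulr1.
split=> [[df <-]|[df <-]].
  by apply: DeriveDef; [exact: ((derivable1P f x v).1 df)|rewrite -DE].
by apply: DeriveDef; [exact: ((derivable1P f x v).2 df)|rewrite DE].
Qed.

Lemma is_derive_shiftV f x c (v : V) (d : R) :
  is_derive (x + c) v f d -> is_derive x v (fun y => f (y + c)) d.
Proof.
move=> /is_derive_lineP h; apply/is_derive_lineP.
by under eq_fun do rewrite -addrA.
Qed.

Lemma is_derive_reflV f x c (v : V) (d : R) :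
  is_derive (c - x) v f d -> is_derive x v (fun y => f (c - y)) (- d).
Proof.
move=> /is_derive_lineP h; apply/is_derive_lineP.
have -> : (fun h : R => f (c - (h *: v + x))) =
    (fun h : R => f (h *: v + (c - x))) \o (fun h : R => - h).
  by apply/funext => t /=; rewrite scaleNr opprD addrCA.
rewrite -[- d]mulrN1; apply: is_derive1_comp; by rewrite oppr0.
Qed.

Lemma is_derive_compV f x (v : V) (G : R -> R) (d a : R) :
  is_derive (f x) 1 G a -> is_derive x v f d -> is_derive x v (G \o f) (a * d).
Proof.
move=> hG /is_derive_lineP h; apply/is_derive_lineP.
by apply: (is_derive1_comp (f := G)); rewrite ?scale0r ?add0r.
Qed.

Lemma is_derive_mulV f g x (v : V) (a b : R) :
  is_derive x v f a -> is_derive x v g b ->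
  is_derive x v (fun y => f y * g y) (f x * b + a * g x).
Proof.
by move=> hf hg; rewrite [a * _]mulrC; exact: (is_deriveM hf hg).
Qed.

Lemma is_derive_addV f g x (v : V) (a b : R) :
  is_derive x v f a -> is_derive x v g b ->
  is_derive x v (fun y => f y + g y) (a + b).
Proof. by move=> hf hg; exact: (is_deriveD hf hg). Qed.

Lemma is_derive_invV f x (v : V) (a : R) : f x != 0 ->
  is_derive x v f a -> is_derive x v (fun y => (f y)^-1) (- ((f x)^-1 * (f x)^-1) * a).
Proof.
move=> fx0 [df <-]; apply: DeriveDef; first exact: derivableV.
by rewrite deriveV// expr2 invfM.
Qed.

Lemma is_derive_coor x i j :
  is_derive x 'e_i (fun y : V => y ord0 j) (i == j)%:R.
Proof.
apply/is_derive_lineP.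
have -> : (fun h : R => (h *: 'e_i + x) ord0 j) =
    (fun h : R => (i == j)%:R * h + x ord0 j).
  by apply/funext => h; rewrite !mxE eqxx /= eq_sym mulrC.
have h := is_deriveD (is_deriveM (is_derive_cst ((i == j)%:R : R) (0 : R) (1 : R))
  (is_derive_id (0 : R) (1 : R))) (is_derive_cst (x ord0 j) (0 : R) (1 : R)).
by apply: is_derive_eq h _; rewrite scaler0 !addr0 [_ *: 1]mulr1.
Qed.

Lemma CkS k f (g : 'I_n -> V -> R) : continuous f ->
  (forall i x, is_derive x 'e_i f (g i x)) -> (forall i, Ck k (g i)) -> Ck k.+1 f.
Proof.
move=> cf df cg; split=> // i; split=> [x|]; first by case: (df i x).
by have -> : pderive i f = g i by apply/funext => x; case: (df i x).
Qed.

Lemma Ck_continuous k f : Ck k f -> continuous f.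
Proof. by case: k => // k []. Qed.

Lemma Ck_derive k f i x : Ck k.+1 f -> is_derive x 'e_i f (pderive i f x).
Proof. by move=> [_ h]; have [d _] := h i; apply: derivableP. Qed.

Lemma Ck_pderive k f i : Ck k.+1 f -> Ck k (pderive i f).
Proof. by move=> [_ h]; have [_] := h i. Qed.

Lemma CkW k f : Ck k.+1 f -> Ck k f.
Proof.
elim: k f => [|k IH] f [cf h]; first exact: cf.
by split=> // i; have [df /IH] := h i.
Qed.

Lemma CkD k f g : Ck k f -> Ck k g -> Ck k (fun x => f x + g x).
Proof.
elim: k f g => [|k IH] f g hf hg; first by move=> x; apply: continuousD; [exact: (Ck_continuous hf)|exact: (Ck_continuous hg)].
apply: (@CkS _ _ (fun i x => pderive i f x + pderive i g x)).
- by move=> x; apply: continuousD; [exact: (Ck_continuous hf)|exact: (Ck_continuous hg)].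
- by move=> i x; apply: is_derive_addV; [exact: Ck_derive hf|exact: Ck_derive hg].
- by move=> i; apply: IH; exact: Ck_pderive.
Qed.

Lemma CkM k f g : Ck k f -> Ck k g -> Ck k (fun x => f x * g x).
Proof.
elim: k f g => [|k IH] f g hf hg; first by move=> x; apply: continuousM; [exact: (Ck_continuous hf)|exact: (Ck_continuous hg)].
apply: (@CkS _ _ (fun i x => f x * pderive i g x + pderive i f x * g x)).
- by move=> x; apply: continuousM; [exact: (Ck_continuous hf)|exact: (Ck_continuous hg)].
- by move=> i x; apply: is_derive_mulV; [exact: Ck_derive hf|exact: Ck_derive hg].
- move=> i; apply: CkD; apply: IH => //; try exact: CkW; exact: Ck_pderive.
Qed.

Lemma Ck_cst k (a : R) : Ck k (fun _ : V => a).
Proof.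
elim: k a => [|k IH] a; first by exact: cst_continuous.
exact: (CkS (g := fun _ _ => 0) (@cst_continuous _ _ a)
  (fun i x => is_derive_cst a x _) (fun i => IH 0)).
Qed.

Lemma Ck_coor k j : Ck k (fun x : V => x ord0 j).
Proof.
case: k => [|k]; first by rewrite /= => x; exact: coord_continuous.
apply: (@CkS _ _ (fun i _ => (i == j)%:R)) => [x|i x|i].
- exact: coord_continuous.
- exact: is_derive_coor.
- exact: Ck_cst.
Qed.

Lemma CkN k f : Ck k f -> Ck k (fun x => - f x).
Proof.
move=> hf; have := CkM (Ck_cst k (-1)) hf.
by under eq_fun do rewrite mulN1r.
Qed.

Lemma CkB k f g : Ck k f -> Ck k g -> Ck k (fun x => f x - g x).
Proof. by move=> hf hg; apply: CkD => //; exact: CkN. Qed.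

Lemma Ck_sum k (I : Type) (s : seq I) (P : pred I) (F : I -> V -> R) :
  (forall j, Ck k (F j)) -> Ck k (fun x => \sum_(j <- s | P j) F j x).
Proof.
move=> h; elim: s => [|j s IH].
  by under eq_fun do rewrite big_nil; exact: Ck_cst.
under eq_fun do rewrite big_cons; case: (P j) => //.
exact: CkD.
Qed.

Lemma Ck_prod k (I : Type) (s : seq I) (P : pred I) (F : I -> V -> R) :
  (forall j, Ck k (F j)) -> Ck k (fun x => \prod_(j <- s | P j) F j x).
Proof.
move=> h; elim: s => [|j s IH].
  by under eq_fun do rewrite big_nil; exact: Ck_cst.
under eq_fun do rewrite big_cons; case: (P j) => //.
exact: CkM.
Qed.

Lemma Ck_inv k f : (forall x, f x != 0) -> Ck k f -> Ck k (fun x => (f x)^-1).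
Proof.
move=> f0; elim: k => [|k IH] hf; first by move=> x; apply: continuousV => //; exact: (Ck_continuous hf).
apply: (@CkS _ _ (fun i x => - ((f x)^-1 * (f x)^-1) * pderive i f x)).
- by move=> x; apply: continuousV => //; exact: (Ck_continuous hf).
- by move=> i x; apply: is_derive_invV => //; exact: Ck_derive hf.
- move=> i; apply: CkM; last exact: Ck_pderive.
  by apply: CkN; apply: CkM; apply: IH; exact: CkW.
Qed.

(** The outer function comes as the whole tower of its derivatives [G l], so that the induction on
    [k] can move from [G j] to [G j.+1]. *)
Lemma Ck_comp k f (G : nat -> R -> R) j :
  (forall l (t : R), is_derive t (1 : R) (G l) (G l.+1 t)) -> Ck k f -> Ck k (G j \o f).
Proof.
move=> dG; have cG l : continuous (G l).
  move=> t; apply: differentiable_continuous; apply/derivable1_diffP.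
  by case: (dG l t).
elim: k f j => [|k IH] f j hf; first by move=> x; apply: continuous_comp; [exact: (Ck_continuous hf)|exact: cG].
apply: (@CkS _ _ (fun i x => (G j.+1 \o f) x * pderive i f x)).
- by move=> x; apply: continuous_comp; [exact: (Ck_continuous hf)|exact: cG].
- by move=> i x; apply: is_derive_compV; exact: Ck_derive hf.
- by move=> i; apply: CkM; [apply: IH; exact: CkW|exact: Ck_pderive].
Qed.

Lemma Ck_refl k c f : Ck k f -> Ck k (fun x => f (c - x)).
Proof.
have cr g : continuous g -> continuous (fun x => g (c - x)).
  move=> cg x; apply: (@continuous_comp V V R (fun x => c - x) g); last exact: cg.
  by apply: continuousB; [exact: cst_continuous|exact: cvg_id].
elim: k f => [|k IH] f hf; first by apply: cr; exact: (Ck_continuous hf).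
apply: (@CkS _ _ (fun i x => - pderive i f (c - x))).
- by apply: cr; exact: Ck_continuous hf.
- by move=> i x; apply: is_derive_reflV; exact: Ck_derive hf.
- by move=> i; apply/CkN/IH; exact: Ck_pderive.
Qed.

Lemma Ck_shift k c f : Ck k f -> Ck k (fun x => f (x + c)).
Proof.
move=> /(Ck_refl c)/(Ck_refl 0).
by under eq_fun do rewrite sub0r opprK addrC.
Qed.

Lemma pderiveE f i x (a : R) : is_derive x 'e_i f a -> pderive i f x = a.
Proof. by move=> /@derive_val. Qed.

Lemma pderive_coor i j x : pderive i (fun y : V => y ord0 j) x = (i == j)%:R.
Proof. exact: pderiveE (is_derive_coor x i j). Qed.

Lemma pderive_refl c f i x k : Ck k.+1 f ->
  pderive i (fun x => f (c - x)) x = - pderive i f (c - x).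
Proof.
move=> hf; have := is_derive_reflV (Ck_derive i (c - x) hf).
by move=> /@derive_val.
Qed.

Lemma pderive_shift c f i x k : Ck k.+1 f ->
  pderive i (fun x => f (x + c)) x = pderive i f (x + c).
Proof.
move=> hf; have := is_derive_shiftV (Ck_derive i (x + c) hf).
by move=> /@derive_val.
Qed.

Lemma pderiveM f g i x k : Ck k.+1 f -> Ck k.+1 g ->
  pderive i (fun x => f x * g x) x = f x * pderive i g x + pderive i f x * g x.
Proof.
move=> hf hg; have := is_derive_mulV (Ck_derive i x hf) (Ck_derive i x hg).
by move=> /@derive_val.
Qed.

Lemma pderiveD f g i x k : Ck k.+1 f -> Ck k.+1 g ->
  pderive i (fun x => f x + g x) x = pderive i f x + pderive i g x.
Proof.
move=> hf hg; have := is_derive_addV (Ck_derive i x hf) (Ck_derive i x hg).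
by move=> /@derive_val.
Qed.

Lemma pderive_cst (a : R) i x : pderive i (fun _ => a) x = 0.
Proof. exact: derive_cst. Qed.

Lemma pderiveB f g i x k : Ck k.+1 f -> Ck k.+1 g ->
  pderive i (fun x => f x - g x) x = pderive i f x - pderive i g x.
Proof.
move=> hf hg; rewrite (pderiveD i x hf (CkN hg)); congr (_ + _).
have := pderiveM i x (Ck_cst k.+1 (-1)) hg.
by rewrite pderive_cst mul0r addr0 mulN1r; under eq_fun do rewrite mulN1r.
Qed.

Lemma pderive_near f g i x : (\near x, f x = g x) -> pderive i f x = pderive i g x.
Proof. by move=> h; exact: near_eq_derive. Qed.

Lemma Cinfty_pderive f i : Cinfty f -> Cinfty (pderive i f).
Proof. by move=> hf k; exact: Ck_pderive (hf k.+1). Qed.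

End Ck_theory.

(** * Smooth cutoff functions of boxes *)

Section bump.
Context {R : realType}.

(** For [P = 1] this is the classical function exp(-1/t) extended by 0. The polynomial in 1/t makes
    the family stable under derivation. *)
Definition flat (P : {poly R}) (t : R) : R :=
  if 0 < t then P.[t^-1] * expR (- t^-1) else 0.

(** From exp y >= y^(i+1) / (i+1)! at y = 1/t, each y^i exp(-y) is at most (i+1)! t. A bound that is
    linear in t is what differentiability at 0 requires. *)
Lemma flat_bound P : exists2 C, 0 <= C & forall t, `|flat P t| <= C * `|t|.
Proof.
pose C := \sum_(i < size P) `|P`_i| * (i.+1)`!%:R.
have C0 : 0 <= C by apply: sumr_ge0 => i _; rewrite mulr_ge0.
exists C => // t.
rewrite /flat; case: ltP => t0; last by rewrite normr0 mulr_ge0.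
rewrite horner_coef mulr_suml (le_trans (ler_norm_sum _ _ _))//.
rewrite mulr_suml; apply: ler_sum => i _.
rewrite !normrM -mulrA -mulrA ler_wpM2l//.
rewrite (gtr0_norm (expR_gt0 _)) (gtr0_norm t0) expRN.
have y0 : 0 < t^-1 by rewrite invr_gt0.
rewrite gtr0_norm ?exprn_gt0// ler_pdivrMr ?expR_gt0//.
have : t^-1 ^+ i.+1 / (i.+1)`!%:R <= expR t^-1.
  by apply: le_trans (expR_ge1Dxn i (ltW y0)); rewrite lerDr.
rewrite ler_pdivrMr ?ltr0n ?fact_gt0// => h.
have -> : t^-1 ^+ i = t * t^-1 ^+ i.+1.
  by rewrite exprS mulVKf ?gt_eqF.
by rewrite [_ * t]mulrC -mulrA ler_wpM2l ?(ltW t0)// mulrC.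
Qed.

Lemma flat_derive P t : is_derive t (1 : R) (flat P) (flat ('X^2 * (P - P^`())) t).
Proof.
have [t0|t0|<-] := ltgtP 0 t.
- have nE : \near t, P.[t^-1] * expR (- t^-1) = flat P t.
    near=> x; rewrite /flat ifT//; near: x; exact: lt_nbhsr.
  apply: near_eq_is_derive nE _.
  have dV : is_derive t (1 : R) (fun x : R => x^-1) (- t ^- 2).
    have := is_deriveV (f := id) (lt0r_neq0 t0) (is_derive_id t (1 : R)).
    by rewrite [_ *: 1]mulr1.
  have dP : is_derive t^-1 (1 : R) (horner P) (P^`()).[t^-1].
    by rewrite derivE derive1E; apply: derivableP; exact: derivable_horner.
  have dN : is_derive t (1 : R) (fun x : R => - x^-1) (- - t ^- 2) := is_deriveN dV.
  have h := is_deriveM (is_derive1_comp dP dV)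
    (is_derive1_comp (g := fun x : R => - x^-1) (is_derive_expR (- t^-1)) dN).
  apply: is_derive_eq h _.
  rewrite /flat t0 hornerM hornerXn hornerD hornerN exprVn.
  rewrite [X in X + _ = _](_ : _ = P.[t^-1] * (expR (- t^-1) * - - t ^- 2))//.
  rewrite [X in _ + X = _](_ : _ = expR (- t^-1) * (P^`().[t^-1] * - t ^- 2))//.
  by move: (expR _) (P.[_]) (P^`().[_]) (t ^- 2) => a b c d; ring.
- have nE : \near t, cst 0 t = flat P t.
    near=> x; rewrite /flat ltNge ifF//; apply/negbF; rewrite ltW//.
    near: x; exact: lt_nbhsl.
  apply: near_eq_is_derive nE _.
  by rewrite /flat ltNge (ltW t0) /=; exact: is_derive_cst.
(* At 0 the difference quotient of [flat P] is [flat ('X * P) h], which its own linear bound sends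
   to 0. *)
- have [C C0 hC] := flat_bound ('X * P).
  suff h : h^-1 *: ((flat P \o shift 0) (h *: 1) - flat P 0) @[h --> 0^'] --> (0 : R).
    apply: DeriveDef; first by apply/cvg_ex; exists 0.
    by rewrite [LHS](cvg_lim _ h)// /flat ltxx.
  apply/cvgr0Pnorm_lt => e e0.
  have eC : 0 < e / (C + 1) by rewrite divr_gt0// ltr_wpDl.
  near=> h.
  have h0 : h != 0 by near: h; exact: nbhs_dnbhs_neq.
  have -> : h^-1 *: ((flat P \o shift 0) (h *: 1) - flat P 0) = flat ('X * P) h.
    rewrite /= addr0 [h *: 1]mulr1 /flat ltxx subr0; case: ifP => _; last by rewrite scaler0.
    by rewrite hornerM hornerX -mulrA.
  rewrite (le_lt_trans (hC _))//.
  have : `|h| < e / (C + 1) by near: h; exact: dnbhs0_lt.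
  rewrite ltr_pdivlMr ?ltr_wpDl// mulrDr mulr1 mulrC => hh.
  by rewrite (le_lt_trans _ hh)// lerDl.
Unshelve. all: by end_near. Qed.

(** The polynomials belonging to the successive derivatives of exp(-1/t), that is, the tower needed
    by [Ck_comp]. *)
Fixpoint flat_poly (k : nat) : {poly R} :=
  if k is k'.+1 then 'X^2 * (flat_poly k' - (flat_poly k')^`()) else 1.

Lemma flat_ge0 t : 0 <= flat 1 t.
Proof. by rewrite /flat; case: ifP => // _; rewrite hornerE mul1r expR_ge0. Qed.

Lemma flat_gt0 t : 0 < t -> 0 < flat 1 t.
Proof. by rewrite /flat => ->; rewrite hornerE mul1r expR_gt0. Qed.

Lemma flat_eq0 t : t <= 0 -> flat 1 t = 0.
Proof. by rewrite /flat ltNge => ->. Qed.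

(** The usual smooth transition from 0 on t <= 0 to 1 on t >= 1; the denominator is positive because
    t and 1 - t are never both nonpositive. *)
Definition step (t : R) : R := flat 1 t / (flat 1 t + flat 1 (1 - t)).

Lemma step_den t : 0 < flat 1 t + flat 1 (1 - t).
Proof.
have [t0|t0] := ltP 0 t; first by rewrite ltr_wpDr ?flat_gt0 ?flat_ge0.
by rewrite ltr_wpDl ?flat_ge0// flat_gt0//; lra.
Qed.

Lemma step_ge0 t : 0 <= step t.
Proof. by rewrite divr_ge0 ?flat_ge0 ?(ltW (step_den t)). Qed.

Lemma step_le1 t : step t <= 1.
Proof. by rewrite ler_pdivrMr ?step_den// mul1r lerDl flat_ge0. Qed.

Lemma step_eq0 t : t <= 0 -> step t = 0.
Proof. by move=> t0; rewrite /step flat_eq0// mul0r. Qed.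

Lemma step_eq1 t : 1 <= t -> step t = 1.
Proof.
move=> t1; rewrite /step (flat_eq0 (_ : 1 - t <= 0)) ?subr_le0// addr0 divff//.
by rewrite gt_eqF// flat_gt0// (lt_le_trans ltr01).
Qed.

Lemma Ck_step n k (f : 'rV[R]_n -> R) : Ck k f -> Ck k (fun x => step (f x)).
Proof.
have cflat g : Ck k g -> Ck k (fun x : 'rV[R]_n => flat 1 (g x)).
  apply: (Ck_comp (G := fun j => flat (flat_poly j)) 0) => l t.
  exact: flat_derive.
move=> cf; apply: CkM; first exact: cflat.
apply: Ck_inv => [x|]; first by rewrite gt_eqF// step_den.
apply: CkD; apply: cflat => //.
by apply: CkB => //; exact: Ck_cst.
Qed.

Section cutoff.
Context {n : nat}.
Implicit Types (a b x : 'rV[R]_n).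

Definition cutoff a b (e : R) x : R :=
  \prod_(i < n) (step ((x ord0 i - a ord0 i) / e) * step ((b ord0 i - x ord0 i) / e)).

Lemma cutoff_ge0 a b e x : 0 <= cutoff a b e x.
Proof. by apply: prodr_ge0 => i _; rewrite mulr_ge0 ?step_ge0. Qed.

Lemma cutoff_le1 a b e x : cutoff a b e x <= 1.
Proof.
apply: prodr_ile1 => i _.
by rewrite mulr_ge0 ?step_ge0//= mulr_ile1 ?step_ge0 ?step_le1.
Qed.

Lemma Ck_cutoff k a b e : Ck k (cutoff a b e).
Proof.
apply: Ck_prod => i; apply: CkM; apply: Ck_step; apply: CkM; try exact: Ck_cst;
  apply: CkB; try exact: Ck_cst; exact: Ck_coor.
Qed.

Lemma cutoff_eq0 a b e x : 0 < e -> ~ obox a b x -> cutoff a b e x = 0.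
Proof.
move=> e0 /existsNP[i /negP]; rewrite negb_and -!leNgt => h.
rewrite /cutoff (bigD1 i)//=.
have [h1|h1] := orP h.
  by rewrite step_eq0 ?mul0r// mulr_le0_ge0 ?subr_le0 ?invr_ge0 ?(ltW e0).
rewrite [X in _ * X * _](_ : _ = 0) ?mulr0 ?mul0r//.
by rewrite step_eq0// mulr_le0_ge0 ?subr_le0 ?invr_ge0 ?(ltW e0).
Qed.

Lemma cutoff_eq1 a b (e : R) x : 0 < e ->
  (forall i, a ord0 i + e <= x ord0 i <= b ord0 i - e) -> cutoff a b e x = 1.
Proof.
move=> e0 h; apply: big1 => i _; have := h i.
by move=> /andP[h1 h2]; rewrite !step_eq1 ?mulr1// ler_pdivlMr// mul1r lerBrDl// -lerBrDr.
Qed.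

Lemma test_cutoff U a b e : 0 < e -> box a b `<=` U -> test_fun U (cutoff a b e).
Proof.
move=> e0 abU; split=> [k|]; first exact: Ck_cutoff.
exists (box a b); split=> //; first exact: compact_box.
by move=> x nx; apply: cutoff_eq0 => // /obox_sub_box.
Qed.

End cutoff.
End bump.

(** * Integrable and square-integrable functions *)

Lemma cvg_sumR (R : realType) (I : Type) (s : seq I) (F : nat -> I -> R) (l : I -> R) :
  (forall i, F k i @[k --> \oo] --> l i) ->
  \sum_(i <- s) F k i @[k --> \oo] --> \sum_(i <- s) l i.
Proof.
move=> h; elim: s => [|i s IH].
  by under eq_fun do rewrite big_nil; rewrite big_nil; exact: cvg_cst.
by under eq_fun do rewrite big_cons; rewrite big_cons; exact: cvgD.
Qed.

Section L2.
Context d (T : measurableType d) (R : realType) (mu : {measure set T -> \bar R}).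
Implicit Types f g h : T -> R.

Definition intg f := mu.-integrable setT (EFin \o f).
Definition sqintg f := measurable_fun setT f /\ intg (fun x => f x ^+ 2).

Lemma intg_measurable f : intg f -> measurable_fun setT f.
Proof. by move=> /measurable_int/measurable_EFinP. Qed.

Lemma intg_le f g : measurable_fun setT f -> intg g ->
  (forall x, `|f x| <= g x) -> intg f.
Proof.
move=> mf ig fg; apply: (le_integrable _ _ _ ig) => //; first exact/measurable_EFinP.
by move=> x _ /=; rewrite lee_fin (le_trans (fg x))// ler_norm.
Qed.

Lemma intgD f g : intg f -> intg g -> intg (fun x => f x + g x).
Proof. by move=> hf hg; exact: (integrableD measurableT hf hg). Qed.

Lemma intgB f g : intg f -> intg g -> intg (fun x => f x - g x).
Proof. by move=> hf hg; exact: (integrableB measurableT hf hg). Qed.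

Lemma intgZ (c : R) f : intg f -> intg (fun x => c * f x).
Proof. by move=> hf; exact: (integrableZl measurableT c hf). Qed.

Lemma intg0 : intg (fun _ => 0).
Proof. exact: integrable0. Qed.

Lemma intg_sum (I : Type) (s : seq I) (F : I -> T -> R) :
  (forall i, intg (F i)) -> intg (fun x => \sum_(i <- s) F i x).
Proof.
move=> h; elim: s => [|i s IH].
  by under eq_fun do rewrite big_nil; exact: intg0.
by under eq_fun do rewrite big_cons; exact: intgD.
Qed.

Lemma RintD f g : intg f -> intg g -> \int[mu]_x (f x + g x) = \int[mu]_x f x + \int[mu]_x g x.
Proof. exact: RintegralD. Qed.

Lemma RintB f g : intg f -> intg g -> \int[mu]_x (f x - g x) = \int[mu]_x f x - \int[mu]_x g x.
Proof. exact: RintegralB. Qed.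

Lemma RintZ (c : R) f : intg f -> \int[mu]_x (c * f x) = c * \int[mu]_x f x.
Proof. exact: RintegralZl. Qed.

Lemma Rintegral0 : \int[mu]_x (0 : R) = 0.
Proof. by rewrite /Rintegral integral0_eq. Qed.

Lemma RintN f : intg f -> \int[mu]_x (- f x) = - \int[mu]_x f x.
Proof. by move=> hf; under eq_Rintegral do rewrite -mulN1r; rewrite RintZ// mulN1r. Qed.

Lemma Rint_sum (I : Type) (s : seq I) (F : I -> T -> R) :
  (forall i, intg (F i)) -> \int[mu]_x (\sum_(i <- s) F i x) = \sum_(i <- s) \int[mu]_x F i x.
Proof.
move=> h; elim: s => [|i s IH].
  by under eq_Rintegral do rewrite big_nil; rewrite big_nil Rintegral0.
under eq_Rintegral do rewrite big_cons; rewrite big_cons RintD ?IH//.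
exact: intg_sum.
Qed.

Lemma Rint_le f g : intg f -> intg g -> (forall x, f x <= g x) -> \int[mu]_x f x <= \int[mu]_x g x.
Proof. by move=> hf hg fg; apply: le_Rintegral => // x _. Qed.

Lemma Rint_norm f : intg f -> `|\int[mu]_x f x| <= \int[mu]_x `|f x|.
Proof. by move=> hf; exact: le_normr_Rintegral. Qed.

Lemma Rint_ae f g : measurable_fun setT f -> measurable_fun setT g ->
  {ae mu, forall x, f x = g x} -> \int[mu]_x f x = \int[mu]_x g x.
Proof.
move=> mf mg fg; congr fine; apply: ae_eq_integral => //; try exact/measurable_EFinP.
by apply: filterS fg => x /= ->.
Qed.

Lemma Rint_sq_eq0 f : sqintg f -> \int[mu]_x (f x ^+ 2) = 0 -> {ae mu, forall x, f x = 0}.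
Proof.
move=> [mf hf] h0.
have /(ae_eq_integral_abs mu measurableT _) : (\int[mu]_x `|(f x ^+ 2)%:E| = 0)%E.
  under eq_integral do rewrite gee0_abs ?lee_fin ?sqr_ge0//.
  rewrite -[LHS]fineK ?integrable_fin_num//.
  by move: h0; rewrite /Rintegral => ->.
move=> /(_ (measurable_int _ hf)); apply: filterS => x /= /(_ I) [].
by move/eqP; rewrite sqrf_eq0 => /eqP.
Qed.

Lemma sqintgM f g : sqintg f -> sqintg g -> intg (fun x => f x * g x).
Proof.
move=> [mf hf] [mg hg]; apply: intg_le (intgD hf hg) _; first exact: measurable_funM.
move=> x; rewrite normrM -(real_normK (num_real (f x))) -(real_normK (num_real (g x))).
by have := sqr_ge0 (`|f x| - `|g x|); have := normr_ge0 (f x); have := normr_ge0 (g x); nra.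
Qed.

Lemma sqintgD f g : sqintg f -> sqintg g -> sqintg (fun x => f x + g x).
Proof.
move=> [mf hf] [mg hg]; split; first exact: measurable_funD.
apply: (intg_le _ (intgZ 2 (intgD hf hg))).
  by apply: measurable_funX; exact: measurable_funD.
by move=> x; rewrite ger0_norm ?sqr_ge0//; have := sqr_ge0 (f x - g x); nra.
Qed.

Lemma sqintgZ (c : R) f : sqintg f -> sqintg (fun x => c * f x).
Proof.
move=> [mf hf]; split; first by apply: measurable_funM => //; exact: measurable_cst.
by under eq_fun do rewrite exprMn; exact: intgZ.
Qed.

Lemma sqintgN f : sqintg f -> sqintg (fun x => - f x).
Proof. by move=> /(sqintgZ (-1)); under eq_fun do rewrite mulN1r. Qed.

Lemma sqintgB f g : sqintg f -> sqintg g -> sqintg (fun x => f x - g x).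
Proof. by move=> hf hg; apply: sqintgD => //; exact: sqintgN. Qed.

Lemma sqintg0 : sqintg (fun _ => 0).
Proof. by split; [exact: measurable_cst|under eq_fun do rewrite expr0n; exact: intg0]. Qed.

Lemma sqintg_sum (I : Type) (s : seq I) (F : I -> T -> R) :
  (forall i, sqintg (F i)) -> sqintg (fun x => \sum_(i <- s) F i x).
Proof.
move=> h; elim: s => [|i s IH].
  by under eq_fun do rewrite big_nil; exact: sqintg0.
by under eq_fun do rewrite big_cons; exact: sqintgD.
Qed.

Lemma sqintg_bounded (C : R) f g : measurable_fun setT f -> (forall x, `|f x| <= C) ->
  sqintg g -> sqintg (fun x => f x * g x).
Proof.
move=> mf fC [mg hg]; split; first exact: measurable_funM.
apply: (intg_le _ (intgZ (C ^+ 2) hg)).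
  by apply: measurable_funX; exact: measurable_funM.
move=> x; rewrite ger0_norm ?sqr_ge0// exprMn ler_wpM2r ?sqr_ge0//.
rewrite -(real_normK (num_real (f x))) ler_pXn2r ?nnegrE ?fC//.
exact: le_trans (normr_ge0 _) (fC x).
Qed.

Lemma Rint_sqr_ge0 f : 0 <= \int[mu]_x (f x ^+ 2).
Proof. by apply: Rintegral_ge0 => x _; exact: sqr_ge0. Qed.

(** Integrates the expansions of (s f - g)^2 / s >= 0 and (s f + g)^2 / s >= 0, giving away a factor
    1/2. The free weight [s] replaces the square roots of Cauchy-Schwarz. *)
Lemma Rint_AMGM f g (s : R) : 0 < s -> sqintg f -> sqintg g ->
  `|\int[mu]_x (f x * g x)| <= s * \int[mu]_x (f x ^+ 2) + s^-1 * \int[mu]_x (g x ^+ 2).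
Proof.
move=> s0 hf hg; have [mf hf2] := hf; have [mg hg2] := hg.
rewrite -!RintZ// -RintD; try exact: intgZ.
apply: le_trans (le_normr_Rintegral _ (sqintgM hf hg)) _ => //.
apply: Rint_le.
- exact: integrable_norm (sqintgM hf hg).
- by apply: intgD; exact: intgZ.
move=> x; have s1 : s * s^-1 = 1 by rewrite divff ?gt_eqF.
have si : 0 < s^-1 by rewrite invr_gt0.
have h1 : 0 <= s^-1 * (s * f x - g x) ^+ 2 by rewrite mulr_ge0 ?sqr_ge0 ?ltW.
have h2 : 0 <= s^-1 * (s * f x + g x) ^+ 2 by rewrite mulr_ge0 ?sqr_ge0 ?ltW.
have h3 : 0 <= s * f x ^+ 2 + s^-1 * g x ^+ 2.
  by rewrite addr_ge0// mulr_ge0 ?sqr_ge0 ?ltW.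
have e1 : s^-1 * (s * f x - g x) ^+ 2 = s * f x ^+ 2 + s^-1 * g x ^+ 2 - 2 * (f x * g x).
  transitivity (s * (s * s^-1) * f x ^+ 2 + s^-1 * g x ^+ 2 - 2 * (s * s^-1) * (f x * g x)); first by ring.
  by rewrite s1 !mulr1.
have e2 : s^-1 * (s * f x + g x) ^+ 2 = s * f x ^+ 2 + s^-1 * g x ^+ 2 + 2 * (f x * g x).
  transitivity (s * (s * s^-1) * f x ^+ 2 + s^-1 * g x ^+ 2 + 2 * (s * s^-1) * (f x * g x)); first by ring.
  by rewrite s1 !mulr1.
by rewrite ler_norml; rewrite e1 in h1; rewrite e2 in h2; lra.
Qed.

Lemma sqintg_cvg (a_ : nat -> T -> R) a b : (forall k, sqintg (a_ k)) -> sqintg a ->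
  sqintg b -> \int[mu]_x ((a_ k x - a x) ^+ 2) @[k --> \oo] --> 0 ->
  \int[mu]_x (a_ k x * b x) @[k --> \oo] --> \int[mu]_x (a x * b x).
Proof.
move=> hk ha hb hc; apply/cvgrPdist_lt => e e0.
pose B := \int[mu]_x (b x ^+ 2); have B0 : 0 <= B by exact: Rint_sqr_ge0.
(* This [s] makes the fixed term [s^-1 * B] smaller than e/2, and the other term is below e/2 once
   the squared distance is below e/(2s). The summand 1 covers B = 0. *)
pose s := (2 * (B + 1)) / e; have s0 : 0 < s by rewrite divr_gt0// mulr_gt0// ltr_wpDl.
have es : 0 < e / (2 * s) by rewrite divr_gt0// mulr_gt0.
near=> k.
have -> : \int[mu]_x (a x * b x) - \int[mu]_x (a_ k x * b x) = - \int[mu]_x ((a_ k x - a x) * b x).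
  under [X in _ = - X]eq_Rintegral do rewrite mulrBl.
  by rewrite RintB ?opprB//; exact: sqintgM.
rewrite normrN; apply: le_lt_trans (Rint_AMGM s0 (sqintgB (hk k) ha) hb) _.
have h1 : `|0 - \int[mu]_x ((a_ k x - a x) ^+ 2)| < e / (2 * s).
  by near: k; move/cvgrPdist_lt : hc; exact.
rewrite sub0r normrN ger0_norm ?Rint_sqr_ge0// ltr_pdivlMr in h1; last by rewrite mulr_gt0.
have h2 : s^-1 * B < e / 2.
  rewrite ltr_pdivrMl//.
  have -> : s * (e / 2) = B + 1 by rewrite /s; field; rewrite gt_eqF.
  by rewrite ltrDl.
by rewrite -/B; lra.
Unshelve. all: by end_near. Qed.

Lemma Rdct (f_ : nat -> T -> R) f g : (forall k, measurable_fun setT (f_ k)) ->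
  (forall x, f_ ^~ x @ \oo --> f x) -> intg g -> (forall k x, `|f_ k x| <= g x) ->
  intg f /\ \int[mu]_x (f_ k x) @[k --> \oo] --> \int[mu]_x f x.
Proof.
move=> mf_ cf ig fg.
have mf : measurable_fun setT f by apply: (measurable_fun_cvg mf_) => x _; exact: cf.
have [h1 _ h3] : [/\ mu.-integrable setT (EFin \o f),
    [sequence (\int[mu]_x `|(EFin \o f_ k) x - (EFin \o f) x|)%E]_k @ \oo --> 0%E &
    [sequence (\int[mu]_x (EFin \o f_ k) x)%E]_k @ \oo --> (\int[mu]_x (EFin \o f) x)%E].
  apply: (@dominated_convergence _ _ _ mu setT measurableT _ _ (EFin \o g)) => //.
  - by move=> k; exact/measurable_EFinP.
  - exact/measurable_EFinP.
  - by apply: aeW => x _; apply: cvg_EFin; [exact: nearW|exact: cf].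
  - by apply: aeW => x k _; rewrite lee_fin.
split=> //.
have : (\int[mu]_x (f_ k x)%:E)%E @[k --> \oo] --> (\int[mu]_x f x)%:E.
  by rewrite fineK ?integrable_fin_num.
by move/fine_cvgP => [].
Qed.

Lemma Lfun2P f : f \in Lfun mu 2%:E <-> sqintg f.
Proof.
split=> [hf|[mf hf]].
  split; last exact: Lfun2_integrable_sqr.
  by move: hf; rewrite inE => /andP[]; rewrite !inE.
rewrite inE; apply/andP; split; rewrite inE//=.
rewrite /finite_norm (@lty_poweRy _ _ 2)//.
rewrite powR_Lnorm// ?pnatr_eq0//.
have /integrableP[_] := hf; apply: le_lt_trans.
rewrite le_eqVlt; apply/orP; left; apply/eqP; apply: eq_integral => x _ /=.
by rewrite powR_mulrn// normrX.
Qed.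

End L2.

(** * Functions of compact support and the integral of a derivative *)

Section compact_support.
Context {R : realType} {n : nat}.
Local Notation V := 'rV[R]_n.
Local Notation mu := (@lebesgue_rV R n).
Local Notation "''e_' i" := (delta_mx ord0 i : V) (at level 8, i at level 2).
Implicit Types (f g w : V -> R) (M : R).

Definition cube M : set V := box (const_mx (- M)) (const_mx M).

Lemma cubeP M (x : V) : cube M x <-> forall i, `|x ord0 i| <= M.
Proof. by split=> h i; have := h i; rewrite !mxE ler_norml. Qed.

Definition csupp f := exists M, 0 < M /\ forall x, ~ cube M x -> f x = 0.

Definition cc f := continuous f /\ csupp f.

Lemma test_fun_cc U f : test_fun U f -> cc f.
Proof.
move=> [cf [K [cK _ fK]]]; split; first exact: Ck_continuous (cf 0).
have [M [M0 KM]] := compact_sub_box cK.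
by exists M; split=> // x nx; apply: fK => /KM.
Qed.

Lemma csuppM f g : csupp f -> csupp (fun x => f x * g x).
Proof. by move=> [M [M0 h]]; exists M; split=> // x /h ->; rewrite mul0r. Qed.

Lemma ccM f g : cc f -> continuous g -> cc (fun x => f x * g x).
Proof.
move=> [cf sf] cg; split; last exact: csuppM.
by move=> x; apply: continuousM; [exact: cf|exact: cg].
Qed.

Lemma cc_bounded f : cc f -> exists2 C, 0 <= C & forall x, `|f x| <= C.
Proof.
move=> [cf [M [M0 h]]].
have cK : compact (cube M) by exact: compact_box.
have : compact (f @` cube M).
  by apply: continuous_compact => //; exact: continuous_subspaceT.
move=> /compact_bounded[C [Cr hC]]; exists (`|C| + 1) => [|x]; first by rewrite addr_ge0.
have [/(imageP f) fx|nx] := pselect (cube M x); last by rewrite h// normr0 addr_ge0.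
by apply: (hC (`|C| + 1)) fx; rewrite (le_lt_trans (ler_norm C))// ltrDl.
Qed.

Lemma cube_lty M : (mu (cube M) < +oo)%E.
Proof. exact: lebesgue_box_lty. Qed.

Lemma intg_indic_cube (C M : R) : intg mu (fun x => C * \1_(cube M) x).
Proof.
have mc : measurable (cube M) by exact: measurable_box.
apply: intgZ; apply/integrableP; split; first exact/measurable_EFinP.
under eq_integral do rewrite gee0_abs ?lee_fin//.
by rewrite integral_indic// setIT; exact: cube_lty.
Qed.

Lemma cc_intg f : cc f -> intg mu f.
Proof.
move=> cf; have [C C0 hC] := cc_bounded cf; have [cf' [M [M0 h]]] := cf.
apply: intg_le (intg_indic_cube C M) _; first exact: continuous_measurable_rV.
move=> x; rewrite indicE; case: (boolP (x \in cube M)) => [_|]; first by rewrite mulr1.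
by rewrite notin_setE => /h ->; rewrite mulr0 normr0.
Qed.

Lemma cc_sqintg f : cc f -> sqintg mu f.
Proof.
move=> cf; split; first exact: continuous_measurable_rV cf.1.
by apply: cc_intg; under eq_fun do rewrite expr2; apply: ccM => //; exact: cf.1.
Qed.

(** Pointwise |f| <= f^2 + 1 on the cube, which has finite measure. *)
Lemma csupp_sqintg_bounded (f : V -> R) (M : R) : sqintg mu f ->
  (forall x, ~ cube M x -> f x = 0) -> intg mu f.
Proof.
move=> [mf hf] h; apply: intg_le (intgD hf (intg_indic_cube 1 M)) _ => //.
move=> x; rewrite indicE mul1r; case: (boolP (x \in cube M)) => [_|].
  rewrite -(real_normK (num_real (f x))) /=.
  by have := normr_ge0 (f x); have := sqr_ge0 (`|f x| - 1); nra.
by rewrite notin_setE => /h ->; rewrite normr0 expr0n addr0.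
Qed.

Lemma pderive_eq0 w i (K : set V) : closed K -> (forall x, ~ K x -> w x = 0) ->
  forall x, ~ K x -> pderive i w x = 0.
Proof.
move=> cK h x nx; rewrite -(pderive_cst 0 i x); apply: pderive_near.
have : nbhs x (~` K) by apply: open_nbhs_nbhs; split => //; rewrite openC.
by apply: filterS => y /h.
Qed.

Lemma pderive_csupp w i : csupp w -> csupp (pderive i w).
Proof.
move=> [M [M0 h]]; exists M; split=> //; apply: pderive_eq0 => //.
by apply: compact_closed; [exact: norm_hausdorff|exact: compact_box].
Qed.

Lemma Ck1_MVT w i x (t : R) : Ck 1 w -> 0 < t ->
  exists2 c, 0 < c < t & w (t *: 'e_i + x) - w x = pderive i w (c *: 'e_i + x) * t.
Proof.
move=> hw t0; pose g (s : R) := w (s *: 'e_i + x).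
have dg s : is_derive s (1 : R) g (pderive i w (s *: 'e_i + x)).
  have /is_derive_lineP h := Ck_derive i (s *: 'e_i + x) hw.
  have h2 : is_derive (s - s) (1 : R) (fun h : R => w (h *: 'e_i + (s *: 'e_i + x)))
    (pderive i w (s *: 'e_i + x)) by rewrite subrr.
  have h3 := is_derive1_comp (g := fun r : R => r - s) h2 (is_derive_shift s (1 : R) (- s)).
  rewrite mulr1 in h3; apply: is_derive_eq _ (erefl _).
  congr (is_derive _ _ _ _) : h3; apply/funext => r /=.
  by rewrite addrA -scalerDl subrK.
have cg : continuous g.
  by move=> s; apply: differentiable_continuous; apply/derivable1_diffP; case: (dg s).
have [|c ct e] := MVT t0 (fun s _ => dg s); first exact: continuous_subspaceT.
by exists c; [move: ct; rewrite in_itv|move: e; rewrite /g scale0r add0r subr0].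
Qed.

(** The difference quotients along e_i have integral 0 by translation invariance. They converge to
    the derivative and are dominated by the mean value theorem. *)
Lemma Rint_pderive w i : Ck 1 w -> csupp w -> \int[mu]_x (pderive i w x) = 0.
Proof.
move=> hw sw; have cw : cc w by split=> //; exact: Ck_continuous hw.
have cdw : cc (pderive i w).
  by split; [exact: Ck_continuous (Ck_pderive i hw)|exact: pderive_csupp].
have [C C0 hC] := cc_bounded cdw; have [M [M0 hM]] := sw.
pose F (k : nat) x := k.+1%:R * (w (k.+1%:R^-1 *: 'e_i + x) - w x).
have ws k : intg mu (fun x => w (k.+1%:R^-1 *: 'e_i + x)).
  have := integrable_shift (k.+1%:R^-1 *: 'e_i) (cc_intg cw).
  by apply: eq_integrable => // x _ /=; rewrite addrC.
have F0 k : \int[mu]_x F k x = 0.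
  rewrite RintZ; last by apply: intgB => //; exact: cc_intg.
  rewrite RintB//; last exact: cc_intg.
  under eq_Rintegral do rewrite addrC.
  by rewrite Rintegral_shift ?subrr ?mulr0//; exact: cc_intg.
have Fc x : F ^~ x @ \oo --> pderive i w x.
  have [dw _] := hw.2 i; have /= h := dw x.
  pose t (k : nat) : R := k.+1%:R^-1.
  have tc : t k @[k --> \oo] --> 0^'.
    move=> A nA; have h0 : \forall k \near \oo, t k != 0 -> A (t k) by exact: cvg_harmonic nA.
    by apply: filterS h0 => k; apply; rewrite /t invr_eq0 pnatr_eq0.
  have h' : (fun u => u^-1 *: ((w \o shift x) (u *: 'e_i) - w x)) @ 0^' --> pderive i w x by [].
  move=> A nA; have h0 : \forall k \near \oo,
    A ((t k)^-1 *: ((w \o shift x) (t k *: 'e_i) - w x)) by exact: tc _ (h' _ nA).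
  by apply: filterS h0 => k; rewrite /F /t /= invrK.
(* The shifts have length at most 1, hence the cube enlarged by 1. *)
have FC k x : `|F k x| <= C * \1_(cube (M + 1)) x.
  have k0 : (0 : R) < k.+1%:R^-1 by rewrite invr_gt0.
  rewrite indicE; case: (boolP (x \in _)) => [_|].
    have [c _ e] := Ck1_MVT i x hw k0.
    by rewrite /F e mulrCA mulfV ?pnatr_eq0// !mulr1 hC.
  rewrite notin_setE => nx; rewrite /F !hM ?subrr ?mulr0 ?normr0//.
    by move=> /cubeP h; apply: nx; apply/cubeP => j; rewrite (le_trans (h j))// lerDl.
  move=> /cubeP h; apply: nx; apply/cubeP => j; have := h j; rewrite !mxE eqxx /=.
  set u := _ * _ => hu.
  have u1 : `|u| <= 1.
    rewrite /u normrM ger0_norm ?invr_ge0// mulr_ile1 ?invr_ge0//.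
      by rewrite invf_le1// ler1n.
    by case: (j == i); rewrite ?normr0 ?normr1.
  have -> : x ord0 j = (u + x ord0 j) - u by ring.
  by rewrite (le_trans (ler_normB _ _))// lerD.
have [_] := Rdct (fun k => intg_measurable (intgZ k.+1%:R (intgB (ws k) (cc_intg cw))))
  Fc (intg_indic_cube C (M + 1)) FC.
rewrite (_ : (fun k => _) = fun _ => 0); last by apply/funext => k; exact: F0.
by move=> /(cvg_lim (@Rhausdorff R)) <-; rewrite lim_cst.
Qed.

End compact_support.

(** * Integration by parts, Poincare and Hardy inequalities *)

#[local] Opaque pderive.

Section ibp.
Context {R : realType} {n : nat}.
Local Notation V := 'rV[R]_n.
Local Notation mu := (@lebesgue_rV R n).
Local Notation "''e_' i" := (delta_mx ord0 i : V) (at level 8, i at level 2).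
Implicit Types (f g v w : V -> R) (M : R) (i j : 'I_n).

(** Schwarz's theorem: two applications of the mean value theorem write the second difference as e^2
    times a mixed derivative at a point close to x ([key]). The second difference is symmetric in
    the two directions, and continuity brings both points back to x. *)
Lemma pderiveC f i j x : Ck 2 f -> pderive i (pderive j f) x = pderive j (pderive i f) x.
Proof.
move=> hf.
have key a b e : 0 < e -> exists2 c : R * R, 0 < c.1 < e /\ 0 < c.2 < e &
   f (e *: 'e_a + (e *: 'e_b + x)) - f (e *: 'e_a + x) - (f (e *: 'e_b + x) - f x) =
   pderive b (pderive a f) (c.2 *: 'e_b + (c.1 *: 'e_a + x)) * e * e.
  move=> e0; pose g y := f (y + e *: 'e_b) - f y.
  have hg : Ck 1 g by apply: CkB; [apply: Ck_shift|]; exact: CkW.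
  have [c1 c1e h1] := Ck1_MVT a x hg e0.
  have [c2 c2e h2] := Ck1_MVT b (c1 *: 'e_a + x) (Ck_pderive a hf) e0.
  exists (c1, c2) => //=; rewrite -h2.
  move: h1; rewrite (pderiveB _ _ (Ck_shift _ (CkW hf)) (CkW hf)).
  rewrite (pderive_shift _ _ _ (CkW hf)) [_ + e *: 'e_b]addrC => <-.
  by rewrite /g -[_ + x + e *: 'e_b]addrA [x + e *: 'e_b]addrC; ring.
have c2 a b : continuous (pderive a (pderive b f)).
  exact: Ck_continuous (Ck_pderive a (Ck_pderive b hf)).
apply/eqP; rewrite -subr_eq0 -normr_le0; apply/ler_addgt0Pr => e e0; rewrite add0r.
have near a b : exists2 r, 0 < r & forall c1 c2, 0 < c1 < r -> 0 < c2 < r ->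
   `|pderive a (pderive b f) x - pderive a (pderive b f) (c2 *: 'e_a + (c1 *: 'e_b + x))| < e / 2.
  have /cvgrPdist_lt/(_ (e / 2)) := c2 a b x.
  rewrite divr_gt0// => /(_ isT)/nbhs_ballP[r /= r0 hr].
  exists (r / 2) => [|c1 c2' /andP[c10 c1r] /andP[c20 c2r]]; first by rewrite divr_gt0.
  apply: hr; apply/ball_rVP => // l; rewrite !mxE eqxx /=.
  rewrite (_ : _ - _ = - (c2' * (l == a)%:R + c1 * (l == b)%:R)); last by ring.
  rewrite normrN; case: (l == a); case: (l == b); rewrite ?mulr1 ?mulr0 ?addr0 ?add0r ?normr0//;
   rewrite gtr0_norm ?addr_gt0//; lra.
have [r1 r10 h1] := near j i; have [r2 r20 h2] := near i j.
pose t := Num.min r1 r2 / 2.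
have t0 : 0 < t by rewrite divr_gt0// lt_min r10.
have tr : t < r1 /\ t < r2.
  have : t < Num.min r1 r2 by rewrite /t ltr_pdivrMr// mulr_natr mulr2n ltrDl lt_min r10.
  by rewrite lt_min => /andP[].
have [[a1 a2] /= [/andP[a10 a1t] /andP[a20 a2t]] ea] := key i j t t0.
have [[b1 b2] /= [/andP[b10 b1t] /andP[b20 b2t]] eb] := key j i t t0.
have e12 : pderive j (pderive i f) (a2 *: 'e_j + (a1 *: 'e_i + x)) =
           pderive i (pderive j f) (b2 *: 'e_i + (b1 *: 'e_j + x)).
  have tn : t != 0 by rewrite gt_eqF.
  move: ea eb; move: (pderive j (pderive i f) _) (pderive i (pderive j f) _) => P Q ea eb.
  apply: (mulIf tn); apply: (mulIf tn); rewrite -ea -eb.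
  by rewrite [t *: 'e_j + (_ + x)]addrCA; ring.
have k1 := h1 a1 a2; have k2 := h2 b1 b2.
rewrite a10 a20 b10 b20 /= (lt_trans a1t tr.1) (lt_trans a2t tr.1) in k1 k2.
rewrite (lt_trans b1t tr.2) (lt_trans b2t tr.2) -e12 in k2.
move: (k1 isT isT) (k2 isT isT) => {k1 k2 e12 h1 h2 ea eb}.
move: (pderive i (pderive j f) x) (pderive j (pderive i f) x) => P Q.
move: (pderive _ _ _) => S.
by rewrite ltr_norml ltr_norml ler_norml => *; lra.
Qed.

Lemma Rint_ibp f g i : Ck 1 f -> Ck 1 g -> csupp f ->
  \int[mu]_x (pderive i f x * g x) = - \int[mu]_x (f x * pderive i g x).
Proof.
move=> hf hg sf.
have cf : cc f by split=> //; exact: Ck_continuous hf.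
have cdf : cc (pderive i f).
  by split; [exact: Ck_continuous (Ck_pderive i hf)|exact: pderive_csupp].
have i1 : intg mu (fun x => f x * pderive i g x).
  by apply/cc_intg/ccM => //; exact: Ck_continuous (Ck_pderive i hg).
have i2 : intg mu (fun x => pderive i f x * g x).
  by apply/cc_intg/ccM => //; exact: Ck_continuous hg.
apply/eqP; rewrite -addr_eq0 addrC -RintD//; apply/eqP.
rewrite -(Rint_pderive i (CkM hf hg) (csuppM g sf)).
by apply: eq_Rintegral => x _; rewrite (pderiveM i x hf hg).
Qed.

(** Both sides are minus the integral of f times a mixed second derivative of g. This exchange of
    derivatives between two factors is the analytic content of Korn for test fields. *)
Lemma Rint_swap f g i j : Ck 2 f -> Ck 2 g -> csupp f ->
  \int[mu]_x (pderive i f x * pderive j g x) = \int[mu]_x (pderive j f x * pderive i g x).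
Proof.
move=> hf hg sf.
rewrite (Rint_ibp i (CkW hf) (Ck_pderive j hg) sf) (Rint_ibp j (CkW hf) (Ck_pderive i hg) sf).
have -> : pderive i (pderive j g) = pderive j (pderive i g); last by [].
by apply/funext => x; exact: pderiveC.
Qed.

(* Integrate the i-th derivative of v^2 x_i. *)
Lemma poincare v M i : Ck 1 v -> (forall x, ~ cube M x -> v x = 0) -> 0 < M ->
  \int[mu]_x (v x ^+ 2) <= 4 * M ^+ 2 * \int[mu]_x (pderive i v x ^+ 2).
Proof.
move=> hv sv M0; have sv' : csupp v by exists M.
have cv : cc v by split=> //; exact: Ck_continuous hv.
have cdv : cc (pderive i v).
  by split; [exact: Ck_continuous (Ck_pderive i hv)|exact: pderive_csupp].
pose w x := v x * v x * x ord0 i.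
have hw : Ck 1 w by apply: CkM; [exact: CkM|exact: Ck_coor].
have sw : csupp w by apply: csuppM; exact: csuppM.
have cdw : cc (pderive i w).
  by split; [exact: Ck_continuous (Ck_pderive i hw)|exact: pderive_csupp].
have ew x : pderive i w x = v x ^+ 2 + 2 * v x * pderive i v x * x ord0 i.
  rewrite (pderiveM i x (CkM hv hv) (Ck_coor 1 i)) (pderiveM i x hv hv).
  by rewrite pderive_coor eqxx /=; ring.
have := Rint_pderive i hw sw; have [_ iv] := cc_sqintg cv; have [_ idv] := cc_sqintg cdv.
(* On the cube the right integrand exceeds v^2 by at least (v + 2 x_i d_i v)^2. Since d_i w has
   integral 0, only the term with the constant 4 M^2 remains. *)
have : \int[mu]_x (v x ^+ 2) <=
   \int[mu]_x (2 * pderive i w x + 4 * M ^+ 2 * pderive i v x ^+ 2).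
  apply: Rint_le => //; first by apply: intgD; apply: intgZ => //; exact: cc_intg.
  move=> x; rewrite ew; have [/cubeP/(_ i)|nx] := pselect (cube M x).
    have := sqr_ge0 (v x + 2 * pderive i v x * x ord0 i); set p := pderive i v x.
    rewrite ler_norml => h /andP[h1 h2].
    have : x ord0 i ^+ 2 <= M ^+ 2 by nra.
    have := sqr_ge0 p => p0 h3.
    have : 4 * M ^+ 2 * p ^+ 2 >= 4 * x ord0 i ^+ 2 * p ^+ 2 by nra.
    by nra.
  rewrite sv// expr0n /= mulr0 mul0r mul0r addr0 mulr0 add0r.
  by rewrite mulr_ge0 ?sqr_ge0// mulr_ge0 ?sqr_ge0.
move=> h1 h0; apply: (le_trans h1); rewrite RintD.
- by rewrite RintZ ?h0 ?mulr0 ?add0r ?RintZ//; exact: cc_intg.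
- by apply: intgZ; exact: cc_intg.
- exact: intgZ.
Qed.

Definition sqnorm (x : V) : R := \sum_i x ord0 i ^+ 2.

Lemma sqnorm_ge0 x : 0 <= sqnorm x.
Proof. by apply: sumr_ge0 => i _; exact: sqr_ge0. Qed.

(* Integrate the divergence of the vector field v^2 x / (1 + |x|^2). *)
Lemma hardy v : (3 <= n)%N -> Ck 1 v -> csupp v ->
  \int[mu]_x (v x ^+ 2 * (1 + sqnorm x)^-1) <= 4 * \sum_i \int[mu]_x (pderive i v x ^+ 2).
Proof.
move=> n3 hv sv.
have cv : cc v by split=> //; exact: Ck_continuous hv.
have cdv i : cc (pderive i v).
  by split; [exact: Ck_continuous (Ck_pderive i hv)|exact: pderive_csupp].
pose rho x := (1 + sqnorm x)^-1.
have d0 x : 0 < 1 + sqnorm x by rewrite ltr_wpDr ?sqnorm_ge0.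
have hq : Ck 1 (fun x : V => 1 + sqnorm x).
  apply: CkD; first exact: Ck_cst.
  by apply: Ck_sum => i; under eq_fun do rewrite expr2; apply: CkM; exact: Ck_coor.
have hrho : Ck 1 rho by apply: Ck_inv => // x; rewrite gt_eqF.
have drho i x : pderive i rho x = - 2 * x ord0 i * rho x ^+ 2.
  have hx : is_derive x 'e_i (fun y : V => 1 + sqnorm y) (0 + 2 * x ord0 i).
    apply: is_derive_addV.
    have h := @is_derive_sum _ _ _ n (fun j (y : V) => y ord0 j * y ord0 j) x 'e_i
      (fun j => x ord0 j * (i == j)%:R + (i == j)%:R * x ord0 j)
      (fun j => is_derive_mulV (is_derive_coor x i j) (is_derive_coor x i j)).
    have -> : sqnorm = \sum_(j < n) (fun y : V => y ord0 j * y ord0 j).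
      by apply/funext => y; rewrite fct_sumE; apply: eq_bigr => j _; rewrite expr2.
    apply: is_derive_eq h _; rewrite (bigD1 i)//= eqxx big1 => [|j ji]; first by rewrite /= mulr1 mul1r addr0 mulr_natl mulr2n.
    by rewrite eq_sym (negbTE ji) mulr0 mul0r addr0.
  by rewrite (pderiveE (is_derive_invV (lt0r_neq0 (d0 x)) hx)) /rho; ring.
pose w i x := v x * v x * (x ord0 i * rho x).
have hw i : Ck 1 (w i) by apply: CkM; [exact: CkM|apply: CkM => //; exact: Ck_coor].
have sw i : csupp (w i) by apply: csuppM; exact: csuppM.
have cdw i : cc (pderive i (w i)).
  by split; [exact: Ck_continuous (Ck_pderive i (hw i))|exact: pderive_csupp].
have ew i x : pderive i (w i) x = v x ^+ 2 * (rho x - 2 * x ord0 i ^+ 2 * rho x ^+ 2) +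
    2 * (v x * rho x * x ord0 i) * pderive i v x.
  rewrite (pderiveM i x (CkM hv hv) (CkM (Ck_coor 1 i) hrho)) (pderiveM i x hv hv).
  by rewrite (pderiveM (f := fun y : V => y ord0 i) i x (Ck_coor 1 i) hrho) pderive_coor eqxx drho /=; ring.
have irho : intg mu (fun x => v x ^+ 2 * rho x).
  apply: cc_intg; apply: ccM; last exact: Ck_continuous hrho.
  by under eq_fun do rewrite expr2; apply: ccM => //; exact: cv.1.
have isum : intg mu (fun x => \sum_i (2 * pderive i (w i) x + 4 * pderive i v x ^+ 2)).
  apply: intg_sum => i; apply: intgD; apply: intgZ; first exact: cc_intg.
  by have [] := cc_sqintg (cdv i).
apply: (@le_trans _ _ (\int[mu]_x \sum_i (2 * pderive i (w i) x + 4 * pderive i v x ^+ 2))).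
  apply: Rint_le => // x.
  pose a i := v x * rho x * x ord0 i.
  (* The square (v rho x_i + 2 d_i v)^2 >= 0 absorbs the cross term of 2 d_i w_i into 4 (d_i v)^2,
     at the cost of v^2 rho^2 x_i^2. *)
  have h1 : \sum_i (2 * pderive i (w i) x + 4 * pderive i v x ^+ 2) >=
     \sum_i (2 * v x ^+ 2 * rho x - (4 * v x ^+ 2 * rho x ^+ 2 + v x ^+ 2 * rho x ^+ 2) * x ord0 i ^+ 2).
    apply: ler_sum => i _; rewrite ew.
    have := sqr_ge0 (v x * rho x * x ord0 i + 2 * pderive i v x).
    by move: (v x) (rho x) (x ord0 i) (pderive i v x) => p q r s; nra.
  apply: le_trans h1.
  rewrite sumrB -[X in _ - X]mulr_sumr -/(sqnorm x) sumr_const card_ord.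
  have e1 : rho x * sqnorm x = 1 - rho x.
    by apply: (@mulfI _ (1 + sqnorm x)); rewrite ?gt_eqF// /rho; field; rewrite gt_eqF.
  have r0 : 0 < rho x by rewrite invr_gt0.
  (* As rho |x|^2 = 1 - rho, the lower bound sums to v^2 rho (2n - 5 + 5 rho). This is at least v^2
     rho because n >= 3 gives 2n - 5 >= 1. *)
  have -> : (4 * v x ^+ 2 * rho x ^+ 2 + v x ^+ 2 * rho x ^+ 2) * sqnorm x =
     5 * (v x ^+ 2 * rho x) * (1 - rho x) by rewrite -e1; ring.
  rewrite -[_ *+ n]mulr_natl; have n3R : 3 <= n%:R :> R by rewrite ler_nat.
  have A0 : 0 <= v x ^+ 2 * rho x by rewrite mulr_ge0 ?sqr_ge0 ?ltW.
  rewrite -/(rho x); move: A0; rewrite -[2 * _ * _]mulrA; set A := v x ^+ 2 * rho x => A0.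
  have h3 : 0 <= n%:R - 3 :> R by rewrite subr_ge0.
  have := mulr_ge0 A0 h3.
  have := mulr_ge0 A0 (ltW r0).
  by nra.
rewrite Rint_sum; last first.
  move=> i; apply: intgD; apply: intgZ; first exact: cc_intg.
  by have [] := cc_sqintg (cdv i).
rewrite mulr_sumr; apply: ler_sum => i _.
rewrite RintD ?RintZ ?Rint_pderive// ?mulr0 ?add0r//; try exact: cc_intg.
- by have [] := cc_sqintg (cdv i).
- by apply: intgZ; exact: cc_intg.
- by apply: intgZ; have [] := cc_sqintg (cdv i).
Qed.

End ibp.

(** * Density of test functions and mollification *)

Import HBNNSimple.

Section density.
Context {R : realType} {n : nat}.
Local Notation V := 'rV[R]_n.
Local Notation mu := (@lebesgue_rV R n).
Implicit Types (a b : V) (f g phi : V -> R).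

(** The tolerance bounds the squared L^2 distance. The support stays in one closed box, so an
    approximant is a test function of every set containing that box. *)
Definition tapprox a b g := forall e : R, 0 < e -> exists phi : V -> R,
  [/\ Cinfty phi, forall x, ~ box a b x -> phi x = 0 &
      \int[mu]_x ((phi x - g x) ^+ 2) <= e].

Lemma box_csupp a b g : (forall x, ~ box a b x -> g x = 0) -> csupp g.
Proof.
move=> h; have [M [M0 hM]] := compact_sub_box (@compact_box R n a b).
by exists M; split=> // x nx; apply: h => /hM.
Qed.

Lemma box_cc a b phi : Cinfty phi -> (forall x, ~ box a b x -> phi x = 0) -> cc phi.
Proof. by move=> hc h; split; [exact: Ck_continuous (hc 0)|exact: box_csupp h]. Qed.

Lemma sqintg_tri f g h : sqintg mu f -> sqintg mu g -> sqintg mu h ->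
  \int[mu]_x ((f x - h x) ^+ 2) <=
  2 * \int[mu]_x ((f x - g x) ^+ 2) + 2 * \int[mu]_x ((g x - h x) ^+ 2).
Proof.
move=> hf hg hh; have [_ i1] := sqintgB hf hg; have [_ i2] := sqintgB hg hh.
have [_ i3] := sqintgB hf hh.
rewrite -!RintZ// -RintD; try exact: intgZ.
apply: Rint_le => //; first by apply: intgD; exact: intgZ.
by move=> x; have := sqr_ge0 (f x - g x - (g x - h x)); nra.
Qed.

Lemma tapproxD a b f g : sqintg mu f -> sqintg mu g ->
  tapprox a b f -> tapprox a b g -> tapprox a b (fun x => f x + g x).
Proof.
move=> sf sg hf hg e e0.
have e4 : 0 < e / 4 by rewrite divr_gt0.
have [p [p1 p2 p3]] := hf _ e4; have [q [q1 q2 q3]] := hg _ e4.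
exists (fun x => p x + q x); split=> [k|x nx|].
- by apply: CkD; [exact: p1|exact: q1].
- by rewrite p2// q2// addr0.
have sp := cc_sqintg (box_cc p1 p2); have sq := cc_sqintg (box_cc q1 q2).
have [_ i1] := sqintgB sp sf; have [_ i2] := sqintgB sq sg.
apply: (@le_trans _ _ (2 * \int[mu]_x ((p x - f x) ^+ 2) + 2 * \int[mu]_x ((q x - g x) ^+ 2))).
  rewrite -!RintZ// -RintD; try exact: intgZ.
  apply: Rint_le; [|by apply: intgD; exact: intgZ|].
    by have [] := sqintgB (sqintgD sp sq) (sqintgD sf sg).
  by move=> x; have := sqr_ge0 (p x - f x - (q x - g x)); nra.
by lra.
Qed.

Lemma tapproxZ a b (c : R) f : sqintg mu f -> tapprox a b f ->
  tapprox a b (fun x => c * f x).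
Proof.
move=> sf hf e e0; have d0 : 0 < c ^+ 2 + 1 by rewrite ltr_wpDl ?sqr_ge0.
have [p [p1 p2 p3]] := hf _ (divr_gt0 e0 d0).
exists (fun x => c * p x); split=> [k|x nx|].
- by apply: CkM; [exact: Ck_cst|exact: p1].
- by rewrite p2// mulr0.
have sp := cc_sqintg (box_cc p1 p2); have [_ i1] := sqintgB sp sf.
under eq_Rintegral do rewrite -mulrBr exprMn.
rewrite RintZ//; rewrite ler_pdivlMr// in p3; apply: le_trans p3.
rewrite mulrDr mulr1 mulrC lerDl; exact: Rint_sqr_ge0.
Qed.

Lemma tapprox_sum a b (I : Type) (s : seq I) (F : I -> V -> R) :
  (forall i, sqintg mu (F i)) -> (forall i, tapprox a b (F i)) ->
  tapprox a b (fun x => \sum_(i <- s) F i x).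
Proof.
move=> sF hF; elim: s => [|i s IH].
  move=> e e0; exists (fun _ => 0); split=> [k|//|]; first exact: Ck_cst.
  under eq_Rintegral do rewrite big_nil subr0 expr0n /=.
  by rewrite Rintegral0 ltW.
under eq_fun do rewrite big_cons.
by apply: tapproxD => //; exact: sqintg_sum.
Qed.

Lemma tapprox_lim a b (f_ : nat -> V -> R) f : (forall k, sqintg mu (f_ k)) ->
  sqintg mu f -> (forall k, tapprox a b (f_ k)) ->
  \int[mu]_x ((f_ k x - f x) ^+ 2) @[k --> \oo] --> 0 -> tapprox a b f.
Proof.
move=> sf_ sf hf_ hc e e0; have e4 : 0 < e / 4 by rewrite divr_gt0.
have [k hk] : exists k, \int[mu]_x ((f_ k x - f x) ^+ 2) < e / 4.
  move/cvgrPdist_lt : hc => /(_ _ e4)[k _ /(_ k (leqnn k))].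
  by rewrite /= sub0r normrN ger0_norm ?Rint_sqr_ge0//; exists k.
have [p [p1 p2 p3]] := hf_ k _ e4; exists p; split=> //.
have := sqintg_tri (cc_sqintg (box_cc p1 p2)) (sf_ k) sf.
by lra.
Qed.

Lemma Rdct_sq (f_ : nat -> V -> R) f g : (forall k, measurable_fun setT (f_ k)) ->
  measurable_fun setT f -> (forall x, f_ ^~ x @ \oo --> f x) -> intg mu g ->
  (forall k x, (f_ k x - f x) ^+ 2 <= g x) ->
  \int[mu]_x ((f_ k x - f x) ^+ 2) @[k --> \oo] --> 0.
Proof.
move=> mf_ mf hc ig hg.
have [| | |_] := @Rdct _ _ _ mu (fun k x => (f_ k x - f x) ^+ 2) (fun _ => 0) g _ _ ig.
- by move=> k; apply: measurable_funX; exact: measurable_funB.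
- move=> x; rewrite [X in _ --> X](_ : _ = (f x - f x) * (f x - f x)); last by rewrite subrr mulr0.
  by under eq_fun do rewrite expr2; apply: cvgM; apply: cvgB => //; exact: cvg_cst.
- by move=> k x; rewrite ger0_norm ?sqr_ge0.
by rewrite Rintegral0.
Qed.

Lemma indic_sqintg (A : set V) (M : R) : measurable A -> A `<=` cube M ->
  sqintg mu (\1_A : V -> R).
Proof.
move=> mA AM; split; first exact: measurable_indic.
apply: intg_le (intg_indic_cube 1 M) _; first by apply: measurable_funX; exact: measurable_indic.
move=> x; rewrite !indicE mul1r; case: (boolP (x \in A)) => [/set_mem/AM/mem_set ->|_] /=.
  by rewrite expr1n normr1.
by rewrite expr0n normr0.
Qed.

(** Cutoffs with ramps of width 1/(k+1) are eventually 1 at each point of the open box and vanish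
    outside it; dominated convergence concludes. *)
Lemma tapprox_indic_obox a b c d : obox c d `<=` box a b -> tapprox a b (\1_(obox c d) : V -> R).
Proof.
move=> sub; have [M [M0 hM]] := compact_sub_box (@compact_box R n a b).
have sO : sqintg mu (\1_(obox c d) : V -> R).
  by apply: (@indic_sqintg _ M); [exact: measurable_obox|move=> x /sub/hM].
pose f_ k := cutoff c d (k.+1%:R^-1 : R).
have k0 k : (0 : R) < k.+1%:R^-1 by rewrite invr_gt0.
have f0 k x : ~ obox c d x -> f_ k x = 0 by exact: cutoff_eq0.
have cf k : Cinfty (f_ k) by move=> l; exact: Ck_cutoff.
have fB k x : ~ box a b x -> f_ k x = 0 by move=> nx; apply: f0 => /sub.
apply: (@tapprox_lim _ _ f_) => //.
- by move=> k; exact: cc_sqintg (box_cc (cf k) (@fB k)).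
- move=> k e e0; exists (f_ k); split; [exact: cf|exact: fB|].
  by under eq_Rintegral do rewrite subrr expr0n /=; rewrite Rintegral0 ltW.
apply: (@Rdct_sq _ _ (fun x => 1 * \1_(cube M) x)).
- by move=> k; apply: continuous_measurable_rV; exact: Ck_continuous (cf k 0).
- by have [] := sO.
- move=> x; rewrite indicE; case: (boolP (x \in obox c d)) => /= [/set_mem xO|]; last first.
    rewrite notin_setE => nx; apply: cvg_near_cst; apply: nearW => k; exact: f0.
  apply: cvg_near_cst.
  have hh i : \forall k \near \oo, c ord0 i + k.+1%:R^-1 <= x ord0 i <= d ord0 i - k.+1%:R^-1.
    have /andP[h1 h2] := xO i; rewrite -subr_gt0 in h1; rewrite -subr_gt0 in h2.
    near=> k.
    have : (k.+1%:R^-1 : R) < x ord0 i - c ord0 i.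
      by near: k; exact: (cvgr_lt _ (@cvg_harmonic R) _ h1).
    have : (k.+1%:R^-1 : R) < d ord0 i - x ord0 i.
      by near: k; exact: (cvgr_lt _ (@cvg_harmonic R) _ h2).
    by move: (k.+1%:R^-1) => t; lra.
  have : \forall k \near \oo, forall i, c ord0 i + k.+1%:R^-1 <= x ord0 i <= d ord0 i - k.+1%:R^-1.
    exact: filter_forall hh.
  by apply: filterS => k hk; exact: cutoff_eq1.
- exact: intg_indic_cube.
- move=> k x; rewrite mul1r !indicE.
  case: (boolP (x \in cube M)) => /= [_|].
    have := cutoff_ge0 c d (k.+1%:R^-1 : R) x.
    have := cutoff_le1 c d (k.+1%:R^-1 : R) x; rewrite -/(f_ k x).
    by case: (x \in obox c d) => /=; nra.
  rewrite notin_setE => nx; rewrite f0; last by move/sub/hM.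
  by rewrite memNset ?subr0 ?expr0n// => /sub/hM.
Unshelve. all: by end_near. Qed.

Lemma oboxI a b c d : obox a b `&` obox c d =
  obox (\row_i Num.max (a ord0 i) (c ord0 i)) (\row_i Num.min (b ord0 i) (d ord0 i)).
Proof.
apply/seteqP; split=> [x [h k] i|x h]; last split=> i; last 2 first.
- by have := h i; rewrite !mxE gt_max lt_min => /andP[/andP[-> _] /andP[-> _]].
- by have := h i; rewrite !mxE gt_max lt_min => /andP[/andP[_ ->] /andP[_ ->]].
by rewrite !mxE gt_max lt_min; have /andP[-> ->] := h i; have /andP[-> ->] := k i.
Qed.

Definition oboxes : set (set V) := [set A | exists c d, A = obox c d].

(** It suffices to look at preimages of open intervals under a coordinate; these are open, hence
    countable unions of open boxes. A pi-lambda argument can therefore start from open boxes. *)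
Lemma oboxes_measurable (A : set V) : measurable A -> <<s oboxes >> A.
Proof.
have sO := smallest_sigma_algebra setT oboxes.
have oO (U : set V) : open U -> <<s oboxes >> U.
  move=> oU; have [->|/set0P U0] := eqVneq U set0; first exact: sigma_algebra0.
  have [c [d [cdU Ucd]]] := open_box_cover oU U0.
  have -> : U = \bigcup_k obox (c k) (d k).
    by apply/seteqP; split=> // x [k _ /obox_sub_box/cdU].
  apply: sigma_algebra_bigcup => k; apply: sub_sigma_algebra.
  by exists (c k), (d k).
apply: smallest_sub => // {A}.
rewrite -bigcup_seq; apply: bigcup_sub => i _ A [B mB <-].
rewrite setTI.
suff mc : measurable_fun setT (fun x : g_sigma_algebraType oboxes => (x : V) ord0 i : measurableTypeR R).
  by have := mc measurableT B mB; rewrite setTI.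
apply: (measurability _ (RGenOpens.measurableE R)).
move=> _ [_ [s [t ->] <-]]; rewrite setTI; apply: oO.
by apply: open_comp => // x _; exact: coord_continuous.
Qed.

(** Pi-lambda theorem: the good sets include the open boxes, which are closed under intersection,
    and are stable under proper differences and increasing unions. Intersecting with [obox a b]
    keeps measures finite and supports in one box. *)
Lemma tapprox_indic a b (A : set V) : measurable A ->
  tapprox a b (\1_(A `&` obox a b) : V -> R).
Proof.
move=> mA; have [M [M0 hM]] := compact_sub_box (@compact_box R n a b).
have sB (B : set V) : measurable B -> sqintg mu (\1_(B `&` obox a b) : V -> R).
  move=> mB; apply: (@indic_sqintg _ M).
    by apply: measurableI => //; exact: measurable_obox.
  by move=> x [_ /obox_sub_box/hM].
pose H : set (set V) := [set B | measurable B /\ tapprox a b (\1_(B `&` obox a b) : V -> R)].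
suff : H A by case.
have GI : setI_closed oboxes.
  by move=> _ _ [c [d ->]] [c' [d' ->]]; rewrite oboxI; eexists; eexists.
apply: (lambda_system_subset GI _ _ _ (oboxes_measurable mA)) => //.
- split=> //.
  + split; first exact: measurableT.
    by rewrite setTI; apply: tapprox_indic_obox; exact: obox_sub_box.
  + move=> B C CB [mB hB] [mC hC]; split; first exact: measurableD.
    have -> : (\1_((B `\` C) `&` obox a b) : V -> R) =
       (fun x => \1_(B `&` obox a b) x + -1 * \1_(C `&` obox a b) x).
      apply/funext => x; rewrite !indicE in_setI in_setD !in_setI.
      case: (boolP (x \in C)) => [/set_mem/CB/mem_set ->|_];
      case: (x \in obox a b); case: (x \in B) => /=; rewrite ?mulr0 ?mulr1 ?addr0 ?subrr//.
    apply: tapproxD; [exact: sB|by apply: sqintgZ; exact: sB|by []|].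
    by apply: tapproxZ => //; exact: sB.
  + move=> F ndF hF; have mU : measurable (\bigcup_k F k).
      by apply: bigcupT_measurable => k; have [] := hF k.
    split=> //; apply: (@tapprox_lim _ _ (fun k => \1_(F k `&` obox a b))).
    * by move=> k; apply: sB; have [] := hF k.
    * exact: sB.
    * by move=> k; have [] := hF k.
    apply: (@Rdct_sq _ _ (fun x => 1 * \1_(cube M) x)).
    * by move=> k; have [] := sB _ (hF k).1.
    * by have [] := sB _ mU.
    * move=> x; apply: cvg_near_cst; have [[k _ Fkx]|nx] := pselect ((\bigcup_k F k) x).
        exists k => // l /= kl; rewrite !indicE !in_setI.
        have Flx : F l x by move: Fkx; apply/subsetPset/ndF.
        rewrite (mem_set Flx) (_ : x \in \bigcup_k F k = true)//.
        by apply/mem_set; exists k.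
      apply: nearW => l; rewrite !indicE !in_setI.
      rewrite (_ : x \in F l = false); last by apply/negP => /set_mem h; apply: nx; exists l.
      by rewrite (_ : x \in \bigcup_k F k = false)//; apply/negP => /set_mem.
    * exact: intg_indic_cube.
    move=> k x; rewrite mul1r !indicE !in_setI.
    case: (boolP (x \in cube M)) => [_|].
      by case: (x \in F k); case: (x \in obox a b); case: (x \in \bigcup_k F k);
        rewrite /= ?subrr ?subr0 ?sub0r ?sqrrN ?expr0n ?expr1n ?ler01.
    rewrite notin_setE => nx.
    rewrite (_ : x \in obox a b = false) ?andbF ?subrr ?expr0n//.
    by apply/negP => /set_mem/obox_sub_box/hM.
- move=> _ [c [d ->]]; split; first exact: measurable_obox.
  by rewrite oboxI; apply: tapprox_indic_obox; rewrite -oboxI => x [_ /obox_sub_box].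
Qed.

(** Simple functions increase to [g]. Lying between 0 and [g] they vanish off the open box, so each
    level set may be cut with that box without changing them. *)
Lemma tapprox_ge0 a b g : sqintg mu g -> (forall x, 0 <= g x) ->
  (forall x, ~ obox a b x -> g x = 0) -> tapprox a b g.
Proof.
move=> sg g0 gB; have [mg ig] := sg.
have [M [M0 hM]] := compact_sub_box (@compact_box R n a b).
have mge : measurable_fun setT (EFin \o g) by exact/measurable_EFinP.
pose h k : V -> R := nnsfun_approx measurableT mge k.
have hc x : h ^~ x @ \oo --> g x.
  have /fine_cvgP[_] := cvg_nnsfun_approx measurableT mge (fun x _ => g0 x) (x := x) I.
  by [].
have hle k x : h k x <= g x.
  have nd : nondecreasing_seq (h ^~ x).
    by move=> i j ij; have /lefP := nd_nnsfun_approx measurableT mge ij; exact.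
  have := nondecreasing_cvgn_le nd (cvgP _ (hc x)) k.
  by rewrite (cvg_lim _ (hc x)).
have h0 k x : 0 <= h k x by exact: fun_ge0.
have mh k : measurable_fun setT (h k) by exact: measurable_funP.
have sh k : sqintg mu (h k).
  split=> //; apply: intg_le ig _; first exact: measurable_funX.
  by move=> x; rewrite ger0_norm ?sqr_ge0// ler_pXn2r ?nnegrE.
apply: (@tapprox_lim _ _ h) => // [k|]; last first.
  apply: (@Rdct_sq _ _ (fun x => g x ^+ 2)) => // k x.
  by have := hle k x; have := h0 k x; nra.
pose s : seq R := finmap.enum_fset (fset_set (range (h k))).
have hE : h k = fun x => \sum_(y <- s) y * \1_(h k @^-1` [set y] `&` obox a b) x.
  apply/funext => x; have [xB|nx] := pselect (obox a b x).
    rewrite {1}/h fimfunE fsbig_finite//=; apply: eq_bigr => y _; congr (_ * _).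
    by rewrite !indicE in_setI (mem_set xB) andbT.
  rewrite big1 => [|y _]; last by rewrite indicE in_setI [X in _ && X]memNset// andbF mulr0.
  by apply/eqP; rewrite eq_le h0 andbT -(gB x nx) hle.
rewrite hE; apply: tapprox_sum => i.
  apply: sqintgZ; apply: (@indic_sqintg _ M).
    apply: measurableI; last exact: measurable_obox.
    by rewrite -[X in measurable X]setTI; exact: mh.
  by move=> x [_ /obox_sub_box/hM].
apply: tapproxZ.
  apply: (@indic_sqintg _ M).
    apply: measurableI; last exact: measurable_obox.
    by rewrite -[X in measurable X]setTI; exact: mh.
  by move=> x [_ /obox_sub_box/hM].
by apply: tapprox_indic; rewrite -[X in measurable X]setTI; exact: mh.
Qed.

Lemma test_density a b g : sqintg mu g ->
  (forall x, ~ obox a b x -> g x = 0) -> tapprox a b g.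
Proof.
move=> sg gB; have [mg ig] := sg.
have gE : g = fun x => g^\+ x + -1 * g^\- x.
  by apply/funext => x; rewrite mulN1r -[in LHS](funrposBneg g).
have sp : sqintg mu g^\+.
  split; first exact: measurable_funrpos.
  apply: intg_le ig _; first by apply: measurable_funX; exact: measurable_funrpos.
  by move=> x; rewrite ger0_norm ?sqr_ge0// /funrpos; have [h|h] := leP (g x) 0; nra.
have sn : sqintg mu g^\-.
  split; first exact: measurable_funrneg.
  apply: intg_le ig _; first by apply: measurable_funX; exact: measurable_funrneg.
  by move=> x; rewrite ger0_norm ?sqr_ge0// /funrneg; have [h|h] := leP (- g x) 0; nra.
rewrite gE; apply: tapproxD => //; first exact: sqintgZ.
  by apply: tapprox_ge0 => // x nx; rewrite /funrpos gB// maxxx.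
by apply: tapproxZ => //; apply: tapprox_ge0 => // x nx; rewrite /funrneg gB// oppr0 maxxx.
Qed.

Lemma test_density_seq a b g : sqintg mu g ->
  (forall x, ~ obox a b x -> g x = 0) -> exists phi : nat -> V -> R,
  [/\ forall k, Cinfty (phi k), forall k x, ~ box a b x -> phi k x = 0 &
      \int[mu]_x ((phi k x - g x) ^+ 2) @[k --> \oo] --> 0].
Proof.
move=> sg gB.
have /choice[phi hphi] : forall k : nat, exists p : V -> R,
  [/\ Cinfty p, forall x, ~ box a b x -> p x = 0 &
      \int[mu]_x ((p x - g x) ^+ 2) <= k.+1%:R^-1].
  by move=> k; apply: test_density sg gB _ _; rewrite invr_gt0.
exists phi; split=> [k|k|]; [by have [] := hphi k|by have [] := hphi k|].
apply: (@squeeze_cvgr _ _ _ _ (cst 0) (fun k => k.+1%:R^-1)).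
- by apply: nearW => k; rewrite Rint_sqr_ge0; have [] := hphi k.
- exact: cvg_cst.
- exact: cvg_harmonic.
Qed.

(** On each box of a countable cover of [U], [h] cut off to the box is an L^2 limit of test
    functions of [U]; hence the integral of [h^2] over the box is 0. *)
Lemma fundamental_lemma (U : set V) h : open U -> sqintg mu h ->
  (forall phi, test_fun U phi -> \int[mu]_x (h x * phi x) = 0) ->
  {ae mu, forall x, U x -> h x = 0}.
Proof.
move=> oU sh h0; have [U0|/set0P Un0] := eqVneq U set0.
  by apply: aeW => x; rewrite U0.
have [a [b [abU Uab]]] := open_box_cover oU Un0.
have key k : {ae mu, forall x, obox (a k) (b k) x -> h x = 0}.
  pose g x := \1_(obox (a k) (b k)) x * h x.
  have sg : sqintg mu g.
    apply: (@sqintg_bounded _ _ _ _ 1) sh; first exact: measurable_indic (measurable_obox _ _).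
    by move=> x; rewrite indicE; case: (_ \in _); rewrite ?normr1 ?normr0.
  have gB x : ~ obox (a k) (b k) x -> g x = 0.
    by move=> nx; rewrite /g indicE memNset// mul0r.
  have [phi [p1 p2 p3]] := test_density_seq sg gB.
  have := sqintg_cvg (fun l => cc_sqintg (box_cc (p1 l) (@p2 l))) sg sh p3.
  rewrite (_ : (fun l => _) = fun _ => 0); last first.
    apply/funext => l; under eq_Rintegral do rewrite mulrC; apply: h0.
    split; first exact: p1.
    by exists (box (a k) (b k)); split; [exact: compact_box|exact: abU|exact: p2].
  move=> /(cvg_lim (@Rhausdorff R)); rewrite lim_cst// => gh.
  have /(Rint_sq_eq0 sg) : \int[mu]_x (g x ^+ 2) = 0.
    rewrite gh; apply: eq_Rintegral => x _; rewrite expr2 /g indicE.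
    by case: (_ \in _); rewrite ?mul1r ?mul0r.
  by apply: filterS => x + xB; rewrite /g indicE mem_set// mul1r.
have : {ae mu, forall x, forall k, obox (a k) (b k) x -> h x = 0} by exact/ae_foralln.
by apply: filterS => x hx /Uab[k _ /hx].
Qed.

End density.

(** * Mollification with possibly off-centre kernels *)

Section mollify.
Context {R : realType} {n : nat}.
Local Notation V := 'rV[R]_n.
Local Notation mu := (@lebesgue_rV R n).
Implicit Types (f g p q phi eta : V -> R).

Lemma kernel_intg p q (k : V * V -> R) (C : R) : intg mu p -> intg mu q ->
  measurable_fun setT k -> (forall z, `|k z| <= C) ->
  (mu \x mu)%E.-integrable setT (EFin \o (fun z => p z.1 * q z.2 * k z)).
Proof.
move=> ip iq mk kC; have mp := intg_measurable ip; have mq := intg_measurable iq.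
have mp1 : measurable_fun setT (fun z : V * V => p z.1).
  exact: (measurableT_comp mp measurable_fst).
have mq2 : measurable_fun setT (fun z : V * V => q z.2).
  exact: (measurableT_comp mq measurable_snd).
have ipq : (mu \x mu)%E.-integrable setT (EFin \o (fun z => p z.1 * q z.2)).
  apply/integrable12ltyP; first by apply/measurable_EFinP; exact: measurable_funM.
  under eq_integral => x _.
    under eq_integral => y _ do rewrite /= normrM EFinM.
    rewrite ge0_integralZl//; last first.
      by do 2 apply: measurableT_comp => //; exact/measurable_EFinP.
    over.
  rewrite ge0_integralZr//; last 2 first.
  - by do 2 apply: measurableT_comp => //; exact/measurable_EFinP.
  - exact: integral_ge0.
  have /integrableP[_ hp] := ip; have /integrableP[_ hq] := iq.
  by apply: lte_mul_pinfty; rewrite ?ge0_fin_numE ?integral_ge0.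
have := intgZ C (ipq : intg _ _); apply: le_integrable => //.
  by apply/measurable_EFinP; apply: measurable_funM => //; exact: measurable_funM.
move=> z _ /=; rewrite lee_fin !normrM mulrC ler_wpM2r ?mulr_ge0//.
by rewrite (le_trans (kC z))// ler_norm.
Qed.

Lemma section_intg1 q (k : V * V -> R) (C : R) x : intg mu q -> measurable_fun setT k ->
  (forall z, `|k z| <= C) -> intg mu (fun y => q y * k (x, y)).
Proof.
move=> iq mk kC; have mq := intg_measurable iq.
apply: (intg_le _ (intgZ C (integrable_norm iq : intg mu (fun y => `|q y|)))).
  by apply: measurable_funM => //; exact: (measurableT_comp mk (measurable_pair1 x)).
by move=> y; rewrite normrM mulrC ler_wpM2r.
Qed.

Lemma section_intg2 p (k : V * V -> R) (C : R) y : intg mu p -> measurable_fun setT k ->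
  (forall z, `|k z| <= C) -> intg mu (fun x => p x * k (x, y)).
Proof.
move=> ip mk kC; have mp := intg_measurable ip.
apply: (intg_le _ (intgZ C (integrable_norm ip : intg mu (fun y => `|p y|)))).
  by apply: measurable_funM => //; exact: (measurableT_comp mk (measurable_pair2 y)).
by move=> x; rewrite normrM mulrC ler_wpM2r.
Qed.

Lemma Rfubini_intg p q (k : V * V -> R) (C : R) : intg mu p -> intg mu q ->
  measurable_fun setT k -> (forall z, `|k z| <= C) ->
  intg mu (fun x => p x * \int[mu]_y (q y * k (x, y))).
Proof.
move=> ip iq mk kC; have ik := kernel_intg ip iq mk kC.
have e1 : (fun x => (p x * \int[mu]_y (q y * k (x, y)))%:E) =
    (fun x => \int[mu]_y (p x * q y * k (x, y))%:E)%E.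
  apply/funext => x; have h := section_intg1 x iq mk kC.
  rewrite -RintZ// /Rintegral fineK; first by apply: eq_integral => y _; rewrite mulrA.
  by apply: integrable_fin_num => //; exact: intgZ.
by rewrite /intg /comp e1; exact: (integrable_fubini_F ik).
Qed.

(** This shape, one factor outside each inner integral, is that of a function paired with a
    convolution; boundedness of the kernel supplies the integrability. *)
Lemma Rfubini p q (k : V * V -> R) (C : R) : intg mu p -> intg mu q ->
  measurable_fun setT k -> (forall z, `|k z| <= C) ->
  [/\ intg mu (fun x => p x * \int[mu]_y (q y * k (x, y))),
      intg mu (fun y => q y * \int[mu]_x (p x * k (x, y))) &
      \int[mu]_x (p x * \int[mu]_y (q y * k (x, y))) =
      \int[mu]_y (q y * \int[mu]_x (p x * k (x, y)))].
Proof.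
move=> ip iq mk kC; have ik := kernel_intg ip iq mk kC; split.
- exact: Rfubini_intg iq mk kC.
- have mk' : measurable_fun setT (fun z : V * V => k (z.2, z.1)).
    by apply: (measurableT_comp mk); apply: measurable_fun_pair; [exact: measurable_snd|exact: measurable_fst].
  exact: (Rfubini_intg (k := fun z => k (z.2, z.1)) iq ip mk' (fun z => kC _)).
have e1 : (fun x => (p x * \int[mu]_y (q y * k (x, y)))%:E) =
    (fun x => \int[mu]_y (p x * q y * k (x, y))%:E)%E.
  apply/funext => x; have h := section_intg1 x iq mk kC.
  rewrite -RintZ// /Rintegral fineK; first by apply: eq_integral => y _; rewrite mulrA.
  by apply: integrable_fin_num => //; exact: intgZ.
have e2 : (fun y => (q y * \int[mu]_x (p x * k (x, y)))%:E) =
    (fun y => \int[mu]_x (p x * q y * k (x, y))%:E)%E.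
  apply/funext => y; have h := section_intg2 y ip mk kC.
  rewrite -RintZ// /Rintegral fineK; first by apply: eq_integral => x _; rewrite mulrCA mulrA.
  by apply: integrable_fin_num => //; exact: intgZ.
by rewrite /Rintegral e1 e2; congr fine; exact: (Fubini ik).
Qed.

(** No symmetry is asked, and the support may avoid the origin: mollifiers displaced into a domain
    are included as long as they shrink to 0 with [r]. *)
Definition mollifier (r : R) eta := [/\ Cinfty eta, forall x, 0 <= eta x,
  forall x, ~ cube r x -> eta x = 0 & \int[mu]_x eta x = 1].

Definition diffker eta : V * V -> R := fun z => eta (z.1 - z.2).

Lemma diffker_measurable eta : continuous eta -> measurable_fun setT (diffker eta).
Proof.
move=> ce; apply: (measurableT_comp (continuous_measurable_rV ce)).
apply: measurable_fun_rV => i; under eq_fun do rewrite !mxE.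
apply: measurable_funB.
  exact: (measurableT_comp (measurable_coor i) measurable_fst).
exact: (measurableT_comp (measurable_coor i) measurable_snd).
Qed.

Lemma young (s w p q : R) : 0 < s -> 0 <= w ->
  `|q| * `|p * w| <= s * (p ^+ 2 * w) + s^-1 * q ^+ 2 * w.
Proof.
move=> s0 w0; rewrite normrM (ger0_norm w0).
have -> : s * (p ^+ 2 * w) + s^-1 * q ^+ 2 * w = (s * p ^+ 2 + s^-1 * q ^+ 2) * w by ring.
rewrite mulrA ler_wpM2r//.
rewrite -(real_normK (num_real p)) -(real_normK (num_real q)).
have s1 : s * s^-1 = 1 by rewrite divff ?gt_eqF.
have si : 0 < s^-1 by rewrite invr_gt0.
have : 0 <= s^-1 * (s * `|p| - `|q|) ^+ 2 by rewrite mulr_ge0 ?sqr_ge0 ?ltW.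
have -> : s^-1 * (s * `|p| - `|q|) ^+ 2 =
   s * s^-1 * (s * `|p| ^+ 2) + s^-1 * `|q| ^+ 2 - 2 * (s * s^-1) * (`|q| * `|p|) by ring.
by rewrite s1; have := mulr_ge0 (normr_ge0 q) (normr_ge0 p); lra.
Qed.

Section one_mollifier.
Variables (r : R) (eta : V -> R).
Hypotheses (r0 : 0 < r) (meta : mollifier r eta).

Lemma mollifier_cc : cc eta.
Proof.
by have [h1 _ h3 _] := meta; split; [exact: Ck_continuous (h1 0)|exists r].
Qed.

Lemma moll_int1 x : intg mu (fun z => eta (x - z)) /\ \int[mu]_z eta (x - z) = 1.
Proof.
have [_ _ _ h] := meta; have ie := cc_intg mollifier_cc.
by split; [exact: integrable_refl|rewrite Rintegral_refl].
Qed.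

Lemma moll_int2 z : intg mu (fun x => eta (x - z)) /\ \int[mu]_x eta (x - z) = 1.
Proof.
have [_ _ _ h] := meta; have ie := cc_intg mollifier_cc.
by split; [exact: integrable_shift|rewrite Rintegral_shift].
Qed.

Lemma diffker_bounded : exists C, forall z, `|diffker eta z| <= C.
Proof.
have [C _ hC] := cc_bounded mollifier_cc; exists C => z; exact: hC.
Qed.

(** Young's inequality for convolution with a probability density, in bilinear form. The bound sees
    [eta] only through positivity and unit mass, so it is uniform in [r]; this uniformity carries
    convergence from continuous functions over to L^2. *)
Lemma moll_bound f g (N s : R) : 0 < s -> sqintg mu f -> intg mu f -> sqintg mu g ->
  (forall x, ~ cube N x -> g x = 0) ->
  `|\int[mu]_x (g x * \int[mu]_z (f z * eta (x - z)))| <=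
  s * \int[mu]_x (f x ^+ 2) + s^-1 * \int[mu]_x (g x ^+ 2).
Proof.
move=> s0 sf if_ sg gN; have [mf f2] := sf; have [mg g2] := sg.
have [_ eta0 _ _] := meta.
have ig := csupp_sqintg_bounded sg gN.
have mk := diffker_measurable mollifier_cc.1; have [C kC] := diffker_bounded.
have si : 0 < s^-1 by rewrite invr_gt0.
have h1 : intg mu (fun x => g x * \int[mu]_z (f z * eta (x - z))) := Rfubini_intg ig if_ mk kC.
(* The indicator of a cube carrying [g] stands in for the constant 1, which is not integrable, so
   that Fubini applies to it and [f^2]. Its inner integral is at most 1. *)
pose ind (x : V) : R := 1 * \1_(cube N) x.
have ii : intg mu ind by exact: intg_indic_cube.
have [h2' h3' h4'] := Rfubini ii f2 mk kC.
have h2 : intg mu (fun x => ind x * \int[mu]_z (f z ^+ 2 * eta (x - z))) := h2'.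
have h3 : intg mu (fun z => f z ^+ 2 * \int[mu]_x (ind x * eta (x - z))) := h3'.
have h4 : \int[mu]_x (ind x * \int[mu]_z (f z ^+ 2 * eta (x - z))) =
  \int[mu]_z (f z ^+ 2 * \int[mu]_x (ind x * eta (x - z))) := h4'.
clear h2' h3' h4'.
apply: (le_trans (Rint_norm h1)).
apply: (@le_trans _ _ (\int[mu]_x (s * (ind x * \int[mu]_z (f z ^+ 2 * eta (x - z))) +
    s^-1 * g x ^+ 2))).
  apply: Rint_le.
  - exact: integrable_norm h1.
  - by apply: intgD; apply: intgZ.
  move=> x; have [i1 e1] := moll_int1 x.
  have j1 : intg mu (fun z => f z * eta (x - z)) := section_intg1 x if_ mk kC.
  have j2 : intg mu (fun z => f z ^+ 2 * eta (x - z)) := section_intg1 x f2 mk kC.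
  rewrite /ind mul1r indicE; case: (boolP (x \in cube N)) => [_|]; last first.
    by rewrite notin_setE => /gN ->; rewrite !mul0r normr0 expr0n /= !mulr0 addr0.
  rewrite mul1r normrM.
  have -> : s * \int[mu]_z (f z ^+ 2 * eta (x - z)) + s^-1 * g x ^+ 2 =
      \int[mu]_z (s * (f z ^+ 2 * eta (x - z)) + s^-1 * g x ^+ 2 * eta (x - z)).
    by rewrite (RintD (intgZ s j2) (intgZ _ i1)) (RintZ s j2) (RintZ _ i1) e1 mulr1.
  apply: (@le_trans _ _ (`|g x| * \int[mu]_z `|f z * eta (x - z)|)).
    exact: (ler_wpM2l (normr_ge0 (g x)) (Rint_norm j1)).
  have j3 : intg mu (fun z => `|f z * eta (x - z)|) by exact: integrable_norm j1.
  rewrite -(RintZ _ j3); apply: (Rint_le (intgZ _ j3) (intgD (intgZ s j2) (intgZ _ i1))).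
  by move=> z; exact: young.
rewrite (RintD (intgZ s h2) (intgZ _ g2)) (RintZ s h2) (RintZ _ g2) lerD2r.
apply: (ler_wpM2l (ltW s0)); rewrite h4; apply: (Rint_le h3 f2) => z.
have [i2 e2] := moll_int2 z.
rewrite -[leRHS]mulr1 -e2; apply: (ler_wpM2l (sqr_ge0 _)).
apply: (Rint_le (section_intg2 z ii mk kC) i2) => x.
by rewrite /ind mul1r indicE /diffker /=; case: (_ \in _); rewrite ?mul1r ?mul0r.
Qed.

End one_mollifier.

Section mollifier_seq.
Variables (r : nat -> R) (eta : nat -> V -> R).
Hypotheses (r0 : forall l, 0 < r l) (meta : forall l, mollifier (r l) (eta l))
  (rc : r k @[k --> \oo] --> 0).

(** Pointwise convergence comes from continuity at [x], since [eta k (x - z)] charges only points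
    [z] within [r k] of [x]; the supremum of [phi] times |g| dominates. *)
Lemma moll_cc phi g : cc phi -> intg mu g ->
  \int[mu]_x (g x * \int[mu]_z (phi z * eta k (x - z))) @[k --> \oo] -->
  \int[mu]_x (g x * phi x).
Proof.
move=> cphi ig; have [C C0 hC] := cc_bounded cphi; have ip := cc_intg cphi.
have mk k := diffker_measurable (mollifier_cc (r0 k) (meta k)).1.
have jint k x : intg mu (fun z => phi z * eta k (x - z)).
  have [D kD] := diffker_bounded (r0 k) (meta k).
  exact: section_intg1 x ip (mk k) kD.
have [| | | |_] := @Rdct _ _ _ mu (fun k x => g x * \int[mu]_z (phi z * eta k (x - z)))
  (fun x => g x * phi x) (fun x => C * `|g x|); last by [].
- move=> k; have [D kD] := diffker_bounded (r0 k) (meta k).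
  by have [/intg_measurable h _ _] := Rfubini ig ip (mk k) kD.
- move=> x; apply: cvgM; first exact: cvg_cst.
  apply/cvgrPdist_le => e e0.
  have /cvgrPdist_lt/(_ _ e0)/nbhs_ballP[d /= d0 hd] := cphi.1 x.
  have rd0 : \forall k \near \oo, r k < d by exact: (cvgr_lt _ rc _ d0).
  apply: filterS rd0 => k rd.
  have [i1 e1] := moll_int1 (r0 k) (meta k) x; have [_ eta0 etar _] := meta k.
  rewrite -[phi x]mulr1 -[in phi x * _]e1 -RintZ// -RintB//; last exact: intgZ.
  have ii : intg mu (fun z => phi x * eta k (x - z) - phi z * eta k (x - z)).
    by apply: intgB => //; exact: intgZ.
  apply: (le_trans (Rint_norm ii)).
  rewrite -[leRHS]mulr1 -[in e * _]e1 -RintZ//; apply: Rint_le.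
  + exact: integrable_norm ii.
  + exact: intgZ.
  move=> z; rewrite -mulrBl normrM (ger0_norm (eta0 _)).
  have [xz|nxz] := pselect (cube (r k) (x - z)); last by rewrite etar// !mulr0.
  rewrite ler_wpM2r// ltW//; apply: hd; apply/ball_rVP => // i.
  by move/cubeP : xz => /(_ i); rewrite !mxE => h; exact: le_lt_trans h rd.
- by apply: intgZ; exact: integrable_norm ig.
- move=> k x; rewrite normrM mulrC ler_wpM2r//.
  have [i1 e1] := moll_int1 (r0 k) (meta k) x; have [_ eta0 _ _] := meta k.
  apply: (le_trans (Rint_norm (jint k x))).
  rewrite -[leRHS]mulr1 -e1 -RintZ//; apply: Rint_le.
  + exact: integrable_norm (jint k x).
  + exact: intgZ.
  by move=> z; rewrite normrM (ger0_norm (eta0 _)) ler_wpM2r.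
Qed.

(** [f] is replaced by a smooth [phi]: the error inside the convolution is controlled by
    [moll_bound] uniformly in k, the error in the limit by [Rint_AMGM]. *)
Lemma moll_cvg f g (a b : V) (N : R) : sqintg mu f -> (forall x, ~ obox a b x -> f x = 0) ->
  sqintg mu g -> (forall x, ~ cube N x -> g x = 0) ->
  \int[mu]_x (g x * \int[mu]_z (f z * eta k (x - z))) @[k --> \oo] -->
  \int[mu]_x (g x * f x).
Proof.
move=> sf fB sg gN; have ig := csupp_sqintg_bounded sg gN.
have [M [M0 hM]] := compact_sub_box (@compact_box R n a b).
have if_ : intg mu f.
  by apply: (csupp_sqintg_bounded (M := M)) => // x nx; apply: fB => /obox_sub_box/hM.
apply/cvgrPdist_lt => e e0.
pose G := \int[mu]_x (g x ^+ 2); have G0 : 0 <= G := Rint_sqr_ge0 _ g.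
(* With the tolerance e/(8s) for [phi], the terms [s * |phi - f|^2] and [s^-1 * G] are at most e/8
   each, so each replacement costs at most e/4. *)
pose s := (8 * (G + 1)) / e; have s0 : 0 < s by rewrite divr_gt0// mulr_gt0// ltr_wpDl.
have d0 : 0 < e / (8 * s) by rewrite divr_gt0// mulr_gt0.
have [phi [p1 p2 p3]] := test_density sf fB d0.
have cp := box_cc p1 p2; have sp := cc_sqintg cp; have ip := cc_intg cp.
have sd := sqintgB sp sf; have id : intg mu (fun x => phi x - f x) by exact: intgB.
have bnd : s * \int[mu]_x ((phi x - f x) ^+ 2) + s^-1 * G <= e / 4.
  have h1 : s^-1 * G <= e / 8.
    rewrite ler_pdivrMl//.
    have -> : s * (e / 8) = G + 1 by rewrite /s; field; rewrite gt_eqF.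
    by rewrite lerDl.
  rewrite ler_pdivlMr in p3; last by rewrite mulr_gt0.
  by move: p3 h1; move: (Rintegral _ _ _) (s^-1 * G) => A B; clear -s; nra.
near=> k.
have [D kD] := diffker_bounded (r0 k) (meta k).
have mk := diffker_measurable (mollifier_cc (r0 k) (meta k)).1.
have c1 : `|\int[mu]_x (g x * phi x) - \int[mu]_x (g x * \int[mu]_z (phi z * eta k (x - z)))| < e / 4.
  near: k; have e4 : 0 < e / 4 by rewrite divr_gt0.
  by have /cvgrPdist_lt/(_ _ e4) := moll_cc cp ig.
have c2 := moll_bound (r0 k) (meta k) s0 sd id sg gN.
have c3 := Rint_AMGM s0 sd sg.
have E2 : \int[mu]_x (g x * \int[mu]_z ((phi z - f z) * eta k (x - z))) =
   \int[mu]_x (g x * \int[mu]_z (phi z * eta k (x - z))) -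
   \int[mu]_x (g x * \int[mu]_z (f z * eta k (x - z))).
  have [j1 _ _] := Rfubini ig ip mk kD; have [j2 _ _] := Rfubini ig if_ mk kD.
  rewrite -RintB//; apply: eq_Rintegral => x _; rewrite -mulrBr; congr (_ * _).
  rewrite -RintB; [|exact: section_intg1 x ip mk kD|exact: section_intg1 x if_ mk kD].
  by apply: eq_Rintegral => z _; rewrite mulrBl.
have E3 : \int[mu]_x ((phi x - f x) * g x) = \int[mu]_x (g x * phi x) - \int[mu]_x (g x * f x).
  rewrite -RintB; [|exact: sqintgM|exact: sqintgM].
  by apply: eq_Rintegral => x _; rewrite mulrC mulrBr.
rewrite E2 in c2; rewrite E3 in c3.
have {}c2 := le_trans c2 bnd; have {}c3 := le_trans c3 bnd.
move: c1 c2 c3.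
move: (Rintegral _ _ (fun x => g x * f x)) (Rintegral _ _ (fun x => g x * phi x)).
move: (Rintegral _ _ (fun x => g x * _)) (Rintegral _ _ (fun x => g x * _)).
clear -e => A B C' D'; rewrite ltr_norml !ler_norml ltr_norml.
by move=> /andP[h1 h2] /andP[h3 h4] /andP[h5 h6]; apply/andP; split; lra.
Unshelve. all: by end_near. Qed.

End mollifier_seq.

Lemma mollifier_exists (c : V) (h r : R) : 0 < h -> (forall i, `|c ord0 i| + h <= r) ->
  exists2 eta, mollifier r eta &
    forall x, ~ box (c - const_mx h) (c + const_mx h) x -> eta x = 0.
Proof.
move=> h0 hr; have h2 : 0 < h / 2 by rewrite divr_gt0.
set a := c - const_mx h; set b := c + const_mx h.
pose f := cutoff a b (h / 2).
have fB x : ~ box a b x -> f x = 0 by move=> nx; apply: cutoff_eq0 => // /obox_sub_box.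
have hf : Cinfty f by move=> k; exact: Ck_cutoff.
have cf := box_cc hf fB; have if_ := cc_intg cf.
pose K := box (c - const_mx (h / 2)) (c + const_mx (h / 2)).
have mK : measurable K by exact: measurable_box.
have muK : (mu K < +oo)%E by exact: lebesgue_box_lty.
have muK0 : (0 < mu K)%E by apply: lebesgue_box_gt0 => i; rewrite !mxE; lra.
have iK : intg mu (\1_K : V -> R).
  apply/integrableP; split; first exact/measurable_EFinP/measurable_indic.
  under eq_integral do rewrite gee0_abs ?lee_fin//.
  by rewrite integral_indic// setIT.
(* The cutoff equals 1 on the concentric cube [K] of half the size, which has positive measure. *)
have I0 : 0 < \int[mu]_x f x.
  apply: (@lt_le_trans _ _ (\int[mu]_x (\1_K x : R))).
    rewrite /Rintegral integral_indic// setIT; apply: fine_gt0.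
    by rewrite muK0 muK.
  apply: Rint_le => // x; rewrite indicE; case: (boolP (x \in K)) => [/set_mem xK|_].
    by rewrite /f cutoff_eq1// => i; have := xK i; rewrite !mxE; lra.
  exact: cutoff_ge0.
exists (fun x => (\int[mu]_x f x)^-1 * f x); last by move=> x nx; rewrite fB ?mulr0.
split.
- by move=> k; apply: CkM; [exact: Ck_cst|exact: hf].
- by move=> x; rewrite mulr_ge0 ?invr_ge0 ?(ltW I0) ?cutoff_ge0.
- move=> x nx; rewrite fB ?mulr0// => xB; apply: nx; apply/cubeP => i.
  have := xB i; have := hr i; rewrite !mxE => h3 h4.
  have -> : x ord0 i = c ord0 i + (x ord0 i - c ord0 i) by ring.
  apply: (le_trans (ler_normD _ _)); apply: le_trans h3; rewrite lerD2l ler_norml; lra.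
- by rewrite RintZ// mulVf// gt_eqF.
Qed.

End mollify.

(** * Doubling of variables *)

Section doubling.
Context {R : realType} {n : nat}.
Local Notation V := 'rV[R]_n.
Local Notation mu := (@lebesgue_rV R n).
Variables (Om : set V) (N : R) (A B : finType) (c : A -> B -> 'I_n -> R).
Variables (p Lq : A -> V -> R) (q Lp : B -> V -> R).
Hypothesis OmN : Om `<=` cube N.
Hypotheses (sp : forall a, sqintg mu (p a)) (sLq : forall a, sqintg mu (Lq a))
  (sq : forall b, sqintg mu (q b)) (sLp : forall b, sqintg mu (Lp b)).
Hypotheses (p0 : forall a x, ~ Om x -> p a x = 0) (Lq0 : forall a x, ~ Om x -> Lq a x = 0)
  (q0 : forall b x, ~ Om x -> q b x = 0) (Lp0 : forall b x, ~ Om x -> Lp b x = 0).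
Hypotheses
  (Hp : forall psi, test_fun setT psi -> forall b,
    \int[mu]_x (Lp b x * psi x) =
    - \sum_a \sum_j c a b j * \int[mu]_x (p a x * pderive j psi x))
  (Hq : forall psi, test_fun Om psi -> forall a,
    \int[mu]_x (Lq a x * psi x) =
    - \sum_b \sum_j c a b j * \int[mu]_x (q b x * pderive j psi x)).

(* Lp = L p and Lq = -L^* q weakly, L having the constant coefficients c.  For
   smooth p and q, [pairing chi] is the integral of the divergence of a field
   with factor chi. *)
Definition pairing (chi : V -> R) : R :=
  \sum_a \int[mu]_x (p a x * chi x * Lq a x) +
  \sum_b \int[mu]_x (Lp b x * chi x * q b x) +
  \sum_a \sum_b \sum_j c a b j * \int[mu]_x (p a x * pderive j chi x * q b x).

Lemma vanish_intg f : sqintg mu f -> (forall x, ~ Om x -> f x = 0) -> intg mu f.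
Proof.
by move=> sf f0; apply: (csupp_sqintg_bounded (M := N)) => // x nx; apply: f0 => /OmN.
Qed.

(** Only points [z] with [chi z != 0] are constrained, so the direction of displacement can be
    fitted to the small support of a single [chi]. *)
Definition admissible (chi : V -> R) := exists (r : nat -> R) (eta : nat -> V -> R),
  [/\ forall k, 0 < r k, r k @[k --> \oo] --> 0, forall k, mollifier (r k) (eta k) &
    forall k z, Om z -> chi z != 0 -> test_fun Om (fun x => eta k (x - z))].

Lemma cc_sqintgM f g : cc g -> sqintg mu f -> sqintg mu (fun x => f x * g x).
Proof.
move=> cg sf; have [C _ hC] := cc_bounded cg.
under eq_fun do rewrite mulrC.
exact: (sqintg_bounded (continuous_measurable_rV cg.1) hC sf).
Qed.

Lemma cc_kernel (g : V -> R) : cc g -> measurable_fun setT (diffker g) /\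
  exists C, forall z, `|diffker g z| <= C.
Proof.
move=> cg; split; first exact: diffker_measurable cg.1.
by have [C _ hC] := cc_bounded cg; exists C => z; exact: hC.
Qed.

Section identity.
Variables (chi eta : V -> R).
Hypotheses (hchi : Cinfty chi) (schi : csupp chi) (heta : Cinfty eta) (seta : csupp eta).
Hypothesis adm : forall z, Om z -> chi z != 0 -> test_fun Om (fun x => eta (x - z)).

Let M f g := \int[mu]_x (g x * \int[mu]_z (f z * eta (x - z))).
Let Mj j f g := \int[mu]_x (g x * \int[mu]_z (f z * pderive j eta (x - z))).

Let cchi : cc chi. Proof. by split=> //; exact: Ck_continuous (hchi 0). Qed.
Let ceta : cc eta. Proof. by split=> //; exact: Ck_continuous (heta 0). Qed.
Let cdchi j : cc (pderive j chi).
Proof. by split; [exact: Ck_continuous (Cinfty_pderive j hchi 0)|exact: pderive_csupp]. Qed.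
Let cdeta j : cc (pderive j eta).
Proof. by split; [exact: Ck_continuous (Cinfty_pderive j heta 0)|exact: pderive_csupp]. Qed.

Let ip a : intg mu (fun x => p a x * chi x).
Proof.
apply: vanish_intg; first exact: cc_sqintgM.
by move=> x nx; rewrite p0// mul0r.
Qed.
Let idp a j : intg mu (fun x => p a x * pderive j chi x).
Proof.
apply: vanish_intg; first exact: cc_sqintgM.
by move=> x nx; rewrite p0// mul0r.
Qed.
Let iq b : intg mu (q b). Proof. exact: vanish_intg (sq b) (@q0 b). Qed.
Let iLq a : intg mu (Lq a). Proof. exact: vanish_intg (sLq a) (@Lq0 a). Qed.

(** For fixed x, chi(z) eta(x - z) is a test function of z on the whole space because chi has
    compact support. Differentiating eta(x - z) in z gives minus the derivative of eta, hence the
    opposite signs of the two terms. *)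
Lemma doubling_p b : M (fun x => Lp b x * chi x) (q b) =
  \sum_a \sum_j (c a b j * Mj j (fun x => p a x * chi x) (q b) -
                 c a b j * M (fun x => p a x * pderive j chi x) (q b)).
Proof.
have [me [C eC]] := cc_kernel ceta.
have mde j := (cc_kernel (cdeta j)).1.
have inner x : \int[mu]_z (Lp b z * chi z * eta (x - z)) =
  \sum_a \sum_j (c a b j * \int[mu]_z (p a z * chi z * pderive j eta (x - z)) -
                 c a b j * \int[mu]_z (p a z * pderive j chi z * eta (x - z))).
  have hrefl : Cinfty (fun z => eta (x - z)) by move=> k; exact: Ck_refl.
  have hpsi : test_fun setT (fun z => chi z * eta (x - z)).
    split; first by move=> k; apply: CkM.
    have [D [D0 hD]] := schi; exists (cube D); split=> //; first exact: compact_box.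
    by move=> z nz; rewrite hD// mul0r.
  transitivity (\int[mu]_z (Lp b z * (chi z * eta (x - z)))).
    by apply: eq_Rintegral => z _; rewrite mulrA.
  rewrite (Hp hpsi) -sumrN; apply: eq_bigr => a _; rewrite -sumrN; apply: eq_bigr => j _.
  have [_ [D jD]] := cc_kernel (cdeta j).
  have j1 : intg mu (fun z => p a z * chi z * pderive j eta (x - z)) :=
    section_intg1 x (ip a) (mde j) jD.
  have j2 : intg mu (fun z => p a z * pderive j chi z * eta (x - z)) :=
    section_intg1 x (idp a j) me eC.
  rewrite -mulrBr -mulrN; congr (_ * _).
  rewrite -(RintB j1 j2) -RintN; last first.
    have := intgB j2 j1; apply: eq_integrable => // z _ /=; congr (_%:E).
    by rewrite (pderiveM j z (hchi 1) (hrefl 1)) (pderive_refl x j z (heta 1)); ring.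
  apply: eq_Rintegral => z _.
  by rewrite (pderiveM j z (hchi 1) (hrefl 1)) (pderive_refl x j z (heta 1)); ring.
rewrite /M.
transitivity (\int[mu]_x (\sum_a \sum_j
   (c a b j * (q b x * \int[mu]_z (p a z * chi z * pderive j eta (x - z))) -
    c a b j * (q b x * \int[mu]_z (p a z * pderive j chi z * eta (x - z)))))).
  apply: eq_Rintegral => x _; rewrite inner mulr_sumr; apply: eq_bigr => a _.
  by rewrite mulr_sumr; apply: eq_bigr => j _; ring.
have k1 a j : intg mu (fun x => q b x * \int[mu]_z (p a z * chi z * pderive j eta (x - z))).
  by have [_ [D jD]] := cc_kernel (cdeta j); exact: (Rfubini_intg (iq b) (ip a) (mde j) jD).
have k2 a j : intg mu (fun x => q b x * \int[mu]_z (p a z * pderive j chi z * eta (x - z))).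
  exact: (Rfubini_intg (iq b) (idp a j) me eC).
rewrite Rint_sum; last first.
  by move=> a; apply: intg_sum => j; apply: intgB; apply: intgZ; [exact: k1|exact: k2].
apply: eq_bigr => a _; rewrite Rint_sum; last first.
  by move=> j; apply: intgB; apply: intgZ; [exact: k1|exact: k2].
apply: eq_bigr => j _.
by rewrite (RintB (intgZ _ (k1 a j)) (intgZ _ (k2 a j))) (RintZ _ (k1 a j)) (RintZ _ (k2 a j)).
Qed.

(** After Fubini the equation of [q] is tested in x with eta(x - z). This is a test function of [Om]
    wherever p(z) chi(z) is nonzero, and elsewhere both sides vanish. *)
Lemma doubling_q a : M (fun x => p a x * chi x) (Lq a) =
  - \sum_b \sum_j c a b j * Mj j (fun x => p a x * chi x) (q b).
Proof.
have [me [C eC]] := cc_kernel ceta.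
have mde j := (cc_kernel (cdeta j)).1.
have [_ _ F1] := Rfubini (iLq a) (ip a) me eC.
rewrite /M [LHS]F1.
have F2 b j : Mj j (fun x => p a x * chi x) (q b) =
   \int[mu]_z (p a z * chi z * \int[mu]_x (q b x * pderive j eta (x - z))).
  by have [_ [D jD]] := cc_kernel (cdeta j); have [_ _ h] := Rfubini (iq b) (ip a) (mde j) jD; exact: h.
have k1 b j : intg mu (fun z => p a z * chi z * \int[mu]_x (q b x * pderive j eta (x - z))).
  by have [_ [D jD]] := cc_kernel (cdeta j); have [_ h _] := Rfubini (iq b) (ip a) (mde j) jD.
under [X in _ = - X]eq_bigr => b _ do under eq_bigr => j _ do rewrite F2.
transitivity (\int[mu]_z (- \sum_b \sum_j c a b j *
    (p a z * chi z * \int[mu]_x (q b x * pderive j eta (x - z))))).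
  apply: eq_Rintegral => z _; rewrite /diffker /=.
  have [pz|pz] := eqVneq (p a z * chi z) 0.
    rewrite pz mul0r; apply/esym/eqP; rewrite oppr_eq0; apply/eqP.
    by apply: big1 => b _; apply: big1 => j _; rewrite mul0r mulr0.
  have Oz : Om z by apply: contrapT => /p0 h; move: pz; rewrite h mul0r eqxx.
  have cz : chi z != 0 by apply: contraNneq pz => ->; rewrite mulr0.
  have I b j : \int[mu]_x (q b x * pderive j (fun x => eta (x - z)) x) =
      \int[mu]_x (q b x * pderive j eta (x - z)).
    by apply: eq_Rintegral => x _; rewrite (pderive_shift (- z) j x (heta 1)).
  rewrite (Hq (adm Oz cz)) mulrN mulr_sumr; congr (- _); apply: eq_bigr => b _.
  by rewrite mulr_sumr; apply: eq_bigr => j _; rewrite I; exact: mulrCA.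
have k2 b : intg mu (fun z => \sum_j c a b j *
    (p a z * chi z * \int[mu]_x (q b x * pderive j eta (x - z)))).
  by apply: intg_sum => j; exact: intgZ.
rewrite RintN; last exact: intg_sum.
rewrite (Rint_sum _ k2); congr (- _); apply: eq_bigr => b _.
rewrite Rint_sum; last by move=> j; exact: intgZ.
by apply: eq_bigr => j _; rewrite (RintZ _ (k1 b j)).
Qed.

(** The derivatives of [eta], which have no limit as the kernel concentrates, occur with opposite
    signs in the two expansions and cancel; only the derivative of [chi] survives. *)
Lemma doubling_identity :
  \sum_a M (fun x => p a x * chi x) (Lq a) + \sum_b M (fun x => Lp b x * chi x) (q b) +
  \sum_a \sum_b \sum_j c a b j * M (fun x => p a x * pderive j chi x) (q b) = 0.
Proof.
under eq_bigr do rewrite doubling_q.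
under [X in _ + X + _]eq_bigr do rewrite doubling_p.
rewrite [X in _ + X + _]exchange_big -!big_split /= big1// => a _.
rewrite -sumrN -!big_split /= big1// => b _.
by rewrite -sumrN -!big_split /= big1// => j _; ring.
Qed.

End identity.

Lemma pairing_local chi : Cinfty chi -> csupp chi -> admissible chi -> pairing chi = 0.
Proof.
move=> hchi schi [r [eta [r0 rc meta adm]]].
have cchi : cc chi by split=> //; exact: Ck_continuous (hchi 0).
have cdchi j : cc (pderive j chi).
  by split; [exact: Ck_continuous (Cinfty_pderive j hchi 0)|exact: pderive_csupp].
have lim f g (w : V -> R) : cc w -> sqintg mu f -> (forall x, ~ Om x -> f x = 0) ->
    sqintg mu g -> (forall x, ~ Om x -> g x = 0) ->
  \int[mu]_x (g x * \int[mu]_z (f z * w z * eta k (x - z))) @[k --> \oo] -->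
  \int[mu]_x (f x * w x * g x).
  move=> cw sf f0 sg g0.
  under [X in _ --> X]eq_Rintegral do rewrite mulrC.
  apply: (moll_cvg r0 meta rc (a := const_mx (- (N + 1))) (b := const_mx (N + 1)) (N := N)) => //.
  - exact: cc_sqintgM.
  - move=> x nx; rewrite f0 ?mul0r// => /OmN/cubeP h; apply: nx => i.
    have := h i; rewrite !mxE ler_norml; lra.
  - by move=> x nx; apply: g0 => /OmN.
have E k := doubling_identity hchi schi (eta := eta k)
  (let: And4 h _ _ _ := meta k in h) (mollifier_cc (r0 k) (meta k)).2 (adm k).
pose T k := \sum_a \int[mu]_x (Lq a x * \int[mu]_z (p a z * chi z * eta k (x - z))) +
  \sum_b \int[mu]_x (q b x * \int[mu]_z (Lp b z * chi z * eta k (x - z))) +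
  \sum_a \sum_b \sum_j c a b j * \int[mu]_x (q b x * \int[mu]_z (p a z * pderive j chi z * eta k (x - z))).
have Tc : T k @[k --> \oo] --> pairing chi.
  apply: cvgD; [apply: cvgD|].
  - by apply: cvg_sumR => a; exact: lim cchi (sp a) (@p0 a) (sLq a) (@Lq0 a).
  - by apply: cvg_sumR => b; exact: lim cchi (sLp b) (@Lp0 b) (sq b) (@q0 b).
  - apply: cvg_sumR => a; apply: cvg_sumR => b; apply: cvg_sumR => j.
    by apply: cvgM; [exact: cvg_cst|exact: lim (cdchi j) (sp a) (@p0 a) (sq b) (@q0 b)].
have T0 : T = fun _ => 0 by apply/funext => k; exact: E k.
by rewrite T0 in Tc; move/(cvg_lim (@Rhausdorff R)) : Tc; rewrite lim_cst.
Qed.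

(** The k-th mollifier lives on the cube of centre [e k *: d] and half-side [kap * e k]; the
    hypothesis says exactly that its translates by the relevant [z] stay in [Om]. *)
Lemma admissible_dir (chi : V -> R) (d : V) (kap e0 : R) : 0 < kap -> 0 < e0 ->
  (forall (e : R) (z w : V), 0 < e -> e < e0 -> Om z -> chi z != 0 ->
    (forall i, `|w ord0 i| <= kap * e) -> Om (z + e *: d + w)) -> admissible chi.
Proof.
move=> k0 e00 h.
pose D := \sum_i `|d ord0 i|.
have D0 : 0 <= D by apply: sumr_ge0.
(* The denominator k + 2 keeps [e k] strictly below [e0] already for k = 0. *)
pose e k : R := e0 * k.+2%:R^-1.
have e_gt0 k : 0 < e k by rewrite mulr_gt0// invr_gt0.
have e_lt k : e k < e0 by rewrite /e gtr_pMr// invf_lt1// ltr1n.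
pose r k := e k * (D + kap).
have /choice[eta heta] : forall k, exists eta, mollifier (r k) eta /\
   forall x, ~ box (e k *: d - const_mx (kap * e k)) (e k *: d + const_mx (kap * e k)) x -> eta x = 0.
  move=> k; have [|i|eta h1 h2] := @mollifier_exists R n (e k *: d) (kap * e k) (r k).
  - by rewrite mulr_gt0.
  - rewrite !mxE normrM (gtr0_norm (e_gt0 k)) /r mulrDr [kap * _]mulrC lerD2r.
    by rewrite ler_wpM2l ?(ltW (e_gt0 k))// /D (bigD1 i)//= lerDl sumr_ge0.
  - by exists eta.
exists r, eta; split.
- by move=> k; rewrite mulr_gt0// ltr_wpDl.
- rewrite [X in _ --> X](_ : _ = e0 * 0 * (D + kap)); last by rewrite mulr0 mul0r.
  apply: cvgM; last exact: cvg_cst.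
  apply: cvgM; first exact: cvg_cst.
  by have := @cvg_harmonic R; rewrite -(cvg_shiftS (@harmonic R)).
- by move=> k; have [] := heta k.
move=> k z Oz cz; have [[h1 _ _ _] h2] := heta k; split.
  by move=> l; exact: Ck_shift (h1 l).
exists (box (z + e k *: d - const_mx (kap * e k)) (z + e k *: d + const_mx (kap * e k))); split.
- exact: compact_box.
- move=> x xB; have -> : x = z + e k *: d + (x - (z + e k *: d)) by rewrite addrC subrK.
  apply: h => // i; have := xB i; rewrite !mxE ler_norml; lra.
- move=> x nx; apply: h2 => xB; apply: nx => i; have := xB i; rewrite !mxE; lra.
Qed.

Lemma rV_norm_le (w : V) (C : R) : 0 <= C -> (forall i, `|w ord0 i| <= C) -> `|w| <= C.
Proof.
move=> C0 h; rewrite {1}/Num.norm /= mx_normrE; apply/bigmax_leP; split=> // -[i j] _.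
by rewrite ord1; exact: h.
Qed.

(** At an interior point centred mollifiers do. At a boundary point, adding t e raises the height x
    . e by t, whereas a perturbation w of size kap t changes the height and the Lipschitz graph
    together by less than t; z + t e + w remains above the graph. *)
Lemma local_admissible (x0 : V) : open Om -> lipschitz_boundary Om -> closure Om x0 ->
  exists2 r, 0 < r & forall chi : V -> R,
    (forall x, ~ box (x0 - const_mx r) (x0 + const_mx r) x -> chi x = 0) -> admissible chi.
Proof.
move=> oOm lip cx0; have inbox (r : R) (chi : V -> R) z :
    (forall x, ~ box (x0 - const_mx r) (x0 + const_mx r) x -> chi x = 0) -> chi z != 0 ->
    forall i, `|z ord0 i - x0 ord0 i| <= r.
  move=> h cz i; have /(_ i) : box (x0 - const_mx r) (x0 + const_mx r) z.
    by apply: contrapT => /h cz0; move: cz; rewrite cz0 eqxx.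
  by rewrite !mxE ler_norml; lra.
have [Ox0|nOx0] := pselect (Om x0).
  have /nbhs_ballP[r /= r0 hr] : nbhs x0 Om by exact: open_nbhs_nbhs.
  exists (r / 4) => [|chi chi0]; first by rewrite divr_gt0.
  apply: (@admissible_dir chi 0 1 (r / 4)) => //; first by rewrite divr_gt0.
  move=> e z w e0 er Oz cz hw; apply: hr; apply/ball_rVP => // i.
  have := inbox _ _ _ chi0 cz i; have := hw i; rewrite !mxE mulr0 addr0 mul1r.
  rewrite !ler_norml ltr_norml; lra.
have [|r [e [gam [r0 ee lipg epi]]]] := lip x0.
  by split=> //; move/interior_subset.
have [L L0 hL] : exists2 L, 0 < L & forall x y, `|gam x - gam y| <= L * `|x - y|.
  have [M [_ hM]] := lipg; exists (`|M| + 1) => [|x y]; first by rewrite ltr_wpDl.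
  by apply: (hM (`|M| + 1) _ (x, y)) => //; rewrite (le_lt_trans (ler_norm M))// ltrDl.
have dotpD (x y : V) : dotp (x + y) e = dotp x e + dotp y e.
  by rewrite /dotp -big_split /=; apply: eq_bigr => i _; rewrite mxE mulrDl.
have dotpZ (t : R) (x : V) : dotp (t *: x) e = t * dotp x e.
  by rewrite /dotp mulr_sumr; apply: eq_bigr => i _; rewrite mxE mulrA.
have e1 i : `|e ord0 i| <= 1.
  rewrite -(@ler_pXn2r _ 2)// ?nnegrE// expr1n real_normK ?num_real// -ee /dotp.
  rewrite (bigD1 i)//= expr2 lerDl; apply: sumr_ge0 => j _; rewrite -expr2; exact: sqr_ge0.
(* The height of w is at most n kap t. Its projection has norm at most (n + 1) kap t, which moves
   the graph by at most L (n + 1) kap t. The sum is below (L + 1)(n + 1) kap t = t. *)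
pose kap := ((L + 1) * (n%:R + 1))^-1.
have n1 : (0 : R) < n%:R + 1 by rewrite ltr_wpDl.
have L1 : 0 < L + 1 by rewrite ltr_wpDr.
have kap0 : 0 < kap by rewrite invr_gt0 mulr_gt0.
have kapE : kap * ((L + 1) * (n%:R + 1)) = 1 by rewrite mulVf// gt_eqF// mulr_gt0.
have kap1 : kap <= 1.
  rewrite invf_le1 ?mulr_gt0//.
  by rewrite -[leLHS]mulr1; apply: ler_pM => //; rewrite lerDr// ltW.
(* In each coordinate z is within r/4 of x0, and t e and w contribute less than r/4 each as kap <=
   1, so shifted points stay in the ball where the epigraph description holds. *)
exists (r / 4) => [|chi chi0]; first by rewrite divr_gt0.
apply: (@admissible_dir chi e kap (r / 4)) => //; first by rewrite divr_gt0.
move=> t z w t0 tr Oz cz hw; have zx := inbox _ _ _ chi0 cz.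
have kt0 : 0 <= kap * t by rewrite mulr_ge0 ?ltW.
have zball : ball x0 r z.
  by apply/ball_rVP => // i; rewrite distrC (le_lt_trans (zx i))// ltr_pdivrMr// ltr_pMr// ltr1n.
have yball : ball x0 r (z + t *: e + w).
  apply/ball_rVP => // i; rewrite !mxE.
  have h1 : `|t * e ord0 i| <= t by rewrite normrM (gtr0_norm t0) ler_piMr ?(ltW t0).
  have h2 : kap * t <= t by rewrite ler_piMl ?(ltW t0).
  have h3 := zx i; have h4 := hw i.
  rewrite distrC (_ : _ - _ = (z ord0 i - x0 ord0 i) + t * e ord0 i + w ord0 i); last by ring.
  apply: (le_lt_trans (ler_normD _ _)).
  have := ler_normD (z ord0 i - x0 ord0 i) (t * e ord0 i).
  lra.
apply/(epi _ yball); move/(epi _ zball) : Oz => Oz.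
have we : `|dotp w e| <= n%:R * (kap * t).
  apply: (le_trans (ler_norm_sum _ _ _)).
  have -> : n%:R * (kap * t) = \sum_(i < n) (kap * t).
    by rewrite mulr_natl sumr_const card_ord.
  apply: ler_sum => i _; rewrite normrM -[leRHS]mulr1; apply: ler_pM => //.
have pe : (z + t *: e + w - dotp (z + t *: e + w) e *: e) - (z - dotp z e *: e) =
    w - dotp w e *: e.
  rewrite !dotpD dotpZ ee mulr1 !scalerDl; apply/rowP => i; rewrite !mxE; ring.
have pn : `|w - dotp w e *: e| <= (n%:R + 1) * (kap * t).
  apply: rV_norm_le => [|i]; first by rewrite mulr_ge0// ltW.
  rewrite !mxE; apply: (le_trans (ler_normB _ _)); rewrite normrM addrC mulrDl mul1r.
  by apply: lerD => //; rewrite -[leRHS]mulr1; apply: ler_pM.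
have := hL (z + t *: e + w - dotp (z + t *: e + w) e *: e) (z - dotp z e *: e).
rewrite pe !dotpD dotpZ ee mulr1.
move: (gam (z + t *: e + w - _)) (gam (z - _)) Oz => g1 g2 Oz gg.
have {}gg := le_trans gg (ler_wpM2l (ltW L0) pn).
move: gg we; rewrite !ler_norml => /andP[_ gg] /andP[we _].
have kt : kap * t * (L + 1) * (n%:R + 1) = t.
  transitivity (kap * ((L + 1) * (n%:R + 1)) * t); first by ring.
  by rewrite kapE mul1r.
have ktp : 0 < kap * t by rewrite mulr_gt0.
move: ktp kt gg we Oz; move: (kap * t) (dotp w e) (dotp z e) (n%:R : R) => u v y m.
by move=> u0 kt gg we Oz; lra.
Qed.

(** Since [f] vanishes off [Om], [g] may be multiplied by a cutoff equal to 1 on [Om]. This makes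
    [pairing] meaningful for chi = 1, which has no compact support. *)
Lemma vanish_sqintgM f g : continuous g -> sqintg mu f -> (forall x, ~ Om x -> f x = 0) ->
  sqintg mu (fun x => f x * g x).
Proof.
move=> cg sf f0.
pose t := cutoff (const_mx (- (N + 1))) (const_mx (N + 1)) (1 : R) : V -> R.
have ct : cc t by apply: (test_fun_cc (U := setT)); exact: test_cutoff.
have -> : (fun x => f x * g x) = (fun x => f x * (t x * g x)).
  apply/funext => x; have [Ox|nx] := pselect (Om x); last by rewrite f0// !mul0r.
  rewrite /t cutoff_eq1 ?mul1r// => i; have /cubeP/(_ i) := OmN Ox.
  by rewrite !mxE ler_norml; lra.
by apply: cc_sqintgM => //; exact: ccM.
Qed.

Lemma pairingD f g : Cinfty f -> Cinfty g -> pairing (fun x => f x + g x) = pairing f + pairing g.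
Proof.
move=> hf hg.
have cf := Ck_continuous (hf 0); have cg := Ck_continuous (hg 0).
have cdf j := Ck_continuous (Cinfty_pderive j hf 0).
have cdg j := Ck_continuous (Cinfty_pderive j hg 0).
have key (u v w1 w2 : V -> R) : continuous w1 -> continuous w2 -> sqintg mu u ->
    (forall x, ~ Om x -> u x = 0) -> sqintg mu v ->
   \int[mu]_x (u x * (w1 x + w2 x) * v x) =
   \int[mu]_x (u x * w1 x * v x) + \int[mu]_x (u x * w2 x * v x).
  move=> c1 c2 su u0 sv.
  have i1 := sqintgM (vanish_sqintgM c1 su u0) sv.
  have i2 := sqintgM (vanish_sqintgM c2 su u0) sv.
  rewrite -(RintD i1 i2); apply: eq_Rintegral => x _; ring.
rewrite /pairing addrACA [X in _ = X + _]addrACA; congr (_ + _ + _).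
- by rewrite -big_split; apply: eq_bigr => a _; apply: key => //; exact: p0.
- by rewrite -big_split; apply: eq_bigr => b _; apply: key => //; exact: Lp0.
rewrite -big_split; apply: eq_bigr => a _ /=.
rewrite -big_split; apply: eq_bigr => b _ /=.
rewrite -big_split; apply: eq_bigr => j _ /=; rewrite -mulrDr; congr (_ * _).
rewrite -(key _ _ _ _ (cdf j) (cdg j) (sp a) (@p0 a) (sq b)).
by apply: eq_Rintegral => x _; rewrite (pderiveD j x (hf 1) (hg 1)).
Qed.

Lemma pairing_vanish f : open Om -> (forall x, Om x -> f x = 0) -> pairing f = 0.
Proof.
move=> oOm f0.
have df0 j x : Om x -> pderive j f x = 0.
  move=> Ox; rewrite -(pderive_cst 0 j x); apply: pderive_near.
  have : nbhs x Om by exact: open_nbhs_nbhs.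
  by apply: filterS => y /f0.
have key (u v w : V -> R) : (forall x, ~ Om x -> u x = 0) -> (forall x, Om x -> w x = 0) ->
   \int[mu]_x (u x * w x * v x) = 0.
  move=> u0 w0; rewrite -[RHS](Rintegral0 mu); apply: eq_Rintegral => x _.
  by have [/w0 ->|/u0 ->] := pselect (Om x); rewrite ?mulr0 !mul0r.
rewrite /pairing !big1 ?addr0// => [a _|b _|a _].
- by apply: big1 => b _; apply: big1 => j _; rewrite key ?mulr0//; [exact: p0|exact: df0].
- by apply: key => //; exact: Lp0.
- by apply: key => //; exact: p0.
Qed.

(** The left side is [pairing 1]. In place of a normalised partition of unity, 1 is the product of
    all [1 - th y] plus terms that each contain a factor [th y]. Those terms have zero pairing by
    [pairing_local], and the product vanishes on [Om] because some [th y] is 1 at every point. *)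
Lemma doubling_ibp : open Om -> lipschitz_boundary Om ->
  \sum_a \int[mu]_x (p a x * Lq a x) + \sum_b \int[mu]_x (Lp b x * q b x) = 0.
Proof.
move=> oOm lip.
have cOm : compact (closure Om).
  apply: (subclosed_compact (@closed_closure _ _) (@compact_box R n (const_mx (- N)) (const_mx N)) _).
  have : closed (cube N : set V).
    by apply: compact_closed; [exact: norm_hausdorff|exact: compact_box].
  by move=> /closure_id hc; rewrite -/(cube N) hc; exact: closureS.
have /choice[r hr] : forall x0 : V, exists r : R, 0 < r /\ (closure Om x0 -> forall chi : V -> R,
    (forall x, ~ box (x0 - const_mx r) (x0 + const_mx r) x -> chi x = 0) -> admissible chi).
  move=> x0; have [c0|nc0] := pselect (closure Om x0); last by exists 1.
  by have [r r0 h] := local_admissible oOm lip c0; exists r.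
move: cOm; rewrite compact_cover => /(_ V (closure Om) (fun x0 => ball x0 (r x0 / 2))).
case=> [x0 _|x cx|D hD cov].
- by apply: ball_open; rewrite divr_gt0//; have [] := hr x0.
- by exists x => //; apply: ballxx; rewrite divr_gt0//; have [] := hr x.
(* Ramps of width r/2 make the cutoff equal to 1 on the ball of radius r/2, which is why the cover
   uses half radii. *)
pose th x0 := cutoff (x0 - const_mx (r x0)) (x0 + const_mx (r x0)) (r x0 / 2) : V -> R.
have hth x0 : Cinfty (th x0) by move=> k; exact: Ck_cutoff.
have th0 x0 x : ~ box (x0 - const_mx (r x0)) (x0 + const_mx (r x0)) x -> th x0 x = 0.
  by move=> nx; apply: cutoff_eq0; [rewrite divr_gt0//; have [] := hr x0|move/obox_sub_box].
have main (s : seq V) : {subset s <= closure Om} ->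
    pairing (fun x => 1) = pairing (fun x => \prod_(y <- s) (1 - th y x)).
  elim: s => [|y s IH] hs; first by congr pairing; apply/funext => x; rewrite big_nil.
  have ys : {subset s <= closure Om} by move=> z zs; apply: hs; rewrite inE zs orbT.
  have hP : Cinfty (fun x => \prod_(y <- s) (1 - th y x)).
    by move=> k; apply: Ck_prod => z; apply: CkB; [exact: Ck_cst|exact: hth].
  have hP1 : Cinfty (fun x => \prod_(y <- y :: s) (1 - th y x)).
    by move=> k; apply: Ck_prod => z; apply: CkB; [exact: Ck_cst|exact: hth].
  have hP2 : Cinfty (fun x => th y x * \prod_(y <- s) (1 - th y x)).
    by move=> k; apply: CkM; [exact: hth|exact: hP].
  have -> : pairing (fun x => 1) = pairing (fun x => \prod_(y <- y :: s) (1 - th y x) +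
      th y x * \prod_(y <- s) (1 - th y x)).
    rewrite (IH ys); congr pairing; apply/funext => x; rewrite big_cons; ring.
  have z0 : pairing (fun x => th y x * \prod_(y <- s) (1 - th y x)) = 0.
    have cs : csupp (fun x => th y x * \prod_(y <- s) (1 - th y x)).
      by apply: csuppM; apply: box_csupp; exact: th0.
    apply: (pairing_local hP2 cs); apply: ((hr y).2 (set_mem (hs y (mem_head y s)))).
    move=> x nx; rewrite (th0 y x nx); exact: mul0r.
  rewrite (pairingD hP1 hP2) z0; exact: addr0.
have := main (finmap.enum_fset D) (fun y yD => hD _ yD).
rewrite [X in _ = X -> _](pairing_vanish oOm); last first.
  move=> x Ox; have [y /= yD] := cov x (subset_closure Ox).
  have r0 := (hr y).1; have r2 : 0 < r y / 2 by rewrite divr_gt0.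
  move=> /(ball_rVP _ _ r2) xy.
  rewrite (big_rem y yD)/= [X in 1 - X](_ : _ = 1) ?subrr ?mul0r//.
  apply: cutoff_eq1 => // i; have := xy i; rewrite !mxE ltr_norml; lra.
rewrite /pairing [X in _ + X = _ -> _]big1 ?addr0 => [h|a _]; last first.
  apply: big1 => b _; apply: big1 => j _; rewrite -[RHS](mulr0 (c a b j)); congr (_ * _).
  rewrite -[RHS](Rintegral0 mu); apply: eq_Rintegral => x _.
  by rewrite pderive_cst mulr0 mul0r.
rewrite -[RHS]h; congr (_ + _); apply: eq_bigr => a _; apply: eq_Rintegral => x _.
  by rewrite mulr1.
by rewrite mulr1.
Qed.

End doubling.

(** * Multi-indices and the Korn inequality *)

Section index.
Context {n : nat}.

Lemma perm_idxM m (s t : 'S_m) (I : m.-tuple 'I_n) :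
  perm_idx s (perm_idx t I) = perm_idx (s * t)%g I.
Proof. by apply: eq_from_tnth => k; rewrite !tnth_mktuple permM. Qed.

Lemma perm_idx1 m (I : m.-tuple 'I_n) : perm_idx 1%g I = I.
Proof. by apply: eq_from_tnth => k; rewrite tnth_mktuple perm1. Qed.

Lemma perm_idx_inj m (s : 'S_m) : injective (@perm_idx n m s).
Proof.
apply: (can_inj (g := perm_idx s^-1%g)) => I.
by rewrite perm_idxM mulVg perm_idx1.
Qed.

Lemma idx_front_rcons m (I : m.-tuple 'I_n) j : idx_front (rcons_tuple I j) = I.
Proof.
apply: eq_from_tnth => k; rewrite tnth_mktuple !(tnth_nth j) /= nth_rcons.
by rewrite size_tuple ltn_ord.
Qed.

Lemma idx_last_rcons m (I : m.-tuple 'I_n) j : idx_last (rcons_tuple I j) = j.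
Proof. by rewrite /idx_last (tnth_nth j) /= nth_rcons size_tuple ltnn eqxx. Qed.

Lemma rcons_front_last m (J : m.+1.-tuple 'I_n) : rcons_tuple (idx_front J) (idx_last J) = J.
Proof.
apply: eq_from_tnth => k; rewrite (tnth_nth (idx_last J)) /= nth_rcons size_map size_enum_ord.
have [km|mk] := ltnP k m.
  have := tnth_nth (idx_last J) (idx_front J) (Ordinal km); rewrite /= => <-.
  by rewrite tnth_mktuple; congr tnth; exact: val_inj.
have km : k = ord_max by apply/val_inj/eqP; rewrite /= eqn_leq mk andbT -ltnS.
by rewrite km /= eqxx.
Qed.

Lemma big_idx (S : nmodType) m (G : m.-tuple 'I_n -> 'I_n -> S) :
  \sum_(J : m.+1.-tuple 'I_n) G (idx_front J) (idx_last J) = \sum_I \sum_j G I j.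
Proof.
rewrite pair_big /= (reindex (fun z : m.-tuple 'I_n * 'I_n => rcons_tuple z.1 z.2)) /=.
  by apply: eq_bigr => -[I j] _; rewrite idx_front_rcons idx_last_rcons.
exists (fun J => (idx_front J, idx_last J)) => [[I j] _|J _] /=.
  by rewrite idx_front_rcons idx_last_rcons.
exact: rcons_front_last.
Qed.

(** A permutation of the first m slots extends by fixing the last one, so a symmetric tensor with
    its last index frozen is symmetric in the others. *)
Lemma rcons_perm_idx m (s : 'S_m) (I : m.-tuple 'I_n) j :
  rcons_tuple (perm_idx s I) j = perm_idx (lift_perm ord_max ord_max s) (rcons_tuple I j).
Proof.
rewrite -[RHS]rcons_front_last; congr rcons_tuple.
  apply: eq_from_tnth => k; rewrite !tnth_mktuple.
  have -> : widen_ord (leqnSn m) k = lift ord_max k by apply: ord_inj; rewrite lift_max.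
  rewrite lift_perm_lift !(tnth_nth j) lift_max /= nth_rcons size_tuple.
  by rewrite ltn_ord.
by rewrite /idx_last tnth_mktuple lift_perm_id !(tnth_nth j) /= nth_rcons size_tuple ltnn eqxx.
Qed.

End index.

Section symmetrisation.
Context {R : realType} {n : nat}.

Lemma symmetrisation_sym m (T : m.-tuple 'I_n -> R) (s : 'S_m) I :
  symmetrisation T (perm_idx s I) = symmetrisation T I.
Proof.
rewrite /symmetrisation [in RHS](reindex_inj (mulIg s)) /=; congr (_ * _).
by apply: eq_bigr => t _; rewrite perm_idxM.
Qed.

Lemma eq_symmetrisation m (T T' : m.-tuple 'I_n -> R) : T =1 T' ->
  symmetrisation T =1 symmetrisation T'.
Proof. by move=> h I; congr (_ * _); apply: eq_bigr => s _; rewrite h. Qed.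

Lemma fact_neq0 m : m`!%:R != 0 :> R.
Proof. by rewrite pnatr_eq0 -lt0n fact_gt0. Qed.

(** Reindexing by a permutation does not change G, so all m! terms of the average agree. A symmetric
    field therefore pairs with an unsymmetrised derivative. *)
Lemma sum_symmetrisation m (G T : m.-tuple 'I_n -> R) :
  (forall (s : 'S_m) I, G (perm_idx s I) = G I) ->
  \sum_I G I * symmetrisation T I = \sum_I G I * T I.
Proof.
move=> hG; under eq_bigr do rewrite /symmetrisation mulrCA mulr_sumr.
rewrite -mulr_sumr exchange_big /=.
have key (s : 'S_m) : \sum_I G I * T (perm_idx s I) = \sum_I G I * T I.
  rewrite [RHS](reindex_inj (@perm_idx_inj n m s)).
  by apply: eq_bigr => I _; rewrite hG.
under eq_bigr do rewrite key.
by rewrite sumr_const card_Sn -[X in _ * X]mulr_natl mulrA mulVf ?mul1r// fact_neq0.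
Qed.

Lemma symmetrisationB m (T T' : m.-tuple 'I_n -> R) I :
  symmetrisation (fun J => T J - T' J) I = symmetrisation T I - symmetrisation T' I.
Proof. by rewrite /symmetrisation sumrB mulrBr. Qed.

Lemma symmetrisation0 m (I : m.-tuple 'I_n) : symmetrisation (fun=> 0 : R) I = 0.
Proof. by rewrite /symmetrisation big1 ?mulr0. Qed.

(** Symmetrisation as a matrix, the form in which [doubling_ibp] takes the constant coefficients of
    L. *)
Lemma symmetrisation_delta m (X : m.-tuple 'I_n -> R) I :
  symmetrisation X I = \sum_J symmetrisation (fun J' => (J == J')%:R) I * X J.
Proof.
under eq_bigr do rewrite /symmetrisation -mulrA mulr_suml.
rewrite -mulr_sumr exchange_big /=; congr (_ * _); apply: eq_bigr => s _.
rewrite (bigD1 (perm_idx s I))//= eqxx mul1r big1 ?addr0// => J /negbTE ->.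
by rewrite mul0r.
Qed.

Lemma sum_sym_delta m (G : m.-tuple 'I_n -> R) J :
  (forall (s : 'S_m) I, G (perm_idx s I) = G I) ->
  \sum_I G I * symmetrisation (fun J' => (J == J')%:R) I = G J.
Proof.
move=> hG; rewrite sum_symmetrisation// (bigD1 J)//= eqxx mulr1 big1 ?addr0// => I.
by rewrite eq_sym => /negbTE ->; rewrite mulr0.
Qed.

End symmetrisation.

(** * Korn inequality for test fields on R^n *)

Section korn.
Context {R : realType} {n : nat}.
Local Notation V := 'rV[R]_n.
Local Notation mu := (@lebesgue_rV R n).

Definition set_idx m (k : 'I_m) (j : 'I_n) (I : m.-tuple 'I_n) : m.-tuple 'I_n :=
  [tuple if l == k then j else tnth I l | l < m].

Lemma tnth_set_idx m (k : 'I_m) j (I : m.-tuple 'I_n) : tnth (set_idx k j I) k = j.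
Proof. by rewrite tnth_mktuple eqxx. Qed.

Lemma set_idx_set m (k : 'I_m) i j (I : m.-tuple 'I_n) :
  set_idx k i (set_idx k j I) = set_idx k i I.
Proof. by apply: eq_from_tnth => l; rewrite !tnth_mktuple; case: eqP. Qed.

Lemma set_idx_id m (k : 'I_m) (I : m.-tuple 'I_n) : set_idx k (tnth I k) I = I.
Proof. by apply: eq_from_tnth => l; rewrite !tnth_mktuple; case: eqP => [->|]. Qed.

(** The involution [h] exchanges the extra summation index with the k-th entry of I. *)
Lemma sum_set_idx m (k : 'I_m) (g : m.-tuple 'I_n -> R) :
  \sum_I \sum_i g (set_idx k i I) = \sum_I \sum_(i < n) g I.
Proof.
rewrite !pair_big /=.
pose h (z : m.-tuple 'I_n * 'I_n) := (set_idx k z.2 z.1, tnth z.1 k).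
have hK : involutive h.
  by case=> I i; rewrite /h /= set_idx_set set_idx_id tnth_set_idx.
by rewrite [RHS](reindex_inj (inv_inj hK)).
Qed.

(* The left factor does not depend on the k-th index of I: summing over that
   index first gives a sum of squares, as if integrating |Div phi|^2. *)
Lemma sum_div_sq_ge0 m (k : 'I_m) (X : 'I_n -> m.-tuple 'I_n -> R) :
  0 <= \sum_I (\sum_j X j (set_idx k j I)) * X (tnth I k) I.
Proof.
have [n0|n0] := posnP n.
  apply: sumr_ge0 => I _; rewrite [X in X * _]big1 ?mul0r// => -[j jn] _.
  by exfalso; move: jn; rewrite n0.
pose g I := (\sum_j X j (set_idx k j I)) * X (tnth I k) I.
rewrite -(@pmulr_rge0 _ n%:R) ?ltr0n//.
have -> : n%:R * \sum_I g I = \sum_I \sum_(i < n) g I.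
  by rewrite mulr_sumr; apply: eq_bigr => I _; rewrite sumr_const card_ord mulr_natl.
rewrite -(sum_set_idx k); apply: sumr_ge0 => I _.
have -> : \sum_i g (set_idx k i I) = (\sum_j X j (set_idx k j I)) ^+ 2.
  rewrite /g expr2 mulr_sumr; apply: eq_bigr => i _; rewrite tnth_set_idx.
  by congr (_ * _); apply: eq_bigr => j _; rewrite set_idx_set.
exact: sqr_ge0.
Qed.

Implicit Types (m : nat).

Section test.
Variables (m : nat) (phi : tfield R n m).
Hypotheses (sphi : symmetric_on setT phi) (cphi : forall I, Cinfty (phi ^~ I))
  (csphi : forall I, csupp (phi ^~ I)).

Let T (J : m.+1.-tuple 'I_n) x := pderive (idx_last J) (phi ^~ (idx_front J)) x.

Lemma pderive_cc j I : cc (pderive j (phi ^~ I)).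
Proof.
by split; [exact: Ck_continuous (Cinfty_pderive j (cphi I) 0)|exact: pderive_csupp].
Qed.

Let TT J J' := \int[mu]_x (T J x * T J' x).

Let TTi J J' : intg mu (fun x => T J x * T J' x).
Proof. by apply: sqintgM; apply: cc_sqintg; exact: pderive_cc. Qed.

(** Such a permutation leaves the derivative index alone and only permutes the indices of [phi],
    which is symmetric. *)
Lemma pderive_fix_last (s : 'S_m.+1) J x : s ord_max = ord_max -> T (perm_idx s J) x = T J x.
Proof.
move=> sm; rewrite /T /idx_last tnth_mktuple sm; congr pderive; apply/funext => y.
have lm (k : 'I_m) : ord_max != s (widen_ord (leqnSn m) k).
  rewrite -{1}sm (inj_eq perm_inj); apply/eqP => /(congr1 val) /= e.
  by have := ltn_ord k; rewrite -e ltnn.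
(* [t] is [s] restricted to the first m slots. The default [k] is never reached, since by [lm] no
   such slot is sent to the last one. *)
pose t k := if unlift ord_max (s (widen_ord (leqnSn m) k)) is Some l then l else k.
have tE k : widen_ord (leqnSn m) (t k) = s (widen_ord (leqnSn m) k).
  rewrite /t; case: unliftP (lm k) => [l ->|->]; last by rewrite eqxx.
  by move=> _; apply: ord_inj; rewrite lift_max.
have tinj : injective t.
  move=> k l /(congr1 (widen_ord (leqnSn m))); rewrite !tE => /perm_inj /(congr1 val) /= kl.
  exact: val_inj.
rewrite -(sphi I (perm tinj) (idx_front J)).
congr phi; apply: eq_from_tnth => k; rewrite !tnth_mktuple permE -tE; congr tnth.
Qed.

Lemma sgradE x J : sgrad phi x J = symmetrisation (T ^~ x) J.
Proof. by []. Qed.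

(** After [Rint_swap] exchanges the derivatives, j is contracted with slot k in the first factor,
    and [sum_div_sq_ge0] applies pointwise under the integral. *)
Lemma sum_swap_ge0 (k : 'I_m) :
  0 <= \sum_I \sum_j \int[mu]_x
    (pderive (tnth I k) (phi ^~ (set_idx k j I)) x * pderive j (phi ^~ I) x).
Proof.
have i2 (i j : 'I_n) I J : intg mu (fun x => pderive i (phi ^~ I) x * pderive j (phi ^~ J) x).
  by apply: sqintgM; apply: cc_sqintg; exact: pderive_cc.
pose F x := \sum_I \sum_j
   (pderive j (phi ^~ (set_idx k j I)) x * pderive (tnth I k) (phi ^~ I) x).
have -> : \sum_I \sum_j \int[mu]_x
    (pderive (tnth I k) (phi ^~ (set_idx k j I)) x * pderive j (phi ^~ I) x) = \int[mu]_x F x.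
  rewrite (Rint_sum _ (fun I => intg_sum _ (fun j => i2 _ _ _ _))).
  apply: eq_bigr => I _; rewrite (Rint_sum _ (fun j => i2 _ _ _ _)).
  apply: eq_bigr => j _; apply: (Rint_swap _ _ (cphi _ 2) (cphi _ 2) (csphi _)).
rewrite -(Rintegral0 mu); apply: Rint_le => [||x]; first exact: intg0.
  by apply: intg_sum => I; apply: intg_sum => j; exact: i2.
rewrite /F; under eq_bigr do rewrite -mulr_suml.
exact: (sum_div_sq_ge0 k (fun j I => pderive j (phi ^~ I) x)).
Qed.

(** If [s] fixes the last slot, which holds the derivative index, the terms are squares. Otherwise
    [s * t] fixes it for a transposition [t], and the symmetry of [phi] reduces [s] to [t]: the
    derivative index trades places with slot k. *)
Lemma perm_pairing_ge0 (s : 'S_m.+1) : 0 <= \sum_J TT (perm_idx s J) J.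
Proof.
case: (unliftP ord_max (s ord_max)) => [k sk|sm]; last first.
  apply: sumr_ge0 => J _; rewrite /TT.
  under eq_Rintegral do rewrite (pderive_fix_last _ _ sm) -expr2.
  exact: Rint_sqr_ge0.
pose t := tperm (s ord_max) ord_max.
have st : (s * t * t)%g = s by rewrite -mulgA tperm2 mulg1.
have fixm : (s * t)%g ord_max = ord_max by rewrite permM tpermL.
have kE : lift ord_max k = widen_ord (leqnSn m) k by apply: ord_inj; rewrite lift_max.
have fr J : idx_front (perm_idx t J) = set_idx k (idx_last J) (idx_front J).
  apply: eq_from_tnth => l; rewrite !tnth_mktuple /t sk kE.
  case: tpermP => [/(congr1 val) /= lk|/(congr1 val) /= lm|lk _].
  - by rewrite (_ : l = k) ?eqxx//; exact: val_inj.
  - by have := ltn_ord l; rewrite lm ltnn.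
  - case: eqP => [lk'|_ //]; by rewrite lk' in lk.
have la J : idx_last (perm_idx t J) = tnth (idx_front J) k.
  by rewrite /idx_last !tnth_mktuple /t tpermR sk kE.
apply: le_trans (sum_swap_ge0 k) _; rewrite -big_idx.
apply: ler_sum => J _; rewrite -(fr J) -la /TT le_eqVlt; apply/orP; left; apply/eqP.
apply: eq_Rintegral => x _; congr (_ * _).
by rewrite -[in RHS]st -perm_idxM pderive_fix_last.
Qed.

(** The squared norm of the symmetrised derivative is the average, over all permutations, of the
    pairings of T with its permuted copy. All pairings are nonnegative, and keeping only the
    identity gives the constant (m+1)!. *)
Lemma korn : \sum_J \int[mu]_x (T J x ^+ 2) <=
  (m.+1)`!%:R * \sum_J \int[mu]_x (sgrad phi x J ^+ 2).
Proof.
have -> : \sum_J \int[mu]_x (sgrad phi x J ^+ 2) =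
    (m.+1`!%:R)^-1 * \sum_(s : 'S_m.+1) \sum_J TT (perm_idx s J) J.
  have iT s J : intg mu (fun x => T (perm_idx s J) x * T J x) by exact: TTi.
  have isg J : intg mu (fun x => sgrad phi x J ^+ 2).
    rewrite (_ : (fun x => _) = fun x => (m.+1`!%:R)^-1 ^+ 2 *
      \sum_(s : 'S_m.+1) \sum_(t : 'S_m.+1) T (perm_idx s J) x * T (perm_idx t J) x).
      by apply: intgZ; apply: intg_sum => s; apply: intg_sum => t; exact: TTi.
    apply/funext => x; rewrite sgradE /symmetrisation exprMn; congr (_ * _).
    by rewrite expr2 mulr_suml; apply: eq_bigr => s _; rewrite mulr_sumr.
  rewrite -(Rint_sum _ isg) /TT.
  under [in RHS]eq_bigr => s _ do rewrite -(Rint_sum _ (iT s)).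
  have iTs s : intg mu (fun x => \sum_J T (perm_idx s J) x * T J x).
    by apply: intg_sum => J; exact: iT.
  rewrite -(Rint_sum _ iTs) -(RintZ _ (intg_sum _ iTs)).
  apply: eq_Rintegral => x _.
  under eq_bigr do rewrite expr2.
  have -> : \sum_I sgrad phi x I * sgrad phi x I = \sum_I sgrad phi x I * T I x.
    by apply: sum_symmetrisation => s I; rewrite !sgradE symmetrisation_sym.
  rewrite exchange_big mulr_sumr /=; apply: eq_bigr => J _.
  by rewrite -mulr_suml mulrA.
rewrite mulrA divff ?fact_neq0// mul1r (bigD1 1%g)//= -[leLHS]addr0; apply: lerD.
  rewrite le_eqVlt; apply/orP; left; apply/eqP; apply: eq_bigr => J _.
  by rewrite perm_idx1 /TT; apply: eq_Rintegral => x _; rewrite expr2.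
by apply: sumr_ge0 => s _; exact: perm_pairing_ge0.
Qed.

Lemma korn_comp I j : \int[mu]_x (pderive j (phi ^~ I) x ^+ 2) <=
  (m.+1)`!%:R * \sum_J \int[mu]_x (sgrad phi x J ^+ 2).
Proof.
apply: le_trans korn; rewrite (bigD1 (rcons_tuple I j))//= /T idx_front_rcons idx_last_rcons.
by rewrite lerDl; apply: sumr_ge0 => J _; exact: Rint_sqr_ge0.
Qed.

End test.
End korn.

(** * Tensor fields *)

Section fields.
Context {R : realType} {n : nat}.
Local Notation V := 'rV[R]_n.
Local Notation mu := (@lebesgue_rV R n).
Implicit Types (U K : set V) (m : nat).

(** Monotone convergence along an exhaustion: uniform bounds on compact subsets become
    square-integrability and the same bound on the whole open set. *)
Lemma sqintg_mono (f_ : nat -> V -> R) f (C : R) : (forall k, sqintg mu (f_ k)) ->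
  (forall x k l, (k <= l)%N -> f_ k x ^+ 2 <= f_ l x ^+ 2) ->
  (forall x, f_ ^~ x @ \oo --> f x) -> (forall k, \int[mu]_x (f_ k x ^+ 2) <= C) ->
  sqintg mu f /\ \int[mu]_x (f x ^+ 2) <= C.
Proof.
move=> sf_ mono fc hC.
have mf : measurable_fun setT f.
  by apply: (measurable_fun_cvg (h := f_)) => [k|x _]; [exact: (sf_ k).1|exact: fc].
have mE (g : V -> R) : measurable_fun setT g -> measurable_fun setT (fun x => (g x ^+ 2)%:E).
  by move=> mg; apply/measurable_EFinP; exact: measurable_funX.
have lim2 x : limn (fun k => (f_ k x ^+ 2)%:E) = (f x ^+ 2)%:E.
  apply/cvg_lim => //; apply: cvg_EFin; first exact: nearW.
  rewrite expr2; under eq_fun do rewrite /= expr2.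
  by apply: cvgM; exact: fc.
have le : (\int[mu]_x (f x ^+ 2)%:E <= C%:E)%E.
  have := @cvg_monotone_convergence _ _ _ mu _ measurableT (fun k x => (f_ k x ^+ 2)%:E)
    (fun k => mE _ (sf_ k).1) (fun k x _ => sqr_ge0 (f_ k x)) (fun x _ k l kl => mono x k l kl).
  under eq_integral do rewrite lim2.
  move=> h; apply: (cvge_le _ h) => //; apply: nearW => k.
  rewrite -[leLHS]fineK; first by rewrite lee_fin; exact: hC.
  exact: integrable_fin_num (sf_ k).2.
have i2 : intg mu (fun x => f x ^+ 2).
  apply/integrableP; split; first exact: mE.
  under eq_integral => x _ do rewrite /= ger0_norm ?sqr_ge0//.
  exact: le_lt_trans le (ltry C).
split=> //; rewrite -lee_fin fineK//; exact: integrable_fin_num i2.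
Qed.

Lemma ext0T m (u : tfield R n m) : ext0 setT u = u.
Proof. by apply/funext => x; apply/funext => I; rewrite /ext0 in_setT. Qed.

Lemma ext0_in U m (u : tfield R n m) x I : U x -> ext0 U u x I = u x I.
Proof. by move=> Ux; rewrite /ext0 mem_set. Qed.

Lemma ext0_out U m (u : tfield R n m) x I : ~ U x -> ext0 U u x I = 0.
Proof. by move=> Ux; rewrite /ext0 memNset. Qed.

Lemma ext0_ext0 U K m (u : tfield R n m) : K `<=` U -> ext0 K (ext0 U u) = ext0 K u.
Proof.
move=> KU; apply/funext => x; apply/funext => I.
have [Kx|nKx] := pselect (K x); last by rewrite !ext0_out.
by rewrite !ext0_in//; exact: KU.
Qed.

Lemma Rint_ext0 U m (u : tfield R n m) (v : V -> R) I :
  \int[mu]_(x in U) (u x I * v x) = \int[mu]_x (ext0 U u x I * v x).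
Proof.
rewrite Rintegral_mkcond; apply: eq_Rintegral => x _.
by rewrite patchE /ext0; case: ifP => // _; rewrite mul0r.
Qed.

Definition sqfield m (u : tfield R n m) := forall I, sqintg mu (u ^~ I).

Lemma L2P U m (u : tfield R n m) : L2 U u <-> symmetric_on U u /\ sqfield (ext0 U u).
Proof. by split=> -[su h]; split=> // I; have := h I; rewrite Lfun2P. Qed.

Lemma ext0_sym U m (u : tfield R n m) : symmetric_on U u -> symmetric_on setT (ext0 U u).
Proof.
move=> su x _ s I; have [Ux|nUx] := pselect (U x); last by rewrite !ext0_out.
by rewrite !ext0_in//; exact: su.
Qed.

Lemma is_sgradE U m (u : tfield R n m) (g : tfield R n m.+1) :
  is_sgrad U u g <-> forall phi, test_fun U phi -> forall I,
    \int[mu]_x (ext0 U g x I * phi x) = - symmetrisation (fun J =>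
      \int[mu]_x (ext0 U u x (idx_front J) * pderive (idx_last J) phi x)) I.
Proof.
have E phi I := Rint_ext0 U g phi I.
have E' phi I : symmetrisation (fun J => \int[mu]_(x in U)
      (u x (idx_front J) * pderive (idx_last J) phi x)) I =
    symmetrisation (fun J => \int[mu]_x
      (ext0 U u x (idx_front J) * pderive (idx_last J) phi x)) I.
  by apply: eq_symmetrisation => J; exact: Rint_ext0.
split=> h phi tphi I; have := h phi tphi I; first by rewrite E E'.
by rewrite E E'.
Qed.

Lemma solenoidalE U m (g : tfield R n m.+1) :
  solenoidal U g <-> forall phi, test_fun U phi -> forall I : m.-tuple 'I_n,
    \sum_j \int[mu]_x (ext0 U g x (rcons_tuple I j) * pderive j phi x) = 0.
Proof.
have z U' phi (I : m.-tuple 'I_n) : \int[mu]_(x in U') (zero_field x I * phi x) = 0 :> R.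
  by rewrite Rint_ext0 -[RHS](Rintegral0 mu); apply: eq_Rintegral => x _;
    rewrite /ext0 if_same mul0r.
split=> h phi tphi I; have := h phi tphi I.
  rewrite z => /esym/eqP; rewrite oppr_eq0 => /eqP e; rewrite -[RHS]e.
  by apply: eq_bigr => j _; rewrite [RHS]Rint_ext0.
move=> e; rewrite z; apply/esym/eqP; rewrite oppr_eq0 -[X in _ == X]e; apply/eqP.
by apply: eq_bigr => j _; rewrite [LHS]Rint_ext0.
Qed.

Lemma sqfield_restrict K m (u : tfield R n m) : measurable K -> sqfield u -> sqfield (ext0 K u).
Proof.
move=> mK su I.
have -> : (fun x => ext0 K u x I) = (fun x => \1_K x * u x I).
  by apply/funext => x; rewrite indicE /ext0; case: ifP; rewrite ?mul1r ?mul0r.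
apply: (sqintg_bounded (C := 1)) (su I); first exact: measurable_indic.
by move=> x; rewrite indicE; case: (x \in K); rewrite ?normr1 ?normr0.
Qed.

Lemma L2dist2E U m (u v : tfield R n m) : sqfield (ext0 U u) -> sqfield (ext0 U v) ->
  L2dist2 U u v = (\sum_I \int[mu]_x ((ext0 U u x I - ext0 U v x I) ^+ 2))%:E.
Proof.
move=> su sv; have i I : intg mu (fun x => (ext0 U u x I - ext0 U v x I) ^+ 2).
  exact: (sqintgB (su I) (sv I)).2.
rewrite -(Rint_sum _ i) /Rintegral fineK; last first.
  by apply: integrable_fin_num => //; exact: (intg_sum _ i).
rewrite /L2dist2 [LHS]integral_mkcond; apply: eq_integral => x _.
rewrite patchE /ext0; case: ifP => // _.
by rewrite big1// => I _; rewrite subrr expr0n.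
Qed.

Lemma L2dist2_cvg U m (u : nat -> tfield R n m) v :
  (forall k, sqfield (ext0 U (u k))) -> sqfield (ext0 U v) ->
  L2dist2 U (u k) v @[k --> \oo] --> 0%E <->
  forall I, \int[mu]_x ((ext0 U (u k) x I - ext0 U v x I) ^+ 2) @[k --> \oo] --> 0.
Proof.
move=> su sv; under eq_fun do rewrite (L2dist2E (su _) sv).
split=> [/fine_cvg h I|h].
  apply: (squeeze_cvgr _ (cvg_cst 0) h); apply: nearW => k /=.
  rewrite Rint_sqr_ge0 /= (bigD1 I)//= lerDl; apply: sumr_ge0 => J _.
  exact: Rint_sqr_ge0.
apply: cvg_EFin; first exact: nearW.
rewrite [X in _ --> X](_ : _ = \sum_(I : m.-tuple 'I_n) 0); last by rewrite big1.
by apply: cvg_sumR => I; exact: h.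
Qed.

Lemma test_funW U U' (f : V -> R) : U `<=` U' -> test_fun U f -> test_fun U' f.
Proof.
move=> UU [cf [K [cK KU h]]]; split=> //; exists K; split=> //.
exact: subset_trans UU.
Qed.

Lemma test_field_cc U m (phi : tfield R n m) I : test_field U phi -> cc (phi ^~ I).
Proof. by move=> [_ /(_ I) h]; exact: test_fun_cc h. Qed.

Lemma test_field_pderive_cc U m (phi : tfield R n m) I j : test_field U phi ->
  cc (pderive j (phi ^~ I)).
Proof.
move=> [_ h]; apply: pderive_cc => J; first exact: (h J).1.
exact: (test_fun_cc (h J)).2.
Qed.

Lemma test_field_sqfield U m (phi : tfield R n m) : test_field U phi ->
  sqfield phi /\ sqfield (sgrad phi).
Proof.
move=> t; split=> I; first by apply: cc_sqintg; exact: test_field_cc t.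
apply: sqintgZ; apply: sqintg_sum => s; apply: cc_sqintg; exact: test_field_pderive_cc t.
Qed.

Lemma test_field_ext0 U m (phi : tfield R n m) : test_field U phi ->
  ext0 U phi = phi /\ ext0 U (sgrad phi) = sgrad phi.
Proof.
move=> [_ t]; split; apply/funext => x; apply/funext => I;
    (have [Ux|nUx] := pselect (U x); first by rewrite ext0_in).
  rewrite ext0_out//; have [_ [K [_ KU ->//]]] := t I.
  by move=> /KU.
rewrite ext0_out// /sgrad -[LHS](symmetrisation0 I); apply: eq_symmetrisation => J.
have [_ [K [cK KU K0]]] := t (idx_front J).
have cl : closed K by apply: compact_closed => //; exact: norm_hausdorff.
exact/esym/(@pderive_eq0 R n (phi ^~ (idx_front J)) (idx_last J) K cl K0)/(contra_not (KU x)).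
Qed.

Lemma L2loc_sqfield U m (u : tfield R n m) K : L2loc U u -> compact K -> K `<=` U ->
  sqfield (ext0 K u).
Proof. by move=> [_ h] cK KU I; rewrite -Lfun2P; exact: h. Qed.

(** [dotH10] with its witnesses exposed and its distances rewritten, componentwise, as integrals
    over R^n of zero extensions, so that the scalar limit theorems apply. *)
Definition h10_approx U m (u : tfield R n m) (phi : nat -> tfield R n m) (g : tfield R n m.+1) :=
  [/\ forall k, test_field U (phi k),
      forall K, compact K -> K `<=` U -> sqfield (ext0 K u) /\ forall I,
        \int[mu]_x ((ext0 K (phi k) x I - ext0 K u x I) ^+ 2) @[k --> \oo] --> 0,
      symmetric_on setT (ext0 U g), sqfield (ext0 U g) &
      forall I, \int[mu]_x ((sgrad (phi k) x I - ext0 U g x I) ^+ 2) @[k --> \oo] --> 0].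

Lemma dotH10P U m (u : tfield R n m) : dotH10 U u <->
  symmetric_on U u /\ exists phi g, h10_approx U u phi g.
Proof.
have restr K (phi : tfield R n m) : test_field U phi -> compact K -> sqfield (ext0 K phi).
  move=> t cK; apply: sqfield_restrict (test_field_sqfield t).1.
  exact: compact_measurable_rV.
split=> [[L [phi [g [tphi phiu Lg phig]]]]|[su [phi [g [tphi phiu sg sqg phig]]]]].
  split; first exact: L.1.
  have /L2P[sg sqg] := Lg.
  exists phi, g; split=> //; last first.
  - move: phig; rewrite L2dist2_cvg//.
      move=> + I => /(_ I).
      by under eq_fun => k do rewrite (test_field_ext0 (tphi k)).2.
    by move=> k; rewrite (test_field_ext0 (tphi k)).2; exact: (test_field_sqfield (tphi k)).2.
  - exact: ext0_sym.
  move=> K cK KU; have sK := L2loc_sqfield L cK KU; split=> //.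
  by apply/(L2dist2_cvg (fun k => restr K _ (tphi k) cK) sK); exact: phiu.
have Ll : L2loc U u.
  by split=> // K cK KU I; rewrite Lfun2P; exact: (phiu K cK KU).1.
split=> //; exists phi, (ext0 U g); split=> //.
- move=> K cK KU; have [sK h] := phiu K cK KU.
  exact/(L2dist2_cvg (fun k => restr K _ (tphi k) cK) sK).
- by apply/L2P; split=> [x Ux s I|]; [exact: sg|rewrite ext0_ext0].
- rewrite L2dist2_cvg ?ext0_ext0//.
    move=> I; under eq_fun => k do rewrite (test_field_ext0 (tphi k)).2.
    exact: phig.
  by move=> k; rewrite (test_field_ext0 (tphi k)).2; exact: (test_field_sqfield (tphi k)).2.
Qed.

End fields.

(** * Limits of symmetric gradients of test fields *)

Section potentials.
Context {R : realType} {n : nat}.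
Local Notation V := 'rV[R]_n.
Local Notation mu := (@lebesgue_rV R n).
Implicit Types (U K : set V) (m : nat).

Lemma symmetrisationN m (T : m.-tuple 'I_n -> R) I :
  symmetrisation (fun J => - T J) I = - symmetrisation T I.
Proof. by rewrite /symmetrisation sumrN mulrN. Qed.

Lemma Rint_symmetrisation m (F : m.-tuple 'I_n -> V -> R) I : (forall J, intg mu (F J)) ->
  \int[mu]_x symmetrisation (F ^~ x) I = symmetrisation (fun J => \int[mu]_x F J x) I.
Proof.
move=> h; have iF (s : 'S_m) : intg mu (F (perm_idx s I)) by exact: h.
rewrite /symmetrisation -(Rint_sum _ iF) -(RintZ _ (intg_sum _ iF)).
by apply: eq_Rintegral.
Qed.

Lemma cvg_symmetrisation m (X_ : nat -> m.-tuple 'I_n -> R) X I :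
  (forall J, X_ k J @[k --> \oo] --> X J) ->
  symmetrisation (X_ k) I @[k --> \oo] --> symmetrisation X I.
Proof.
move=> h; apply: cvgM; first exact: cvg_cst.
by apply: cvg_sumR => s; exact: h.
Qed.

Lemma sgrad_ibp U m (phi : tfield R n m) psi I : test_field U phi -> test_fun U psi ->
  \int[mu]_x (sgrad phi x I * psi x) = - symmetrisation (fun J =>
      \int[mu]_x (phi x (idx_front J) * pderive (idx_last J) psi x)) I.
Proof.
move=> tphi tpsi; rewrite -symmetrisationN.
have i J : intg mu (fun x =>
    pderive (idx_last J) (phi ^~ (idx_front J)) x * psi x).
  by apply: sqintgM; apply: cc_sqintg; [exact: test_field_pderive_cc tphi|exact: test_fun_cc tpsi].
have E x : sgrad phi x I * psi x = symmetrisation (fun J =>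
    pderive (idx_last J) (phi ^~ (idx_front J)) x * psi x) I.
  by rewrite /sgrad /symmetrisation -mulrA mulr_suml.
transitivity (\int[mu]_x symmetrisation (fun J =>
    pderive (idx_last J) (phi ^~ (idx_front J)) x * psi x) I).
  by apply: eq_Rintegral => x _; exact: E.
rewrite (Rint_symmetrisation _ i); apply: eq_symmetrisation => J.
apply: (Rint_ibp _ ((tphi.2 _).1 1) (tpsi.1 1)).
exact: (test_fun_cc (tphi.2 _)).2.
Qed.

(** The derivatives of a test function vanish off a compact set K, so convergence of [phi k] in
    L^2(K) is enough to pass to the limit in the integration by parts. *)
Lemma sgrad_lim U m (u : tfield R n m) phi g : h10_approx U u phi g -> is_sgrad U u g.
Proof.
move=> [tphi phiu _ sg phig]; apply/is_sgradE => psi tpsi I.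
have [psiC [K [cK KU K0]]] := tpsi.
have sdpsi j : sqintg mu (pderive j psi).
  apply: cc_sqintg; split; first exact: Ck_continuous (Cinfty_pderive j psiC 0).
  exact: pderive_csupp (test_fun_cc tpsi).2.
have clK : closed K by apply: compact_closed => //; exact: norm_hausdorff.
have dpsi0 j x : ~ K x -> pderive j psi x = 0 by exact: pderive_eq0.
have onK m' (v : tfield R n m') J j :
    \int[mu]_x (v x J * pderive j psi x) = \int[mu]_x (ext0 K v x J * pderive j psi x).
  apply: eq_Rintegral => x _; have [Kx|nKx] := pselect (K x); first by rewrite ext0_in.
  by rewrite dpsi0// !mulr0.
have [sK phiK] := phiu K cK KU.
have sphiK k : sqfield (ext0 K (phi k)).
  by apply: sqfield_restrict (test_field_sqfield (tphi k)).1; exact: compact_measurable_rV.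
have l1 : \int[mu]_x (sgrad (phi k) x I * psi x) @[k --> \oo] -->
    \int[mu]_x (ext0 U g x I * psi x).
  apply: sqintg_cvg (phig I) => [k||]; first exact: (test_field_sqfield (tphi k)).2.
    exact: sg.
  exact: cc_sqintg (test_fun_cc tpsi).
have l2 : \int[mu]_x (sgrad (phi k) x I * psi x) @[k --> \oo] --> - symmetrisation (fun J =>
      \int[mu]_x (ext0 U u x (idx_front J) * pderive (idx_last J) psi x)) I.
  under eq_fun => k do rewrite (sgrad_ibp _ (tphi k) tpsi).
  apply: cvgN; apply: cvg_symmetrisation => J; under eq_fun do rewrite onK.
  rewrite onK ext0_ext0//.
  exact: sqintg_cvg (fun k => sphiK k _) (sK _) (sdpsi _) (phiK _).
exact: cvg_unique l1 l2.
Qed.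

(** Identifies the limit gradient carried by [dotH10] with the weak gradient supplied by a
    decomposition; an instance of [fundamental_lemma]. *)
Lemma sgrad_unique U m (u : tfield R n m) g g' : open U -> sqfield (ext0 U g) ->
  sqfield (ext0 U g') -> is_sgrad U u g -> is_sgrad U u g' ->
  {ae mu, forall x, forall I, ext0 U g x I = ext0 U g' x I}.
Proof.
move=> oU sg sg' /is_sgradE hg /is_sgradE hg'; apply: filter_forall => I.
have sB := sqintgB (sg I) (sg' I).
have : {ae mu, forall x, U x -> ext0 U g x I - ext0 U g' x I = 0}.
  apply: (fundamental_lemma oU sB) => phi tphi.
  have sphi := cc_sqintg (test_fun_cc tphi).
  transitivity (\int[mu]_x (ext0 U g x I * phi x) - \int[mu]_x (ext0 U g' x I * phi x)).
    rewrite -(RintB (sqintgM (sg I) sphi) (sqintgM (sg' I) sphi)).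
    by apply: eq_Rintegral => x _; rewrite mulrBl.
  by rewrite hg// hg'// subrr.
apply: filterS => x h; have [Ux|nUx] := pselect (U x); last by rewrite !ext0_out.
by apply/eqP; rewrite -subr_eq0 h.
Qed.

Lemma sgrad_congr U m (u : tfield R n m) g g' : sqfield (ext0 U g) -> sqfield (ext0 U g') ->
  {ae mu, forall x, forall I, ext0 U g x I = ext0 U g' x I} ->
  is_sgrad U u g -> is_sgrad U u g'.
Proof.
move=> sg sg' gg /is_sgradE h; apply/is_sgradE => phi tphi I; rewrite -(h phi tphi I).
have mphi := (cc_sqintg (test_fun_cc tphi)).1.
apply: Rint_ae; [exact: measurable_funM (sg' I).1 mphi|exact: measurable_funM (sg I).1 mphi|].
by apply: filterS gg => x ->.
Qed.

(** Symmetry of [s] removes the symmetrisation from the gradient of [phi k]; the divergence equation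
    is then tested with each component of [phi k], and the result passes to the L^2 limit. *)
Lemma sgrad_orth_solenoidal U m (phi : nat -> tfield R n m) G s : (forall k, test_field U (phi k)) ->
  sqfield G -> (forall I, \int[mu]_x ((sgrad (phi k) x I - G x I) ^+ 2) @[k --> \oo] --> 0) ->
  symmetric_on setT (ext0 U s) -> sqfield (ext0 U s) -> solenoidal U s ->
  \sum_I \int[mu]_x (G x I * ext0 U s x I) = 0.
Proof.
move=> tphi sG phiG ss sqs /solenoidalE sol.
have l : \sum_I \int[mu]_x (sgrad (phi k) x I * ext0 U s x I) @[k --> \oo] -->
   \sum_I \int[mu]_x (G x I * ext0 U s x I).
  apply: cvg_sumR => I; apply: sqintg_cvg (sG I) (sqs I) (phiG I) => k.
  exact: (test_field_sqfield (tphi k)).2.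
have z k : \sum_I \int[mu]_x (sgrad (phi k) x I * ext0 U s x I) = 0.
  have i1 I : intg mu (fun x => sgrad (phi k) x I * ext0 U s x I).
    by apply: sqintgM => //; exact: (test_field_sqfield (tphi k)).2.
  have sd j I : sqintg mu (pderive j (phi k ^~ I)).
    by apply: cc_sqintg; exact: test_field_pderive_cc (tphi k).
  have i2 (I : m.+1.-tuple 'I_n) : intg mu (fun x =>
      ext0 U s x I * pderive (idx_last I) (phi k ^~ (idx_front I)) x).
    exact: sqintgM.
  transitivity (\sum_I \int[mu]_x
      (ext0 U s x I * pderive (idx_last I) (phi k ^~ (idx_front I)) x)).
    rewrite -(Rint_sum _ i1) -(Rint_sum _ i2); apply: eq_Rintegral => x _.
    under eq_bigr do rewrite mulrC.
    by apply: sum_symmetrisation => p I; exact: ss.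
  have -> : \sum_I \int[mu]_x
      (ext0 U s x I * pderive (idx_last I) (phi k ^~ (idx_front I)) x) =
      \sum_(I : m.-tuple 'I_n) \sum_j
        \int[mu]_x (ext0 U s x (rcons_tuple I j) * pderive j (phi k ^~ I) x).
    rewrite -big_idx; apply: eq_bigr => I _; by rewrite rcons_front_last.
  by apply: big1 => I _; exact: sol ((tphi k).2 I) I.
have l0 : \sum_I \int[mu]_x (sgrad (phi k) x I * ext0 U s x I) @[k --> \oo] --> (0 : R).
  by under eq_fun do rewrite z; exact: cvg_cst.
exact: cvg_unique l l0.
Qed.

Lemma test_field_diff m (phi psi : tfield R n m) U : test_field U phi -> test_field U psi ->
  [/\ symmetric_on setT (sub_field phi psi), forall I, Cinfty (sub_field phi psi ^~ I),
    forall I, csupp (sub_field phi psi ^~ I) &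
    forall x I, sgrad (sub_field phi psi) x I = sgrad phi x I - sgrad psi x I].
Proof.
move=> t1 t2; split=> [x _ s I|I k|I|x I].
- by rewrite /sub_field t1.1// t2.1.
- by apply: CkB; [exact: (t1.2 I).1|exact: (t2.2 I).1].
- have [M1 [M10 h1]] := (test_fun_cc (t1.2 I)).2.
  have [M2 [M20 h2]] := (test_fun_cc (t2.2 I)).2.
  exists (M1 + M2); split=> [|x nx]; first exact: addr_gt0.
  rewrite /sub_field h1 ?h2 ?subrr// => /cubeP c; apply: nx; apply/cubeP => i.
    by rewrite (le_trans (c i))// lerDr ltW.
  by rewrite (le_trans (c i))// lerDl ltW.
- rewrite /sgrad -symmetrisationB; apply: eq_symmetrisation => J.
  exact: (pderiveB _ _ ((t1.2 _).1 1) ((t2.2 _).1 1)).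
Qed.

Lemma ler_sum2 (A : finType) (f g h : A -> R) : (forall i, f i <= 2 * g i + 2 * h i) ->
  \sum_i f i <= 2 * \sum_i g i + 2 * \sum_i h i.
Proof. by move=> le; rewrite !mulr_sumr -big_split; apply: ler_sum => i _; exact: le. Qed.

Lemma sgrad_diff_le m (phi psi : tfield R n m) U G : test_field U phi -> test_field U psi ->
  sqfield G -> \sum_I \int[mu]_x (sgrad (sub_field phi psi) x I ^+ 2) <=
  2 * \sum_I \int[mu]_x ((sgrad phi x I - G x I) ^+ 2) +
  2 * \sum_I \int[mu]_x ((sgrad psi x I - G x I) ^+ 2).
Proof.
move=> t1 t2 sG; have [_ _ _ E] := test_field_diff t1 t2.
have key I : \int[mu]_x (sgrad (sub_field phi psi) x I ^+ 2) <=
    2 * \int[mu]_x ((sgrad phi x I - G x I) ^+ 2) +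
    2 * \int[mu]_x ((sgrad psi x I - G x I) ^+ 2).
  have := sqintg_tri ((test_field_sqfield t1).2 I) (sG I) ((test_field_sqfield t2).2 I).
  have -> : \int[mu]_x ((G x I - sgrad psi x I) ^+ 2) =
      \int[mu]_x ((sgrad psi x I - G x I) ^+ 2).
    by apply: eq_Rintegral => x _; rewrite -opprB sqrrN.
  have -> : \int[mu]_x ((sgrad phi x I - sgrad psi x I) ^+ 2) =
      \int[mu]_x (sgrad (sub_field phi psi) x I ^+ 2).
    by apply: eq_Rintegral => x _; rewrite E.
  exact: id.
exact: ler_sum2 key.
Qed.

Lemma exhaustion U : open U -> U !=set0 -> exists K : nat -> set V,
  [/\ forall k, compact (K k), forall k, K k `<=` U,
    forall k l, (k <= l)%N -> K k `<=` K l & U `<=` \bigcup_k K k].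
Proof.
move=> oU U0; have [a [b [abU Uab]]] := open_box_cover oU U0.
exists (fun k => \big[setU/set0]_(i < k) box (a i) (b i)); split.
- by move=> k; apply: bigsetU_compact => i _; exact: compact_box.
- by move=> k x; rewrite -(bigcup_mkord k (fun i => box (a i) (b i))) => -[i _ /abU].
- by move=> k l kl; exact: (subset_bigsetU (F := fun i => box (a i) (b i))).
- move=> x /Uab[i _ /obox_sub_box xi]; exists i.+1 => //.
  by rewrite -(bigcup_mkord i.+1 (fun i => box (a i) (b i))); exists i => /=.
Qed.

(** [dotH10] provides convergence on compact subsets only. Poincare in the direction [i0] and Korn
    make [phi k] Cauchy in L^2 of the bounded set; letting l tend to infinity on a compact subset
    and then exhausting [U] gives an estimate up to the boundary. *)
Lemma domain_approx U m (u : tfield R n m) phi g (M : R) (i0 : 'I_n) :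
  open U -> U !=set0 -> U `<=` cube M -> 0 < M -> h10_approx U u phi g ->
  forall I, sqintg mu (fun x => ext0 U u x I) /\
    \int[mu]_x ((phi k x I - ext0 U u x I) ^+ 2) @[k --> \oo] --> 0.
Proof.
move=> oU U0 UM M0 [tphi phiu _ sg phig] I.
(* The factor 4 M^2 comes from Poincare on the cube, (m+1)! from Korn. *)
pose C : R := 4 * M ^+ 2 * (m.+1)`!%:R.
have C0 : 0 <= C by apply: mulr_ge0 => //; apply: mulr_ge0 => //; exact: sqr_ge0.
pose E k := \sum_J \int[mu]_x ((sgrad (phi k) x J - ext0 U g x J) ^+ 2).
have Ec : E k @[k --> \oo] --> 0.
  rewrite [X in _ --> X](_ : _ = \sum_(J : m.+1.-tuple 'I_n) 0); last by rewrite big1.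
  by apply: cvg_sumR => J; exact: phig.
have phikl k l : \int[mu]_x ((phi k x I - phi l x I) ^+ 2) <= C * (2 * E k + 2 * E l).
  have [h1 h2 h3 h4] := test_field_diff (tphi k) (tphi l).
  have out x : ~ cube M x -> sub_field (phi k) (phi l) x I = 0.
    move=> nx; have z p : phi p x I = 0.
      by have [_ [K [_ KU ->//]]] := (tphi p).2 I; move=> /KU/UM.
    by rewrite /sub_field !z subrr.
  apply: le_trans (poincare i0 (h2 I 1) out M0) _.
  rewrite /C -[leRHS]mulrA; apply: ler_wpM2l; first by apply: mulr_ge0 => //; exact: sqr_ge0.
  apply: le_trans (korn_comp h1 h2 h3 I i0) _; rewrite ler_wpM2l//.
  exact: (sgrad_diff_le (tphi k) (tphi l) sg).
have [K [cK KU Kmono UK]] := exhaustion oU U0.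
have sphi k : sqintg mu (phi k ^~ I) := (test_field_sqfield (tphi k)).1 I.
have sK i k : sqintg mu (fun x => ext0 (K i) (phi k) x I).
  exact: sqfield_restrict (compact_measurable_rV (cK i)) (test_field_sqfield (tphi k)).1 I.
(* Comparison with [phi l] gives r k <= 2 C (2 E k + 2 E l) + 2 r l, where E l and r l tend to 0.
   The bound 4 C E k does not depend on the compact set. *)
have bound i k : \int[mu]_x ((ext0 (K i) (phi k) x I - ext0 (K i) u x I) ^+ 2) <= 4 * C * E k.
  have [su /(_ I) cu] := phiu _ (cK i) (KU i).
  pose r l := \int[mu]_x ((ext0 (K i) (phi l) x I - ext0 (K i) u x I) ^+ 2).
  have le l : r k <= 2 * (C * (2 * E k + 2 * E l)) + 2 * r l.
    apply: le_trans (sqintg_tri (sK i k) (sK i l) (su I)) _.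
    rewrite lerD2r ler_wpM2l//; apply: le_trans _ (phikl k l).
    apply: Rint_le => [||x]; [exact: (sqintgB (sK i k) (sK i l)).2|exact: (sqintgB _ _).2|].
    by rewrite /ext0; case: ifP => // _; rewrite subrr expr0n sqr_ge0.
  have lim : 2 * (C * (2 * E k + 2 * E l)) + 2 * r l @[l --> \oo] -->
      2 * (C * (2 * E k + 2 * 0)) + 2 * 0.
    apply: cvgD; (apply: cvgM; first exact: cvg_cst) => //.
    apply: cvgM; first exact: cvg_cst.
    apply: cvgD; first exact: cvg_cst.
    by apply: cvgM; first exact: cvg_cst.
  have h : r k <= 2 * (C * (2 * E k + 2 * 0)) + 2 * 0.
    by apply: (cvgr_to_ge lim); exact: nearW.
  have -> : 4 * C * E k = 2 * (C * (2 * E k + 2 * 0)) + 2 * 0 by ring.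
  exact: h.
have main k : sqintg mu (fun x => phi k x I - ext0 U u x I) /\
    \int[mu]_x ((phi k x I - ext0 U u x I) ^+ 2) <= 4 * C * E k.
  apply: (sqintg_mono (f_ := fun i x => ext0 (K i) (phi k) x I - ext0 (K i) u x I)).
  - by move=> i; apply: sqintgB; [exact: sK|exact: (phiu _ (cK i) (KU i)).1].
  - move=> x i j ij; have [xi|nxi] := pselect (K i x).
      by rewrite !(ext0_in _ _ xi) !(ext0_in _ _ (Kmono _ _ ij _ xi)).
    by rewrite !(ext0_out _ _ nxi) subrr expr0n sqr_ge0.
  - move=> x; have [Ux|nUx] := pselect (U x); last first.
      rewrite (ext0_out _ _ nUx) -(test_field_ext0 (tphi k)).1 (ext0_out _ _ nUx).
      under eq_fun => i do rewrite !(ext0_out _ _ (contra_not (KU i x) nUx)).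
      exact: cvg_cst.
    have [j _ xj] := UK _ Ux; rewrite (ext0_in _ _ Ux).
    apply: cvg_near_cst; near=> i.
    have xi : K i x by apply: Kmono xj; near: i; exact: nbhs_infty_ge.
    by rewrite !(ext0_in _ _ xi).
  - by move=> i; exact: bound.
split.
  have := sqintgB (sphi 0) (main 0).1.
  by rewrite (_ : (fun x => _ - _) = (fun x => ext0 U u x I))//; apply/funext => x; rewrite opprB addrC subrK.
apply: (squeeze_cvgr _ (cvg_cst 0) (_ : 4 * C * E k @[k --> \oo] --> 0)).
  by apply: nearW => k; rewrite Rint_sqr_ge0 (main k).2.
by rewrite -[X in _ --> X](mulr0 (4 * C)); apply: cvgM => //; exact: cvg_cst.
Unshelve. all: by end_near. Qed.

End potentials.

(** * Uniqueness of potentials on R^n and zero extension of solenoidal fields *)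

Section uniqueness.
Context {R : realType} {n : nat}.
Local Notation V := 'rV[R]_n.
Local Notation mu := (@lebesgue_rV R n).
Implicit Types (U K : set V) (m : nat).

(** On the cube 1 + |x|^2 <= 1 + n M^2, which turns the weighted inequality into a local L^2
    bound. *)
Lemma hardy_cube (v : V -> R) (M : R) : (3 <= n)%N -> Ck 1 v -> csupp v ->
  \int[mu]_x ((\1_(cube M) x * v x) ^+ 2) <=
  (1 + n%:R * M ^+ 2) * (4 * \sum_i \int[mu]_x (pderive i v x ^+ 2)).
Proof.
move=> n3 hv sv.
have cv : cc v by split=> //; exact: Ck_continuous hv.
have d0 (x : V) : 0 < 1 + sqnorm x by rewrite ltr_wpDr ?sqnorm_ge0.
have hrho : Ck 1 (fun x : V => (1 + sqnorm x)^-1).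
  apply: Ck_inv => [x|]; first by rewrite gt_eqF.
  apply: CkD; first exact: Ck_cst.
  by apply: Ck_sum => i; under eq_fun do rewrite expr2; apply: CkM; exact: Ck_coor.
have irho : intg mu (fun x => v x ^+ 2 * (1 + sqnorm x)^-1).
  apply: cc_intg; apply: ccM; last exact: Ck_continuous hrho.
  by under eq_fun do rewrite expr2; apply: ccM => //; exact: cv.1.
have C0 : 0 <= 1 + n%:R * M ^+ 2 by rewrite addr_ge0// mulr_ge0// sqr_ge0.
apply: le_trans (ler_wpM2l C0 (hardy n3 hv sv)).
rewrite -(RintZ _ irho); apply: Rint_le (intgZ _ irho) _ => [|x].
  apply: (sqintg_bounded (C := 1) _ _ (cc_sqintg cv)).2 => [|x].
    by apply: measurable_indic; exact: measurable_box.
  by rewrite indicE; case: (_ \in _); rewrite ?normr1 ?normr0.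
rewrite indicE; case: (boolP (x \in cube M)) => [/set_mem/cubeP xM|_] /=; last first.
  rewrite mul0r expr0n; apply: mulr_ge0 => //; apply: mulr_ge0; first exact: sqr_ge0.
  by rewrite invr_ge0 ltW.
rewrite mul1r mulrCA -[leLHS]mulr1; apply: ler_wpM2l; first exact: sqr_ge0.
rewrite ler_pdivlMr// mul1r lerD2l.
have -> : n%:R * M ^+ 2 = \sum_(i < n) M ^+ 2 by rewrite sumr_const card_ord mulr_natl.
apply: ler_sum => i _; rewrite -(real_normK (num_real (x ord0 i))) ler_pXn2r ?nnegrE ?xM//.
exact: le_trans (normr_ge0 _) (xM i).
Qed.

Lemma test_fieldW U U' m (phi : tfield R n m) : U `<=` U' -> test_field U phi ->
  test_field U' phi.
Proof. by move=> UU [s h]; split=> // I; exact: test_funW UU (h I). Qed.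

Lemma test_fieldB U m (phi psi : tfield R n m) : test_field U phi -> test_field U psi ->
  test_field U (sub_field phi psi).
Proof.
move=> t1 t2; have [h1 h2 _ _] := test_field_diff t1 t2; split=> // I; split; first exact: h2.
have [_ [K1 [cK1 KU1 z1]]] := t1.2 I; have [_ [K2 [cK2 KU2 z2]]] := t2.2 I.
exists (K1 `|` K2); split; [exact: compactU|by move=> x [/KU1|/KU2]|move=> x nx].
have n1 : ~ K1 x by move=> h; apply: nx; left.
have n2 : ~ K2 x by move=> h; apply: nx; right.
by rewrite /sub_field (z1 x n1) (z2 x n2) subrr.
Qed.

Lemma cvg_sqB (a_ b_ : nat -> V -> R) (a b : V -> R) : (forall k, sqintg mu (a_ k)) ->
  (forall k, sqintg mu (b_ k)) -> sqintg mu a -> sqintg mu b ->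
  \int[mu]_x ((a_ k x - a x) ^+ 2) @[k --> \oo] --> 0 ->
  \int[mu]_x ((b_ k x - b x) ^+ 2) @[k --> \oo] --> 0 ->
  \int[mu]_x (((a_ k x - b_ k x) - (a x - b x)) ^+ 2) @[k --> \oo] --> 0.
Proof.
move=> sa_ sb_ sa sb ca cb.
have le k : \int[mu]_x (((a_ k x - b_ k x) - (a x - b x)) ^+ 2) <=
    2 * \int[mu]_x ((a_ k x - a x) ^+ 2) + 2 * \int[mu]_x ((b_ k x - b x) ^+ 2).
  have ia := (sqintgB (sa_ k) sa).2; have ib := (sqintgB (sb_ k) sb).2.
  rewrite -(RintZ 2 ia) -(RintZ 2 ib) -(RintD (intgZ 2 ia) (intgZ 2 ib)).
  apply: Rint_le (intgD (intgZ 2 ia) (intgZ 2 ib)) _ => [|x].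
    exact: (sqintgB (sqintgB (sa_ k) (sb_ k)) (sqintgB sa sb)).2.
  have := sqr_ge0 ((a_ k x - a x) + (b_ k x - b x)).
  by move: (a_ k x) (b_ k x) (a x) (b x) => p q r s; nra.
have lim : 2 * \int[mu]_x ((a_ k x - a x) ^+ 2) +
    2 * \int[mu]_x ((b_ k x - b x) ^+ 2) @[k --> \oo] --> (2 * 0 + 2 * 0 : R).
  by apply: cvgD; apply: cvgM => //; exact: cvg_cst.
rewrite mulr0 addr0 in lim.
apply: (squeeze_cvgr _ (cvg_cst 0) lim); apply: nearW => k.
by rewrite Rint_sqr_ge0 le.
Qed.

Lemma ext0B U m (u v : tfield R n m) x I :
  ext0 U (sub_field u v) x I = ext0 U u x I - ext0 U v x I.
Proof. by rewrite /ext0 /sub_field; case: ifP => // _; rewrite subrr. Qed.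

Lemma sqfieldB m (u v : tfield R n m) : sqfield u -> sqfield v -> sqfield (sub_field u v).
Proof. by move=> su sv I; exact: sqintgB. Qed.

Lemma approxB m (u v : tfield R n m) phi psi g g' :
  h10_approx setT u phi g -> h10_approx setT v psi g' ->
  h10_approx setT (sub_field u v) (fun k => sub_field (phi k) (psi k)) (sub_field g g').
Proof.
rewrite /h10_approx !ext0T => -[t1 c1 s1 sq1 cg1] [t2 c2 s2 sq2 cg2]; split.
- by move=> k; exact: test_fieldB.
- move=> K cK KT; have [sK1 l1] := c1 K cK KT; have [sK2 l2] := c2 K cK KT; split=> [I|I].
    rewrite (_ : (fun x => _) = fun x => ext0 K u x I - ext0 K v x I).
      exact: sqintgB.
    by apply/funext => x; exact: ext0B.
  have sK (p : tfield R n m) : test_field setT p -> sqintg mu (fun x => ext0 K p x I).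
    move=> t; apply: sqfield_restrict (test_field_sqfield t).1 I.
    exact: compact_measurable_rV.
  have := cvg_sqB (fun k => sK _ (t1 k)) (fun k => sK _ (t2 k)) (sK1 I) (sK2 I) (l1 I) (l2 I).
  apply: cvg_trans; apply: near_eq_cvg; apply: nearW => k.
  by apply: eq_Rintegral => x _; rewrite !ext0B.
- by move=> x _ s I; rewrite /sub_field s1// s2.
- exact: sqfieldB.
move=> I; have := cvg_sqB (fun k => (test_field_sqfield (t1 k)).2 I)
  (fun k => (test_field_sqfield (t2 k)).2 I) (sq1 I) (sq2 I) (cg1 I) (cg2 I).
apply: cvg_trans; apply: near_eq_cvg; apply: nearW => k.
have [_ _ _ E] := test_field_diff (t1 k) (t2 k).
by apply: eq_Rintegral => x _; rewrite E.
Qed.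

(** The gradients of [chi k] tend to 0, so Korn and Hardy send [chi k] to 0 in L^2 of every cube,
    where it also tends to [w]. *)
Lemma hardy_unique m (w : tfield R n m) chi g : (3 <= n)%N -> h10_approx setT w chi g ->
  {ae mu, forall x, forall I, g x I = 0} -> {ae mu, forall x, forall I, w x I = 0}.
Proof.
move=> n3; rewrite /h10_approx ext0T => -[tchi cw _ sg cg] g0.
pose E k := \sum_J \int[mu]_x (sgrad (chi k) x J ^+ 2).
have Ec : E k @[k --> \oo] --> 0.
  rewrite [X in _ --> X](_ : _ = \sum_(J : m.+1.-tuple 'I_n) 0); last by rewrite big1.
  apply: cvg_sumR => J; apply: cvg_trans (cg J); apply: near_eq_cvg; apply: nearW => k.
  have st := (test_field_sqfield (tchi k)).2 J.
  apply: Rint_ae; [exact: (intg_measurable (sqintgB st (sg J)).2)|exact: (intg_measurable st.2)|].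
  by apply: filterS g0 => x ->; rewrite subr0.
have main (M : R) I : {ae mu, forall x, ext0 (cube M) w x I = 0}.
  have cM : compact (cube M : set V) by exact: compact_box.
  have [sw lw] := cw _ cM (@subsetT _ _).
  apply: Rint_sq_eq0 (sw I) _; apply/eqP; rewrite eq_le Rint_sqr_ge0 andbT.
  pose C : R := (1 + n%:R * M ^+ 2) * (4 * \sum_(i < n) (m.+1)`!%:R).
  have sc k : sqintg mu (fun x => ext0 (cube M) (chi k) x I).
    exact: sqfield_restrict (compact_measurable_rV cM) (test_field_sqfield (tchi k)).1 I.
  have bound k : \int[mu]_x ((ext0 (cube M) (chi k) x I) ^+ 2) <= C * E k.
    have hc := ((tchi k).2 I).1; have sc' := (test_fun_cc ((tchi k).2 I)).2.
    have -> : \int[mu]_x ((ext0 (cube M) (chi k) x I) ^+ 2) =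
        \int[mu]_x ((\1_(cube M) x * chi k x I) ^+ 2).
      apply: eq_Rintegral => x _; rewrite /ext0 indicE; case: ifP => _.
        by rewrite mul1r.
      by rewrite mul0r.
    apply: le_trans (hardy_cube M n3 (hc 1) sc') _.
    rewrite /C -[leRHS]mulrA; apply: ler_wpM2l.
      by rewrite addr_ge0// mulr_ge0// sqr_ge0.
    rewrite -[leRHS]mulrA ler_wpM2l// mulr_suml; apply: ler_sum => i _.
    apply: korn_comp => [|J|J]; first exact: (tchi k).1.
      exact: ((tchi k).2 J).1.
    exact: (test_fun_cc ((tchi k).2 J)).2.
  have le k : \int[mu]_x ((ext0 (cube M) w x I) ^+ 2) <=
      2 * \int[mu]_x ((ext0 (cube M) (chi k) x I - ext0 (cube M) w x I) ^+ 2) + 2 * (C * E k).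
    have := sqintg_tri (sw I) (sc k) (sqintg0 mu).
    have -> : \int[mu]_x ((ext0 (cube M) w x I - 0) ^+ 2) =
        \int[mu]_x ((ext0 (cube M) w x I) ^+ 2).
      by apply: eq_Rintegral => x _; rewrite subr0.
    have -> : \int[mu]_x ((ext0 (cube M) (chi k) x I - 0) ^+ 2) =
        \int[mu]_x ((ext0 (cube M) (chi k) x I) ^+ 2).
      by apply: eq_Rintegral => x _; rewrite subr0.
    have -> : \int[mu]_x ((ext0 (cube M) w x I - ext0 (cube M) (chi k) x I) ^+ 2) =
        \int[mu]_x ((ext0 (cube M) (chi k) x I - ext0 (cube M) w x I) ^+ 2).
      by apply: eq_Rintegral => x _; rewrite -opprB sqrrN.
    move=> h; apply: (le_trans h); rewrite lerD2l ler_wpM2l//; exact: bound.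
  have lim : 2 * \int[mu]_x ((ext0 (cube M) (chi k) x I - ext0 (cube M) w x I) ^+ 2) +
      2 * (C * E k) @[k --> \oo] --> 2 * 0 + 2 * (C * 0).
    apply: cvgD; first by apply: cvgM; [exact: cvg_cst|exact: lw].
    by apply: cvgM; [exact: cvg_cst|apply: cvgM => //; exact: cvg_cst].
  have : \int[mu]_x ((ext0 (cube M) w x I) ^+ 2) <= 2 * 0 + 2 * (C * 0).
    by apply: (cvgr_to_ge lim); exact: nearW.
  by rewrite !mulr0 addr0.
apply: filter_forall => I; have := ae_foralln (fun k => main k%:R I).
apply: filterS => x h; have [M [M0 /(_ x erefl)/cubeP xM]] := compact_sub_box (@compact_set1 _ x).
have [k Mk] : exists k : nat, M <= k%:R by exists (Num.bound M); rewrite ltW// archi_boundP// ltW.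
have := h k; rewrite ext0_in//; apply/cubeP => i; exact: le_trans (xM i) Mk.
Qed.

(* The test fields are symmetrised multiples of a fixed scalar test function. *)
Lemma solenoidal_ext0 Om m (s : tfield R n m.+1) : measurable Om ->
  symmetric_on Om s -> sqfield (ext0 Om s) ->
  (forall (phi : tfield R n m) D, H1_grad Om phi D -> \int[mu]_(x in Om)
     (\sum_(I : m.+1.-tuple 'I_n) s x I * D (idx_last I) x (idx_front I)) = 0) ->
  solenoidal setT (ext0 Om s).
Proof.
move=> mO ss sqs h; apply/solenoidalE => psi tpsi I; rewrite ext0T.
pose de (J : m.-tuple 'I_n) : R := symmetrisation (fun J' => (I == J')%:R) J.
have de_sym (p : 'S_m) J : de (perm_idx p J) = de J by exact: symmetrisation_sym.
pose phi : tfield R n m := fun x J => de J * psi x.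
pose D j : tfield R n m := fun x J => de J * pderive j psi x.
have spsi := cc_sqintg (test_fun_cc tpsi).
have cdpsi j : cc (pderive j psi).
  split; first exact: Ck_continuous (Cinfty_pderive j tpsi.1 0).
  exact: pderive_csupp (test_fun_cc tpsi).2.
have hD : H1_grad Om phi D.
  split.
  - apply/L2P; split=> [x _ p J|]; first by rewrite /phi de_sym.
    by apply: sqfield_restrict => // J; exact: sqintgZ.
  - move=> j; apply/L2P; split=> [x _ p J|]; first by rewrite /D de_sym.
    by apply: sqfield_restrict => // J; apply: sqintgZ; exact: cc_sqintg.
  move=> j th tth J; rewrite (Rint_ext0 Om (D j) th J) (Rint_ext0 Om phi (pderive j th) J).
  have thC := tth.1; have [_ [K [cK KO th0]]] := tth.
  have clK : closed K by apply: compact_closed => //; exact: norm_hausdorff.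
  have i1 : intg mu (fun x => pderive j psi x * th x).
    by apply: sqintgM; [exact: cc_sqintg|exact: cc_sqintg (test_fun_cc tth)].
  have cdth : cc (pderive j th).
    split; first exact: Ck_continuous (Cinfty_pderive j thC 0).
    exact: pderive_csupp (test_fun_cc tth).2.
  have i2 : intg mu (fun x => psi x * pderive j th x).
    by apply: sqintgM => //; exact: cc_sqintg.
  transitivity (de J * \int[mu]_x (pderive j psi x * th x)).
    rewrite -(RintZ _ i1); apply: eq_Rintegral => x _.
    have [Ox|nOx] := pselect (Om x); first by rewrite ext0_in// /D mulrA.
    by rewrite th0 ?mulr0// => /KO.
  rewrite (Rint_ibp j (tpsi.1 1) (thC 1) (test_fun_cc tpsi).2) mulrN; congr (- _).
  rewrite -(RintZ _ i2); apply: eq_Rintegral => x _.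
  have [Ox|nOx] := pselect (Om x); first by rewrite ext0_in// /phi mulrA.
  have -> : pderive j th x = 0 by apply: (@pderive_eq0 R n th j K clK th0) => /KO.
  by rewrite !mulr0.
have i3 j : intg mu (fun x => ext0 Om s x (rcons_tuple I j) * pderive j psi x).
  by apply: sqintgM => //; exact: cc_sqintg.
rewrite -(Rint_sum _ i3) -[RHS](h _ _ hD) [RHS]Rintegral_mkcond.
apply: eq_Rintegral => x _; rewrite patchE; case: ifPn => [/set_mem Ox|nOx]; last first.
  by apply: big1 => j _; rewrite /ext0 (negbTE nOx) mul0r.
have -> : \sum_(J : m.+1.-tuple 'I_n) s x J * D (idx_last J) x (idx_front J) =
    \sum_(J : m.-tuple 'I_n) \sum_j s x (rcons_tuple J j) * D j x J.
  by rewrite -big_idx; apply: eq_bigr => J _; rewrite rcons_front_last.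
rewrite exchange_big /=; apply: eq_bigr => j _; rewrite ext0_in//.
(* With j fixed, s is symmetric in its first m indices, so pairing it with the symmetrised unit
   tensor [de] returns exactly the component I. *)
have := @sum_sym_delta R n m (fun J => s x (rcons_tuple J j)) I.
move=> <- => [|p J]; last by rewrite rcons_perm_idx ss.
by rewrite mulr_suml; apply: eq_bigr => J _; rewrite /D mulrA.
Qed.

End uniqueness.

(** * The two implications *)

Section parts.
Context {R : realType} {n m : nat}.
Local Notation V := 'rV[R]_n.
Local Notation mu := (@lebesgue_rV R n).
Variables (Om : set V) (f : tfield R n m.+1) (u : tfield R n m) (sf : tfield R n m.+1)
  (uO : tfield R n m) (sfO : tfield R n m.+1) (hO : tfield R n m).
Hypotheses (n_ge1 : (1 <= n)%N) (dom : bounded_lipschitz_domain Om)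
  (f_supp : supported_in Om f)
  (dec_space : helmholtz_space f u sf) (dec_Om : helmholtz_domain Om f uO sfO hO).

Lemma domain_cube : exists2 M : R, 0 < M & Om `<=` cube M.
Proof.
have [_ _ _ [M [Mr hM]] _] := dom; exists (`|M| + 1) => [|x Ox]; first by rewrite ltr_wpDl.
apply/cubeP => i; apply: le_trans (_ : `|x| <= _).
  by rewrite {2}/Num.norm /= mx_normrE; apply/bigmax_geP; right; exists (ord0, i).
apply: hM => //; by rewrite (le_lt_trans (ler_norm M))// ltrDl.
Qed.

Lemma ext0_zero U m' x I : ext0 U (@zero_field R n m') x I = 0.
Proof. by rewrite /ext0 if_same. Qed.

Lemma sqfield_zero U m' : sqfield (ext0 U (@zero_field R n m')).
Proof.
move=> I; rewrite (_ : (fun x => _) = fun=> 0); first exact: sqintg0.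
by apply/funext => x; exact: ext0_zero.
Qed.

(** The integral of |s|^2 is that of s against G1 - G2, hence 0. Both implications end here, with a
    field that is orthogonal to each of the two parts it is a difference of. *)
Lemma sum_sq_ae0 m' (s G1 G2 : tfield R n m') : sqfield s -> sqfield G1 -> sqfield G2 ->
  {ae mu, forall x, forall I, s x I = G1 x I - G2 x I} ->
  \sum_I \int[mu]_x (G1 x I * s x I) = 0 -> \sum_I \int[mu]_x (G2 x I * s x I) = 0 ->
  {ae mu, forall x, forall I, s x I = 0}.
Proof.
move=> qs q1 q2 sE z1 z2.
have e I : \int[mu]_x (s x I ^+ 2) = \int[mu]_x (G1 x I * s x I) - \int[mu]_x (G2 x I * s x I).
  have i1 := sqintgM (q1 I) (qs I); have i2 := sqintgM (q2 I) (qs I).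
  rewrite -(RintB i1 i2).
  apply: Rint_ae; [exact: intg_measurable (qs I).2|exact: intg_measurable (intgB i1 i2)|].
  by apply: filterS sE => x sx; rewrite -mulrBl -sx expr2.
have : \sum_I \int[mu]_x (s x I ^+ 2) = 0.
  under eq_bigr do rewrite e.
  by rewrite sumrB z1 z2 subrr.
move/eqP; rewrite psumr_eq0 => [/allP h|I _]; last exact: Rint_sqr_ge0.
apply: filter_forall => I; apply: Rint_sq_eq0 (qs I) _.
by apply/eqP; exact: (h I (mem_index_enum I)).
Qed.

(** The same test fields serve on R^n: by [domain_approx] they converge in L^2 up to the boundary of
    [Om], hence to the zero extension on every compact subset of R^n. *)
Lemma ext0_approx phi g : h10_approx Om uO phi g ->
  h10_approx setT (ext0 Om uO) phi (ext0 Om g).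
Proof.
move=> A; have [tphi _ sg qg phig] := A.
have [oO _ O0 _ _] := dom; have [M M0 OM] := domain_cube.
have key := domain_approx (Ordinal n_ge1) oO O0 OM M0 A.
have mK (K : set V) : compact K -> measurable K by exact: compact_measurable_rV.
rewrite /h10_approx ext0T; split=> //.
  by move=> k; apply: test_fieldW (tphi k).
move=> K cK _; split=> [|I].
  by apply: sqfield_restrict; [exact: mK|move=> I; exact: (key I).1].
apply: (squeeze_cvgr _ (cvg_cst 0) (key I).2); apply: nearW => k.
rewrite Rint_sqr_ge0 /=.
have sp := (test_field_sqfield (tphi k)).1 I.
have sK : sqintg mu (fun x => ext0 K (phi k) x I).
  exact: sqfield_restrict (mK _ cK) (test_field_sqfield (tphi k)).1 I.
have su : sqintg mu (fun x => ext0 K (ext0 Om uO) x I).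
  apply: (sqfield_restrict (mK _ cK)) => J; exact: (key J).1.
apply: Rint_le (sqintgB sK su).2 (sqintgB sp (key I).1).2 _ => x.
have [Kx|nKx] := pselect (K x); first by rewrite !(ext0_in _ _ Kx).
by rewrite !(ext0_out _ _ nKx) subrr expr0n sqr_ge0.
Qed.

Lemma harmonic_free_decomposition : is_sgrad Om hO (@zero_field R n m.+1) ->
  [/\ ae_eq_field sf (ext0 Om sfO), dotH10_eq setT u (ext0 Om uO) &
      (3 <= n)%N -> ae_eq_field u (ext0 Om uO)].
Proof.
move=> h0; have [oO _ O0 _ _] := dom.
have [Hu /L2P[]] := dec_space; rewrite ext0T => ssf qsf sol [du [/L2P[_]]].
rewrite ext0T => qdu gdu fE.
have /dotH10P[su [phi [g A]]] := Hu.
have [/dotH10P[suO [phiO [gO AO]]] [/L2P[ssfO qsfO] testO] _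
  [duO [dh [[/L2P[_ qduO] gduO] [/L2P[_ qdh] gdh] _ fOE]]]] := dec_Om.
have [tphi _ sg qg phig] := A; have [tphiO _ sgO qgO phigO] := AO.
(* The gradients [du] and [duO] of the decompositions are replaced by the limits [g] and [gO], which
   come with the approximating test fields that the orthogonality argument uses. *)
have a1 : {ae mu, forall x, forall I, ext0 setT g x I = ext0 setT du x I}.
  by apply: (sgrad_unique openT qg _ (sgrad_lim A) gdu); rewrite ext0T.
have a2 : {ae mu, forall x, forall I, ext0 Om gO x I = ext0 Om duO x I}.
  exact: (sgrad_unique oO qgO qduO (sgrad_lim AO) gduO).
have a3 : {ae mu, forall x, forall I, ext0 Om dh x I = ext0 Om (@zero_field R n m.+1) x I}.
  have q0 : sqfield (ext0 Om (@zero_field R n m.+1)) by exact: sqfield_zero.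
  exact: (sgrad_unique oO qdh q0 gdh h0).
rewrite !ext0T in a1 qg sg phig.
pose s := sub_field (ext0 Om sfO) sf.
(* On [Om] the two decompositions of f are compared, with dh = 0. Off [Om], f = 0 gives -sf = du,
   while the extended fields are 0. *)
have sE : {ae mu, forall x, forall I, s x I = g x I - ext0 Om gO x I}.
  apply: filterS3 (filterI a1 a2) (filterI a3 fE) (filterI fOE f_supp) => x.
  move=> [e1 e2] [e3 ef] [eO e0] I; rewrite e1 e2 /s /sub_field.
  have [Ox|nOx] := pselect (Om x); last first.
    by have := ef I; rewrite (e0 nOx) !(ext0_out _ _ nOx) => h; lra.
  have := e3 I; have := eO Ox I; rewrite ef ext0_zero !(ext0_in _ _ Ox) => h1 h2; lra.
have qs : sqfield s by exact: sqfieldB.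
have ss : symmetric_on setT s.
  move=> x _ p I; rewrite /s /sub_field ssf// (ext0_sym ssfO)//.
have sols : solenoidal setT s.
  have mO : measurable Om by exact: open_measurable_rV.
  have /solenoidalE hO1 := solenoidal_ext0 mO ssfO qsfO testO.
  move/solenoidalE : sol => hsf; apply/solenoidalE => psi tpsi I.
  have cd j : sqintg mu (pderive j psi).
    apply: cc_sqintg; split; first exact: Ck_continuous (Cinfty_pderive j tpsi.1 0).
    exact: pderive_csupp (test_fun_cc tpsi).2.
  have h1 := hO1 _ tpsi I; have h2 := hsf _ tpsi I; rewrite ext0T in h1; rewrite ext0T in h2.
  transitivity (\sum_j \int[mu]_x (ext0 Om sfO x (rcons_tuple I j) * pderive j psi x) -
      \sum_j \int[mu]_x (sf x (rcons_tuple I j) * pderive j psi x)).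
    rewrite ext0T -sumrB; apply: eq_bigr => j _.
    rewrite -(RintB (sqintgM (qsfO _) (cd j)) (sqintgM (qsf _) (cd j))).
    by apply: eq_Rintegral => x _; rewrite -mulrBl.
  by rewrite h1 h2 subrr.
have zs : {ae mu, forall x, forall I, s x I = 0}.
  apply: (sum_sq_ae0 qs qg qgO sE).
    have := sgrad_orth_solenoidal tphi qg phig; move=> /(_ s); rewrite ext0T; exact.
  have tO k : test_field setT (phiO k) by apply: test_fieldW (tphiO k).
  have := sgrad_orth_solenoidal tO qgO phigO; move=> /(_ s); rewrite ext0T; exact.
have gz : {ae mu, forall x, forall I, sub_field g (ext0 Om gO) x I = 0}.
  by apply: filterS2 sE zs => x e z I; rewrite -[RHS](z I) e.
(* [D] presents u - ext0 uO as a limit of differences of test fields with limit gradient g - ext0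
   gO, which vanishes almost everywhere by [gz]. *)
have B := ext0_approx AO; have D := approxB A B.
split.
- by apply: filterS zs => x z I; apply/eqP; rewrite eq_sym -subr_eq0; apply/eqP; exact: z.
- split=> //.
    by apply/dotH10P; split; [exact: ext0_sym|exists phiO, (ext0 Om gO)].
  have q0 : sqfield (ext0 setT (@zero_field R n m.+1)) by exact: sqfield_zero.
  have qB : sqfield (ext0 setT (sub_field g (ext0 Om gO))).
    by rewrite ext0T; exact: sqfieldB.
  apply: (sgrad_congr qB q0 _ (sgrad_lim D)).
  by rewrite ext0T; apply: filterS gz => x z I; rewrite z ext0_zero.
move=> n3; have := hardy_unique n3 D gz.
by apply: filterS => x z I; apply/eqP; rewrite -subr_eq0; apply/eqP; exact: z.
Qed.

Lemma supported_decomposition : supported_in Om sf -> supported_in Om u ->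
  is_sgrad Om hO (@zero_field R n m.+1).
Proof.
move=> sf_supp u_supp; have [oO _ O0 _ lip] := dom; have [M M0 OM] := domain_cube.
have mO : measurable Om by exact: open_measurable_rV.
have [Hu /L2P[]] := dec_space; rewrite ext0T => ssf qsf sol [du [/L2P[sdu]]].
rewrite ext0T => qdu gdu fE; have [Lu _] := Hu.
have [/dotH10P[suO [phiO [gO AO]]] [/L2P[ssfO qsfO] testO] [D HD]
  [duO [dh [[/L2P[_ qduO] gduO] [/L2P[sdh qdh] gdh] soldh fOE]]]] := dec_Om.
have [tphiO _ sgO qgO phigO] := AO.
have [/L2P[sh qh] LD wg] := HD.
have qD j : sqfield (ext0 Om (D j)) by have /L2P[] := LD j.
have a2 : {ae mu, forall x, forall I, ext0 Om gO x I = ext0 Om duO x I}.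
  exact: (sgrad_unique oO qgO qduO (sgrad_lim AO) gduO).
(* u is only locally square-integrable; [Om] lies in a compact cube. *)
have qO : sqfield (ext0 Om u).
  have cM : compact (cube M : set V) by exact: compact_box.
  rewrite -(ext0_ext0 u OM); apply: sqfield_restrict => //.
  exact: L2loc_sqfield Lu cM (@subsetT _ _).
have qsfO' : sqfield (ext0 Om sf) by exact: sqfield_restrict.
have qduO' : sqfield (ext0 Om du) by exact: sqfield_restrict.
have du_supp : {ae mu, forall x, ~ Om x -> forall I, du x I = 0}.
  apply: filterS3 fE sf_supp f_supp => x e s0 f0 nO I.
  by have := e I; rewrite s0// f0// addr0.
(* The symmetrised weak derivatives of [hO] are a weak symmetric gradient of [hO], hence equal to
   dh. Against symmetric fields dh can thus be traded for all the derivatives [D], which occur in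
   the orthogonality of sfO and in the adjoint of the divergence. *)
pose E : tfield R n m.+1 := fun x I =>
  symmetrisation (fun J => D (idx_last J) x (idx_front J)) I.
have EE x I : ext0 Om E x I =
    symmetrisation (fun J => ext0 Om (D (idx_last J)) x (idx_front J)) I.
  rewrite /ext0 /E; case: (x \in Om) => //; exact/esym/symmetrisation0.
have qE : sqfield (ext0 Om E).
  move=> I; rewrite (_ : (fun x => _) = fun x =>
    symmetrisation (fun J => ext0 Om (D (idx_last J)) x (idx_front J)) I).
    by apply: sqintgZ; apply: sqintg_sum => s; exact: qD.
  by apply/funext => x; exact: EE.
have gE : is_sgrad Om hO E.
  apply/is_sgradE => psi tpsi I; rewrite -symmetrisationN.
  have sp := cc_sqintg (test_fun_cc tpsi).
  have iD J : intg mu (fun x => ext0 Om (D (idx_last J)) x (idx_front J) * psi x).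
    exact: sqintgM (qD _ _) sp.
  transitivity (\int[mu]_x symmetrisation (fun J =>
      ext0 Om (D (idx_last J)) x (idx_front J) * psi x) I).
    apply: eq_Rintegral => x _; rewrite EE /symmetrisation -mulrA mulr_suml.
    by [].
  rewrite (Rint_symmetrisation _ iD); apply: eq_symmetrisation => J.
  have := wg (idx_last J) psi tpsi (idx_front J).
  by rewrite (Rint_ext0 Om (D (idx_last J)) psi) (Rint_ext0 Om hO (pderive (idx_last J) psi)).
have a3 : {ae mu, forall x, forall I, ext0 Om dh x I = ext0 Om E x I}.
  exact: (sgrad_unique oO qdh qE gdh gE).
have pairE (s : tfield R n m.+1) : symmetric_on Om s -> sqfield (ext0 Om s) ->
    \sum_I \int[mu]_x (ext0 Om s x I * ext0 Om dh x I) =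
    \sum_(I : m.+1.-tuple 'I_n)
      \int[mu]_x (ext0 Om s x I * ext0 Om (D (idx_last I)) x (idx_front I)).
  move=> ss qs; have iE I := sqintgM (qs I) (qE I).
  have iD (I : m.+1.-tuple 'I_n) := sqintgM (qs I) (qD (idx_last I) (idx_front I)).
  transitivity (\sum_I \int[mu]_x (ext0 Om s x I * ext0 Om E x I)).
    apply: eq_bigr => I _; apply: Rint_ae.
    - exact: intg_measurable (sqintgM (qs I) (qdh I)).
    - exact: intg_measurable (iE I).
    - by apply: filterS a3 => x ->.
  rewrite -(Rint_sum _ iE) -(Rint_sum _ iD); apply: eq_Rintegral => x _.
  under eq_bigr do rewrite EE.
  by apply: sum_symmetrisation => p I; exact: ext0_sym.
have z1 : \sum_I \int[mu]_x (ext0 Om gO x I * ext0 Om dh x I) = 0.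
  exact: sgrad_orth_solenoidal tphiO qgO phigO (ext0_sym sdh) qdh soldh.
have z2 : \sum_I \int[mu]_x (ext0 Om sfO x I * ext0 Om dh x I) = 0.
  have iD (I : m.+1.-tuple 'I_n) := sqintgM (qsfO I) (qD (idx_last I) (idx_front I)).
  rewrite (pairE _ ssfO qsfO) -[RHS](testO _ _ HD) -(Rint_sum _ iD) [RHS]Rintegral_mkcond.
  apply: eq_Rintegral => x _; rewrite patchE /ext0; case: (x \in Om) => //.
  by apply: big1 => I _; rewrite mul0r.
have out m' (v : tfield R n m') I x : ~ Om x -> ext0 Om v x I = 0 by exact: ext0_out.
have Rint0 (psi : V -> R) : \int[mu]_x (0 * psi x) = 0.
  by rewrite -[RHS](Rintegral0 mu); apply: eq_Rintegral => x _; rewrite mul0r.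
have cd U (psi : V -> R) j : test_fun U psi -> cc (pderive j psi).
  move=> tpsi; split; first exact: Ck_continuous (Cinfty_pderive j tpsi.1 0).
  exact: pderive_csupp (test_fun_cc tpsi).2.
(* Doubling with L the symmetric gradient: p = u, Lp = du, q = dh and Lq = Div dh = 0. The
   coefficients are the matrix of the symmetrisation. *)
have z3 : \sum_I \int[mu]_x (ext0 Om du x I * ext0 Om dh x I) = 0.
  pose c (a : m.-tuple 'I_n) (I : m.+1.-tuple 'I_n) j : R :=
    symmetrisation (fun J => (rcons_tuple a j == J)%:R) I.
  have Hp psi : test_fun setT psi -> forall I, \int[mu]_x (ext0 Om du x I * psi x) =
      - \sum_a \sum_j c a I j * \int[mu]_x (ext0 Om u x a * pderive j psi x).
    move=> tpsi I; have sp := cc_sqintg (test_fun_cc tpsi).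
    transitivity (\int[mu]_x (du x I * psi x)).
      apply: Rint_ae.
      - exact: intg_measurable (sqintgM (qduO' I) sp).
      - exact: intg_measurable (sqintgM (qdu I) sp).
      apply: filterS du_supp => x h; have [Ox|nOx] := pselect (Om x).
        by rewrite ext0_in.
      by rewrite ext0_out// h.
    (* The comparison passes through a cube carrying the derivative of [psi], since u itself is
       square-integrable only on compact sets. *)
    have uE J j : \int[mu]_x (u x J * pderive j psi x) =
        \int[mu]_x (ext0 Om u x J * pderive j psi x).
      have [L [L0 dL]] := (cd _ _ j tpsi).2.
      have cL : compact (cube L : set V) by exact: compact_box.
      have qL := L2loc_sqfield Lu cL (@subsetT _ _).
      have sd := cc_sqintg (cd _ _ j tpsi).
      transitivity (\int[mu]_x (ext0 (cube L) u x J * pderive j psi x)).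
        apply: eq_Rintegral => x _; have [Lx|nLx] := pselect (cube L x).
          by rewrite ext0_in.
        by rewrite dL// !mulr0.
      apply: Rint_ae.
      - exact: intg_measurable (sqintgM (qL J) sd).
      - exact: intg_measurable (sqintgM (qO J) sd).
      apply: filterS u_supp => x h; have [Lx|nLx] := pselect (cube L x); last first.
        by rewrite dL// !mulr0.
      rewrite (ext0_in _ _ Lx); have [Ox|nOx] := pselect (Om x); first by rewrite ext0_in.
      by rewrite (ext0_out _ _ nOx) h.
    have /is_sgradE/(_ psi tpsi I) := gdu; rewrite !ext0T => ->; congr (- _).
    rewrite symmetrisation_delta -big_idx; apply: eq_bigr => J _.
    by rewrite uE /c rcons_front_last.
  have Hq psi : test_fun Om psi -> forall a : m.-tuple 'I_n, \int[mu]_x (0 * psi x) =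
      - \sum_I \sum_j c a I j * \int[mu]_x (ext0 Om dh x I * pderive j psi x).
    move=> tpsi a; rewrite Rint0.
    have /solenoidalE/(_ psi tpsi a) := soldh => sz.
    rewrite exchange_big -[LHS]oppr0 -[in LHS]sz; congr (- _); apply: eq_bigr => j _.
    have := @sum_sym_delta R n _
      (fun I => \int[mu]_x (ext0 Om dh x I * pderive j psi x)) (rcons_tuple a j).
    move=> <- => [|p I]; first by apply: eq_bigr => I _; rewrite mulrC.
    by apply: eq_Rintegral => x _; rewrite (ext0_sym sdh).
  have := @doubling_ibp R n Om M _ _ c (fun (a : m.-tuple 'I_n) x => ext0 Om u x a)
    (fun _ _ => 0) (fun (I : m.+1.-tuple 'I_n) x => ext0 Om dh x I)
    (fun I x => ext0 Om du x I) OM qO (fun _ => sqintg0 mu)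
    qdh qduO' (fun a x => out _ u a x) (fun _ _ _ => erefl)
    (fun a x => out _ dh a x) (fun a x => out _ du a x) Hp Hq oO lip.
  rewrite big1 ?add0r// => a _.
  by rewrite -[RHS](Rintegral0 mu); apply: eq_Rintegral => x _; rewrite mulr0.
(* Doubling with L the divergence: p = sf, Lp = 0, q = hO and Lq the weak derivatives [D]. The
   coefficient selects the multi-index obtained by appending j. *)
have z4 : \sum_I \int[mu]_x (ext0 Om sf x I * ext0 Om dh x I) = 0.
  have ssf' : symmetric_on Om sf by move=> x _ p I; exact: ssf.
  rewrite (pairE _ ssf' qsfO').
  pose c (I : m.+1.-tuple 'I_n) (J : m.-tuple 'I_n) j : R := (I == rcons_tuple J j)%:R.
  have Hp psi : test_fun setT psi -> forall J : m.-tuple 'I_n, \int[mu]_x (0 * psi x) =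
      - \sum_I \sum_j c I J j * \int[mu]_x (ext0 Om sf x I * pderive j psi x).
    move=> tpsi J; rewrite Rint0.
    have /solenoidalE/(_ psi tpsi J) := sol; rewrite ext0T => sz.
    rewrite exchange_big -[LHS]oppr0 -[in LHS]sz; congr (- _); apply: eq_bigr => j _.
    rewrite (bigD1 (rcons_tuple J j))//= /c eqxx mul1r [X in _ + X]big1 ?addr0; last first.
      by move=> I /negbTE ->; rewrite mul0r.
    have sd := cc_sqintg (cd _ _ j tpsi).
    apply: Rint_ae.
    - exact: intg_measurable (sqintgM (qsf _) sd).
    - exact: intg_measurable (sqintgM (qsfO' _) sd).
    apply: filterS sf_supp => x h; have [Ox|nOx] := pselect (Om x).
      by rewrite ext0_in.
    by rewrite ext0_out// h.
  have Hq psi : test_fun Om psi -> forall I : m.+1.-tuple 'I_n,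
      \int[mu]_x (ext0 Om (D (idx_last I)) x (idx_front I) * psi x) =
      - \sum_J \sum_j c I J j * \int[mu]_x (ext0 Om hO x J * pderive j psi x).
    move=> tpsi I; have := wg (idx_last I) psi tpsi (idx_front I).
    rewrite (Rint_ext0 Om (D (idx_last I)) psi) (Rint_ext0 Om hO (pderive (idx_last I) psi)).
    move=> ->; congr (- _); rewrite -big_idx (bigD1 I)//= /c rcons_front_last eqxx mul1r.
    rewrite [X in _ + X]big1 ?addr0// => J.
    by rewrite rcons_front_last eq_sym => /negbTE ->; rewrite mul0r.
  have := @doubling_ibp R n Om M _ _ c (fun (I : m.+1.-tuple 'I_n) x => ext0 Om sf x I)
    (fun I x => ext0 Om (D (idx_last I)) x (idx_front I))
    (fun (J : m.-tuple 'I_n) x => ext0 Om hO x J) (fun _ _ => 0) OM qsfO'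
    (fun I => qD (idx_last I) (idx_front I)) qh (fun _ => sqintg0 mu)
    (fun a x => out _ sf a x) (fun I x => out _ (D (idx_last I)) (idx_front I) x)
    (fun a x => out _ hO a x) (fun _ _ _ => erefl) Hp Hq oO lip.
  by rewrite [X in _ + X]big1 ?addr0// => J _; exact: Rint0.
(* dh = G1 - G2 is the difference of the two decompositions of f on [Om]. [G2] uses [gO] instead of
   duO because [z1] rests on its approximating test fields. *)
pose G1 : tfield R n m.+1 := fun x I => ext0 Om du x I + ext0 Om sf x I.
pose G2 : tfield R n m.+1 := fun x I => ext0 Om gO x I + ext0 Om sfO x I.
have q1 : sqfield G1 by move=> I; exact: sqintgD.
have q2 : sqfield G2 by move=> I; exact: sqintgD.
have dhE : {ae mu, forall x, forall I, ext0 Om dh x I = G1 x I - G2 x I}.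
  apply: filterS3 a2 fE fOE => x e ef eO I; rewrite /G1 /G2 e.
  have [Ox|nOx] := pselect (Om x); last by rewrite !(ext0_out _ _ nOx) !addr0 subrr.
  by have := eO Ox I; rewrite ef !(ext0_in _ _ Ox) => h; lra.
have add0 (a b : tfield R n m.+1) : sqfield a -> sqfield b ->
    \sum_I \int[mu]_x (a x I * ext0 Om dh x I) = 0 ->
    \sum_I \int[mu]_x (b x I * ext0 Om dh x I) = 0 ->
    \sum_I \int[mu]_x ((a x I + b x I) * ext0 Om dh x I) = 0.
  move=> qa qb za zb; transitivity (\sum_I \int[mu]_x (a x I * ext0 Om dh x I) +
      \sum_I \int[mu]_x (b x I * ext0 Om dh x I)); last by rewrite za zb addr0.
  rewrite -big_split; apply: eq_bigr => I _.
  rewrite /= -(RintD (sqintgM (qa I) (qdh I)) (sqintgM (qb I) (qdh I))).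
  by apply: eq_Rintegral => x _; rewrite mulrDl.
have dh0 : {ae mu, forall x, forall I, ext0 Om dh x I = 0}.
  apply: (sum_sq_ae0 qdh q1 q2 dhE); first exact: add0 qduO' qsfO' z3 z4.
  exact: add0 qgO qsfO z1 z2.
have q0 : sqfield (ext0 Om (@zero_field R n m.+1)) by exact: sqfield_zero.
apply: (sgrad_congr qdh q0 _ gdh).
by apply: filterS dh0 => x z I; rewrite z ext0_zero.
Qed.

End parts.

Theorem lemma1 (R : realType) (n m : nat) (n_ge1 : (1 <= n)%N)
    (Omega : set 'rV[R]_n) (Omega_dom : bounded_lipschitz_domain Omega)
    (f : tfield R n m.+1) (f_L2 : L2 setT f) (f_supp : supported_in Omega f)
    (u : tfield R n m) (sf : tfield R n m.+1)
    (uO : tfield R n m) (sfO : tfield R n m.+1) (hO : tfield R n m)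
    (dec_space : helmholtz_space f u sf)
    (dec_Omega : helmholtz_domain Omega f uO sfO hO) :
  (is_sgrad Omega hO (@zero_field R n m.+1) ->
     [/\ ae_eq_field sf (ext0 Omega sfO),
         dotH10_eq setT u (ext0 Omega uO) &
         (3 <= n)%N -> ae_eq_field u (ext0 Omega uO)])
  /\
  (supported_in Omega sf -> supported_in Omega u ->
     is_sgrad Omega hO (@zero_field R n m.+1)).
Proof.
split; first exact: harmonic_free_decomposition n_ge1 Omega_dom f_supp dec_space dec_Omega.
exact: supported_decomposition Omega_dom f_supp dec_space dec_Omega.
Qed.
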